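(* For the quantum group $\mathfrak{D}$ at $\mathbb{S}_3$ attached to the 12-dimensional Fomin–Kirillov algebra, the nonzero proper $\mathfrak{D}$-submodules of the Verma module $\mathsf{M}(e,\rho)$ are $\mathsf{S}(e,\rho)\subset\mathsf{X}(e,\rho)$, where (i) $\mathsf{X}(e,\rho)=\mathfrak{D}\mathsf{E}$ is a highest-weight submodule of weight $(\sigma,-)$; (ii) $\mathsf{S}(e,\rho)=\mathfrak{D}\mathsf{C}$ is a highest-weight submodule of weight $(\tau,0)$. Here $\mathsf{E}\subset\mathsf{M}^{-1}(e,\rho)$ is the $\mathfrak{D}(\mathbb{S}_3)$-submodule of weight $(\sigma,-)$ with basis $\mathsf{e}_i=\zeta^i(1-\sigma\tau^i)x_{\sigma\tau^{i}}|\tau\rangle_\rho$, $i=0,1,2$, and $\mathsf{C}\subset\mathsf{M}^{-2}(e,\rho)$ is the $\mathfrak{D}(\mathbb{S}_3)$-submodule of weight $(\tau,0)$ with basis $\mathsf{c}=(\zeta x_{(13)}x_{(12)}-x_{(12)}x_{(23)})|\tau\rangle_\rho+(x_{(12)}x_{(23)}-\zeta^{-1}x_{(13)}x_{(12)})|\tau^{-1}\rangle_\rho$ and $\sigma\mathsf{c}$. Therefore the composition factors of $\mathsf{M}(e,\rho)$, counted with multiplicity, are $\mathsf{L}(e,\rho),\mathsf{L}(\sigma,-),\mathsf{L}(\tau,0)$.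
   Context: $\Bbbk$ is an algebraically closed field of characteristic zero, $\zeta\in\Bbbk$ a fixed primitive cube root of $1$; $\sigma=(12)$, $\tau=(123)$ in $\mathbb{S}_3$, permutations composed right to left, so $\sigma\tau=(23)$, $\sigma\tau^2=(13)$. $V=\Bbbk\{x_{(12)},x_{(23)},x_{(13)}\}$ is the Yetter–Drinfeld module over $\Bbbk\mathbb{S}_3$ with $g\cdot x_{(ij)}=\mathrm{sgn}(g)x_{g(ij)g^{-1}}$ and coaction $x_{(ij)}\mapsto(ij)\otimes x_{(ij)}$; $x_{\sigma\tau^t}$ means $x_{(ij)}$ for $(ij)=\sigma\tau^t$. Its Nichols algebra $\mathfrak{B}(V)=\bigoplus_{n=0}^4\mathfrak{B}^n(V)$ is the 12-dimensional Fomin–Kirillov algebra. $\mathfrak{D}$ is the Drinfeld double of the bosonization $\mathfrak{B}(V)\#\Bbbk\mathbb{S}_3$. Explicitly, $\mathfrak{D}$ is the algebra generated by $x_{(ij)}$, $y_{(ij)}$ (transpositions $(ij)$) and $g,\delta_g$ ($g\in\mathbb{S}_3$), where the $g$ multiply as in $\mathbb{S}_3$, the $\delta_g$ are orthogonal idempotents with sum $1$, and, for distinct $i,j,k$ and $g,h\in\mathbb{S}_3$: $x_{(ij)}^2=0$, $x_{(ij)}x_{(ik)}+x_{(jk)}x_{(ij)}+x_{(ik)}x_{(jk)}=0$; the same relations for the $y$'s; $\delta_hg=g\delta_{g^{-1}hg}$; $gx_{(ij)}=\mathrm{sgn}(g)x_{g(ij)g^{-1}}g$; $\delta_hx_{(ij)}=x_{(ij)}\delta_{(ij)h}$;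 $\delta_gy_{(ij)}=y_{(ij)}\delta_{(ij)g}$; $y_{(ij)}g=\mathrm{sgn}(g)\,g\,y_{g^{-1}(ij)g}$; $y_{(ij)}x_{(ij)}+x_{(ij)}y_{(ij)}=1+(ij)(\delta_{(ij)}-\delta_e)$; $y_{(ik)}x_{(ij)}+x_{(ij)}y_{(jk)}=(ij)(\delta_{(ik)}-\delta_{(ik)(ij)})$. The $g,\delta_g$ generate the Drinfeld double $\mathfrak{D}(\mathbb{S}_3)$ of $\Bbbk\mathbb{S}_3$; $\overline V=\Bbbk\{y_{(ij)}\}$ generates $\mathfrak{B}(\overline V)$; multiplication $\mathfrak{B}(V)\otimes\mathfrak{D}(\mathbb{S}_3)\otimes\mathfrak{B}(\overline V)\to\mathfrak{D}$ is a linear isomorphism. Simple $\mathfrak{D}(\mathbb{S}_3)$-modules relevant here (''degree $h$'' means $\delta_h$ acts as identity and other $\delta$'s by $0$): $M(e,\rho)$, concentrated in degree $e$, is the 2-dimensional irreducible $\mathbb{S}_3$-submodule of the permutation module $\Bbbk\{\mathbf 1,\mathbf 2,\mathbf 3\}$, with basis $|\tau^{\pm1}\rangle_\rho=\zeta^{\mp1}\mathbf 1+\zeta^{\pm1}\mathbf 2+\mathbf 3$; $M(\sigma,-)$ with basis $|12\rangle,|23\rangle,|13\rangle$, $|ij\rangle$ of degree $(ij)$, $g|ij\rangle=\mathrm{sgn}(g)|g(ij)g^{-1}\rangle$; $M(\tau,0)$ with basis $|\tau\rangle,|\tau^{-1}\rangle$, $|\tau^{\pm1}\rangle$ of degree $\tau^{\pm1}$,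 $\tau^t|\tau^{\pm1}\rangle=|\tau^{\pm1}\rangle$, $\sigma\tau^t|\tau^{\pm1}\rangle=|\tau^{\mp1}\rangle$. A $\mathfrak{D}(\mathbb{S}_3)$-module is of weight $(g,\varrho)$ if it is isomorphic to $M(g,\varrho)$. Let $\mathfrak{D}^{\ge0}$ be the subalgebra generated by $\mathfrak{D}(\mathbb{S}_3)$ and $\overline V$; a simple $\mathfrak{D}(\mathbb{S}_3)$-module $M(g,\varrho)$ is a $\mathfrak{D}^{\ge0}$-module with $\overline V$ acting by $0$. The Verma module is $\mathsf{M}(g,\varrho)=\mathfrak{D}\otimes_{\mathfrak{D}^{\ge0}}M(g,\varrho)=\mathfrak{B}(V)\otimes M(g,\varrho)$, graded with $\mathsf{M}^n(g,\varrho)=\mathfrak{B}^{-n}(V)\otimes M(g,\varrho)$, $n\le0$; write $x|h\rangle$ for $x\otimes|h\rangle$. $\mathsf{X}(g,\varrho)$ is its unique maximal $\mathfrak{D}$-submodule, $\mathsf{L}(g,\varrho)$ its head and $\mathsf{S}(g,\varrho)$ its socle. A $\mathfrak{D}$-module is a highest-weight module of weight $(g,\varrho)$ if it is generated by a $\mathfrak{D}(\mathbb{S}_3)$-submodule $M$ of weight $(g,\varrho)$ with $\overline VM=0$. *)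

(* Defs.v *)
From HB Require Import structures.
From mathcomp Require Import all_boot all_order all_algebra fingroup perm.
From mathcomp Require Import ring.
From mathcomp Require Import boolp classical_sets generic_quotient.

Set Implicit Arguments.
Unset Strict Implicit.
Unset Printing Implicit Defensive.

Import GRing.Theory.
Local Open Scope ring_scope.
Local Open Scope quotient_scope.
Local Open Scope classical_set_scope.

(* The points 1, 2, 3 are encoded as 0, 1, 2 : 'I_3.  The product of 'S_3 in
   MathComp composes left to right, whereas here permutations compose right to
   left; \circ is the latter. *)
Notation "g \circ h" := ((h * g)%g : 'S_3)
  (at level 40, left associativity, format "g  \circ  h").

Definition pt1 : 'I_3 := @Ordinal 3 0 isT.
Definition pt2 : 'I_3 := @Ordinal 3 1 isT.
Definition pt3 : 'I_3 := @Ordinal 3 2 isT.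

Definition s12 : 'S_3 := tperm pt1 pt2.
Definition s23 : 'S_3 := tperm pt2 pt3.
Definition s13 : 'S_3 := tperm pt1 pt3.

Definition sigma : 'S_3 := s12.
(* The 3-cycle 1 -> 2 -> 3 -> 1. *)
Definition tau : 'S_3 := s12 \circ s23.

Lemma I3_cases (x : 'I_3) : [\/ x = pt1, x = pt2 | x = pt3].
Proof.
have : x \in [:: pt1; pt2; pt3] by case: x => -[|[|[|]]] //.
by rewrite !inE => /or3P [] /eqP ->; constructor.
Qed.

Lemma S3_eq (g h : 'S_3) :
  g pt1 = h pt1 -> g pt2 = h pt2 -> g pt3 = h pt3 -> g = h.
Proof. by move=> *; apply/permP => x; case: (I3_cases x) => ->. Qed.

Lemma tperm3E (a b c : 'I_3) :
  tperm a b c = if c == a then b else if c == b then a else c.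
Proof. by rewrite permE. Qed.

Lemma tauVE : (tau^-1)%g = s23 \circ s12.
Proof. by rewrite invMg !tpermV. Qed.

Lemma S3_cases (g : 'S_3) :
  [\/ g = 1%g, g = s12, g = s23 | g = s13] \/ g = tau \/ g = tau^-1%g.
Proof.
have n12 : g pt1 != g pt2 by rewrite (inj_eq perm_inj).
have n13 : g pt1 != g pt3 by rewrite (inj_eq perm_inj).
have n23 : g pt2 != g pt3 by rewrite (inj_eq perm_inj).
case: (I3_cases (g pt1)) (I3_cases (g pt2)) (I3_cases (g pt3)) =>
  e1 [] e2 [] e3; rewrite e1 e2 e3 // in n12 n13 n23; rewrite tauVE;
  [ left; constructor 1 | left; constructor 3 | left; constructor 2
  | right; left | right; right | left; constructor 4];
  by apply: S3_eq; rewrite ?e1 ?e2 ?e3 /tau /s12 /s23 /s13 ?permM ?perm1 ?tperm3E.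
Qed.


Inductive gen := GX of 'S_3 | GY of 'S_3 | GG of 'S_3 | GD of 'S_3.

(* GX t, GY t, GG g, GD h stand for x_t, y_t, g, delta_h.  Only the x_t and y_t
   with t a transposition, i.e., t odd, are wanted: rel_x0 and rel_y0 remove the
   others. *)
Record Dalg_relations (k : fieldType) (A : algType k) (v : gen -> A) : Prop := {
  rel_x0 : forall t : 'S_3, ~~ odd_perm t -> v (GX t) = 0;
  rel_y0 : forall t : 'S_3, ~~ odd_perm t -> v (GY t) = 0;
  rel_g1 : v (GG 1%g) = 1;
  rel_gM : forall g h : 'S_3, v (GG (g \circ h)) = v (GG g) * v (GG h);
  rel_dM : forall g h : 'S_3,
    v (GD g) * v (GD h) = if g == h then v (GD g) else 0;
  rel_d1 : \sum_(g : 'S_3) v (GD g) = 1;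
  rel_xx : forall i j : 'I_3, i != j ->
    v (GX (tperm i j)) * v (GX (tperm i j)) = 0;
  rel_xxx : forall i j l : 'I_3, i != j -> i != l -> j != l ->
    v (GX (tperm i j)) * v (GX (tperm i l))
    + v (GX (tperm j l)) * v (GX (tperm i j))
    + v (GX (tperm i l)) * v (GX (tperm j l)) = 0;
  rel_yy : forall i j : 'I_3, i != j ->
    v (GY (tperm i j)) * v (GY (tperm i j)) = 0;
  rel_yyy : forall i j l : 'I_3, i != j -> i != l -> j != l ->
    v (GY (tperm i j)) * v (GY (tperm i l))
    + v (GY (tperm j l)) * v (GY (tperm i j))
    + v (GY (tperm i l)) * v (GY (tperm j l)) = 0;
  rel_dg : forall g h : 'S_3,
    v (GD h) * v (GG g) = v (GG g) * v (GD (g^-1%g \circ h \circ g));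
  rel_gx : forall (g : 'S_3) (i j : 'I_3), i != j ->
    v (GG g) * v (GX (tperm i j))
    = (-1) ^+ odd_perm g * v (GX (g \circ tperm i j \circ g^-1%g)) * v (GG g);
  rel_dx : forall (h : 'S_3) (i j : 'I_3), i != j ->
    v (GD h) * v (GX (tperm i j))
    = v (GX (tperm i j)) * v (GD (tperm i j \circ h));
  rel_dy : forall (g : 'S_3) (i j : 'I_3), i != j ->
    v (GD g) * v (GY (tperm i j))
    = v (GY (tperm i j)) * v (GD (tperm i j \circ g));
  rel_yg : forall (g : 'S_3) (i j : 'I_3), i != j ->
    v (GY (tperm i j)) * v (GG g)
    = (-1) ^+ odd_perm g * v (GG g) * v (GY (g^-1%g \circ tperm i j \circ g));
  rel_yx : forall i j : 'I_3, i != j ->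
    v (GY (tperm i j)) * v (GX (tperm i j))
    + v (GX (tperm i j)) * v (GY (tperm i j))
    = 1 + v (GG (tperm i j)) * (v (GD (tperm i j)) - v (GD 1%g));
  rel_yx' : forall i j l : 'I_3, i != j -> i != l -> j != l ->
    v (GY (tperm i l)) * v (GX (tperm i j))
    + v (GX (tperm i j)) * v (GY (tperm j l))
    = v (GG (tperm i j))
      * (v (GD (tperm i l)) - v (GD (tperm i l \circ tperm i j)))
}.

Inductive term (k : Type) :=
  | TGen of gen
  | TScal of k
  | TAdd of term k & term k
  | TMul of term k & term k.
Arguments TGen {k}.

HB.instance Definition _ (k : Type) := gen_eqMixin (term k).
HB.instance Definition _ (k : Type) := gen_choiceMixin (term k).

Fixpoint eval (k : fieldType) (A : algType k) (v : gen -> A) (t : term k) : A :=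
  match t with
  | TGen s => v s
  | TScal a => a%:A
  | TAdd t1 t2 => eval v t1 + eval v t2
  | TMul t1 t2 => eval v t1 * eval v t2
  end.

Section Double.
Variable k : fieldType.
Implicit Types t u : term k.

(* Two noncommutative polynomials in the generators agree in the algebra
   presented by the relations iff they agree in every algebra in which the
   relations hold; Dalg below is that algebra (dgen_relations, dlift). *)
Definition term_eqv t u : Prop :=
  forall (A : algType k) (v : gen -> A), Dalg_relations v -> eval v t = eval v u.

Definition term_eqvb t u : bool := `[< term_eqv t u >].

Lemma term_eqvb_refl : reflexive term_eqvb.
Proof. by move=> t; apply/asboolP. Qed.

Lemma term_eqvb_sym : symmetric term_eqvb.
Proof.
by move=> t u; apply/asboolP/asboolP => h A v r; rewrite (h A v r).
Qed.

Lemma term_eqvb_trans : transitive term_eqvb.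
Proof.
move=> u t w /asboolP h1 /asboolP h2; apply/asboolP => A v r.
by rewrite (h1 A v r) (h2 A v r).
Qed.

Canonical term_equiv :=
  EquivRel term_eqvb term_eqvb_refl term_eqvb_sym term_eqvb_trans.

Definition Dalg : Type := {eq_quot term_equiv}.
HB.instance Definition _ := EqQuotient.on Dalg.
HB.instance Definition _ := Choice.on Dalg.

Definition dpi t : Dalg := \pi_Dalg t.

Lemma dpiP t u : dpi t = dpi u <-> term_eqv t u.
Proof. by split=> [/eqmodP/asboolP|h]; [|apply/eqmodP/asboolP]. Qed.

Lemma eval_repr (A : algType k) (v : gen -> A) t :
  Dalg_relations v -> eval v (repr (dpi t)) = eval v t.
Proof. by move=> r; have /dpiP/(_ A v r) := reprK (dpi t). Qed.

Lemma dpiW (P : Dalg -> Prop) : (forall t, P (dpi t)) -> forall a, P a.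
Proof. by move=> h a; rewrite -(reprK a); apply: h. Qed.

Definition dzero := dpi (TScal 0).
Definition done_ := dpi (TScal 1).
Definition dadd (a b : Dalg) := dpi (TAdd (repr a) (repr b)).
Definition dmul (a b : Dalg) := dpi (TMul (repr a) (repr b)).
Definition dscale (c : k) (a : Dalg) := dpi (TMul (TScal c) (repr a)).
Definition dopp (a : Dalg) := dscale (-1) a.

Local Ltac dtac :=
  repeat (elim/dpiW=> ?); apply/dpiP => ? v r;
  rewrite /= ?eval_repr //= ?eval_repr //=.

Lemma daddA : associative dadd.
Proof. by move=> a b c; move: a b c; dtac; rewrite addrA. Qed.
Lemma daddC : commutative dadd.
Proof. by move=> a b; move: a b; dtac; rewrite addrC. Qed.
Lemma dadd0 : left_id dzero dadd.
Proof. by move=> a; move: a; dtac; rewrite scale0r add0r. Qed.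
Lemma daddN : left_inverse dzero dopp dadd.
Proof. by dtac; rewrite scaleN1r mulN1r addNr scale0r. Qed.
HB.instance Definition _ := GRing.isZmodule.Build Dalg daddA daddC dadd0 daddN.

Lemma dmulA : associative dmul.
Proof. by dtac; rewrite mulrA. Qed.
Lemma dmul1 : left_id done_ dmul.
Proof. by dtac; rewrite scale1r mul1r. Qed.
Lemma dmulr1 : right_id done_ dmul.
Proof. by dtac; rewrite scale1r mulr1. Qed.
Lemma dmulDl : left_distributive dmul dadd.
Proof. by dtac; rewrite mulrDl. Qed.
Lemma dmulDr : right_distributive dmul dadd.
Proof. by dtac; rewrite mulrDr. Qed.


HB.instance Definition _ := GRing.Zmodule_isPzRing.Build Dalg
  dmulA dmul1 dmulr1 dmulDl dmulDr.

Definition counit (s : gen) : k^o :=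
  match s with
  | GX _ | GY _ => 0
  | GG _ => 1
  | GD g => (g == 1%g)%:R
  end.

Lemma tperm_neq1 (i j : 'I_3) : i != j -> (tperm i j == 1%g) = false.
Proof. by move=> ij; apply/eqP => /(congr1 (@odd_perm _)); rewrite odd_tperm odd_perm1 ij. Qed.

Lemma counit_relations : Dalg_relations counit.
Proof.
split=> //=; try (by move=> *; rewrite ?mul0r ?mulr0 ?mul1r ?addr0).
- move=> g h; rewrite -natrM mulnb; case: (g =P h) => [->|ne].
    by rewrite andbb.
  by case: eqP => // g1; case: eqP => // h1; case: ne; rewrite g1 h1.
- by rewrite (bigD1 1%g) //= eqxx big1 ?addr0 // => g /negPf ->.
- move=> g h; rewrite mulr1 mul1r; congr (_%:R); congr nat_of_bool.
  by rewrite mulgA -eq_mulgV1 -{2}(mulg1 g) (inj_eq (mulgI g)).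
- by move=> g i j _; rewrite !mulr0 mul0r.
- by move=> i j ij; rewrite mul0r addr0 mul1r eqxx tperm_neq1 // sub0r subrr.
- move=> i j l ij il jl; rewrite mul0r addr0 mul1r tperm_neq1 // sub0r.
  case: eqP => [/permP/(_ j)|]; last by rewrite oppr0.
  by rewrite permM tpermR tpermL perm1 => /eqP; rewrite eq_sym (negPf jl).
Qed.

Lemma done_neq0 : (1 : Dalg) != 0.
Proof.
apply/eqP => h; have := (dpiP (TScal 1) (TScal 0)).1 h _ _ counit_relations.
by rewrite /= scale1r scale0r => /eqP; rewrite oner_eq0.
Qed.
HB.instance Definition _ := GRing.PzSemiRing_isNonZero.Build Dalg done_neq0.

Lemma dscaleA (a b : k) (m : Dalg) : dscale a (dscale b m) = dscale (a * b) m.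
Proof. by move: m; dtac; rewrite !mulr_algl scalerA. Qed.
Lemma dscale1 : left_id 1 dscale.
Proof. by dtac; rewrite scale1r mul1r. Qed.
Lemma dscaleDr : right_distributive dscale dadd.
Proof. by move=> a; dtac; rewrite mulrDr. Qed.
Lemma dscaleDl (m : Dalg) : {morph dscale^~ m : a b / a + b >-> dadd a b}.
Proof. by move=> a b; move: m; dtac; rewrite scalerDl mulrDl. Qed.
HB.instance Definition _ := GRing.Zmodule_isLmodule.Build k Dalg
  dscaleA dscale1 dscaleDr dscaleDl.

Lemma dscaleAl (a : k) (b c : Dalg) : 
  dscale a (dmul b c) = dmul (dscale a b) c.
Proof. by move: b c; dtac; rewrite mulrA. Qed.
HB.instance Definition _ := GRing.Lmodule_isLalgebra.Build k Dalg dscaleAl.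
Lemma dscaleAr (a : k) (b c : Dalg) : 
  dscale a (dmul b c) = dmul b (dscale a c).
Proof. by move: b c; dtac; rewrite !mulr_algl scalerAr. Qed.
HB.instance Definition _ := GRing.Lalgebra_isAlgebra.Build k Dalg dscaleAr.

Definition dgen (s : gen) : Dalg := dpi (TGen s).


Section Universal.
Variables (A : algType k) (v : gen -> A) (rel_v : Dalg_relations v).

Definition dlift (_ : Dalg_relations v) (a : Dalg) : A := eval v (repr a).
Local Notation f := (dlift rel_v).

Lemma dliftE t : f (dpi t) = eval v t.
Proof. exact: eval_repr. Qed.

Lemma dlift_is_zmod_morphism : zmod_morphism f.
Proof.
move=> a b; rewrite (dliftE (TAdd (repr a) (repr (- b)))) -[LHS]/(f a + f (- b)).
by rewrite [f (- b)](dliftE (TMul (TScal (-1)) (repr b))) /= scaleN1r mulN1r.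
Qed.
Lemma dlift_is_monoid_morphism : monoid_morphism f.
Proof.
split=> [|a b]; first by rewrite (dliftE (TScal 1)) /= scale1r.
by rewrite (dliftE (TMul (repr a) (repr b))).
Qed.
Lemma dlift_is_scalable : scalable f.
Proof.
by move=> c a; rewrite (dliftE (TMul (TScal c) (repr a))) /= mulr_algl.
Qed.
HB.instance Definition _ := GRing.isZmodMorphism.Build Dalg A f
  dlift_is_zmod_morphism.
HB.instance Definition _ := GRing.isMonoidMorphism.Build Dalg A f
  dlift_is_monoid_morphism.
HB.instance Definition _ := GRing.isScalable.Build k Dalg A *:%R f
  dlift_is_scalable.

Lemma dlift_gen s : f (dgen s) = v s.
Proof. exact: dliftE. Qed.

End Universal.

Lemma Dalg_ext (a b : Dalg) :
  (forall (A : algType k) (v : gen -> A) (r : Dalg_relations v),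
    dlift r a = dlift r b) -> a = b.
Proof.
elim/dpiW: a => t; elim/dpiW: b => u h; apply/dpiP => A v r.
by have := h A v r; rewrite !dliftE.
Qed.

Lemma dgen_relations : Dalg_relations dgen.
Proof.
have E := (rmorph0, rmorph1, rmorphD, rmorphN, rmorphM, rmorph_sign).
split=> *; apply: Dalg_ext => A v r; have [] := r => *;
  rewrite ?E /= ?dlift_gen; auto.
- by rewrite (rel_dM r); case: ifP; rewrite ?rmorph0 ?dlift_gen.
- by rewrite rmorph_sum /=; under eq_bigr do rewrite dlift_gen.
Qed.

End Double.


Record ds3Module (k : fieldType) := DS3Module {
  ds_sort :> lmodType k;
  ds_g : 'S_3 -> ds_sort -> ds_sort;
  ds_d : 'S_3 -> ds_sort -> ds_sort;
  ds_gL : forall g, linear (ds_g g);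
  ds_dL : forall h, linear (ds_d h);
  ds_g1 : forall m, ds_g 1%g m = m;
  ds_gM : forall g h m, ds_g (g \circ h) m = ds_g g (ds_g h m);
  ds_dM : forall g h m, ds_d g (ds_d h m) = if g == h then ds_d g m else 0;
  ds_d1 : forall m, \sum_(h : 'S_3) ds_d h m = m;
  ds_dg : forall g h m,
    ds_d h (ds_g g m) = ds_g g (ds_d (g^-1%g \circ h \circ g) m)
}.

Section Rho.
Variables (k : fieldType) (zeta : k).

Definition perm_vec (i : 'I_3) : 'rV[k]_3 := delta_mx 0 i.

(* The permutation module: g sends the i-th basis vector to the (g i)-th. *)
Definition perm_act (g : 'S_3) (v : 'rV[k]_3) : 'rV[k]_3 :=
  \row_i v 0 ((g^-1)%g i).

Lemma perm_act_vec g i : perm_act g (perm_vec i) = perm_vec (g i).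
Proof.
by apply/rowP => j; rewrite !mxE eqxx /= -(inj_eq (@perm_inj _ g)) permKV.
Qed.

(* |tau>_rho is rho_vec zeta and |tau^-1>_rho is rho_vec zeta^-1; likewise for
   rho_ket below. *)
Definition rho_vec (w : k) : 'rV[k]_3 :=
  w^-1 *: perm_vec pt1 + w *: perm_vec pt2 + perm_vec pt3.

Definition rho_space : {vspace 'rV[k]_3} :=
  <<[:: rho_vec zeta; rho_vec zeta^-1]>>%VS.

Definition rho_type := subvs_of rho_space.
Definition rho_g (g : 'S_3) (u : rho_type) : rho_type :=
  vsproj rho_space (perm_act g (vsval u)).
Definition rho_d (h : 'S_3) (u : rho_type) : rho_type :=
  if h == 1%g then u else 0.
Definition rho_ket (w : k) : rho_type := vsproj rho_space (rho_vec w).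

Variable zetaP : 3.-primitive_root zeta.

Lemma zeta_neq0 : zeta != 0.
Proof.
apply/eqP => z0; have /eqP := prim_expr_order zetaP.
by rewrite z0 expr0n eq_sym oner_eq0.
Qed.

Lemma zeta_sum : 1 + zeta + zeta ^+ 2 = 0.
Proof.
have z1 : zeta - 1 != 0.
  by rewrite subr_eq0 -(prim_order_dvd zetaP 1).
have h : (zeta - 1) * (1 + zeta + zeta ^+ 2) = zeta ^+ 3 - 1 by ring.
by apply: (mulfI z1); rewrite mulr0 h (prim_expr_order zetaP) subrr.
Qed.

Lemma zetaVE : zeta^-1 = zeta ^+ 2.
Proof.
apply: (mulfI zeta_neq0); rewrite divff ?zeta_neq0 //.
by rewrite -exprS (prim_expr_order zetaP).
Qed.

Lemma rho_vecE (w : k) : [/\ rho_vec w 0 pt1 = w^-1, rho_vec w 0 pt2 = w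
  & rho_vec w 0 pt3 = 1].
Proof. by split; rewrite !mxE /=; ring. Qed.

Lemma rho_spaceP (v : 'rV[k]_3) :
  (v \in rho_space) = (v 0 pt1 + v 0 pt2 + v 0 pt3 == 0).
Proof.
have [a1 a2 a3] := rho_vecE zeta; have [b1 b2 b3] := rho_vecE zeta^-1.
have zs : zeta^-1 + zeta + 1 = 0 by rewrite zetaVE -[RHS]zeta_sum; ring.
have hm a b i : (a *: rho_vec zeta + b *: rho_vec zeta^-1) 0 i
    = a * rho_vec zeta 0 i + b * rho_vec zeta^-1 0 i.
  by rewrite mxE [X in X + _]mxE [X in _ + X]mxE.
apply/idP/eqP => [|v0].
  rewrite /rho_space span_cons span_seq1.
  case/memv_addP => [x /vlineP [a ->]] [y /vlineP [b ->]] ->.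
  rewrite !hm a1 a2 a3 b1 b2 b3 invrK.
  have -> : zeta^-1 = - (zeta + 1) by apply/eqP; rewrite -addr_eq0 addrA zs.
  by ring.
have d0 : zeta - zeta^-1 != 0.
  rewrite subr_eq0; apply/eqP => h.
  have : zeta ^+ 2 == 1 by rewrite expr2 {2}h divff ?zeta_neq0.
  by rewrite -(prim_order_dvd zetaP 2).
pose a := (v 0 pt2 - zeta^-1 * v 0 pt3) / (zeta - zeta^-1).
have -> : v = a *: rho_vec zeta + (v 0 pt3 - a) *: rho_vec zeta^-1.
  have ad : a * (zeta - zeta^-1) = v 0 pt2 - zeta^-1 * v 0 pt3.
    by rewrite divfK.
  have e2 : v 0 pt2 = a * zeta + (v 0 pt3 - a) * zeta^-1.
    by rewrite -[LHS](subrK (zeta^-1 * v 0 pt3)) -ad; ring.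
  have e1 : v 0 pt1 = a * zeta^-1 + (v 0 pt3 - a) * zeta.
    have -> : v 0 pt1 = - (v 0 pt2 + v 0 pt3).
      by apply/eqP; rewrite -addr_eq0 addrA v0.
    rewrite e2.
    have -> : zeta^-1 = - (zeta + 1).
      by apply/eqP; rewrite -addr_eq0 addrA zs.
    by ring.
  apply/rowP => -[[|[|[|//]]] i3]; rewrite hm.
  - have -> : Ordinal i3 = pt1 by apply: val_inj.
    by rewrite a1 b1 invrK.
  - have -> : Ordinal i3 = pt2 by apply: val_inj.
    by rewrite a2 b2.
  - have -> : Ordinal i3 = pt3 by apply: val_inj.
    by rewrite a3 b3; ring.
by rewrite memvD // memvZ // memv_span // !inE eqxx ?orbT.
Qed.

Lemma rho_stable g (u : 'rV[k]_3) : u \in rho_space -> perm_act g u \in rho_space.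
Proof.
have E (w : 'rV[k]_3) : w 0 pt1 + w 0 pt2 + w 0 pt3 = \sum_i w 0 i.
  rewrite !big_ord_recl big_ord0 addr0 addrA.
  by congr (w 0 _ + w 0 _ + w 0 _); apply: val_inj.
rewrite !rho_spaceP !E; under [in X in _ -> X]eq_bigr do rewrite mxE.
by rewrite [in X in _ -> X](reindex_inj (@perm_inj _ g)); under [in X in _ -> X]eq_bigr do rewrite permK.
Qed.

Lemma rho_val g (u : rho_type) : vsval (rho_g g u) = perm_act g (vsval u).
Proof. by rewrite vsprojK // rho_stable // subvsP. Qed.

Lemma rho_gL g : linear (rho_g g).
Proof.
move=> a u v; rewrite /rho_g -linearP; congr (vsproj _ _).
by rewrite linearP; apply/rowP => i; rewrite !mxE.
Qed.
Lemma rho_dL h : linear (rho_d h).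
Proof. by move=> a u v; rewrite /rho_d; case: ifP => //; rewrite scaler0 addr0. Qed.
Lemma rho_g1 u : rho_g 1%g u = u.
Proof.
by apply: val_inj; rewrite /= rho_val; apply/rowP => i; rewrite mxE invg1 perm1.
Qed.
Lemma rho_gM g h u : rho_g (g \circ h) u = rho_g g (rho_g h u).
Proof.
by apply: val_inj; rewrite /= !rho_val; apply/rowP => i; rewrite !mxE invMg permM.
Qed.
Lemma rho_dM g h u : rho_d g (rho_d h u) = if g == h then rho_d g u else 0.
Proof.
rewrite /rho_d; case: (g =P h) => [->|ne]; first by case: (h == 1%g).
by case: eqP => // g1; case: eqP => // h1; case: ne; rewrite g1 h1.
Qed.
Lemma rho_d1 u : \sum_(h : 'S_3) rho_d h u = u.
Proof.
by rewrite (bigD1 1%g) //= /rho_d eqxx big1 ?addr0 // => g /negPf ->.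
Qed.
Lemma rho_dg g h u :
  rho_d h (rho_g g u) = rho_g g (rho_d (g^-1%g \circ h \circ g) u).
Proof.
have -> : rho_d (g^-1%g \circ h \circ g) = rho_d h.
  rewrite /rho_d; have -> // : (g * (h * g^-1) == 1)%g = (h == 1%g).
  by rewrite mulgA -eq_mulgV1 -{2}(mulg1 g) (inj_eq (mulgI g)).
rewrite /rho_d; case: ifP => // _.
by have := rho_gL g (-1) u u; rewrite scaleN1r addNr => ->; rewrite scaleN1r addNr.
Qed.

Definition M_e_rho : ds3Module k :=
  DS3Module rho_gL rho_dL rho_g1 rho_gM rho_dM rho_d1 rho_dg.

End Rho.

Section Sigma.
Variable k : fieldType.

(* The odd elements of S_3 are its transpositions. *)
Definition transposition := {t : 'S_3 | odd_perm t}.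

Lemma conj_transpositionP (g : 'S_3) (t : transposition) :
  odd_perm (g \circ val t \circ g^-1%g).
Proof. by rewrite !odd_permM odd_permV (valP t); case: (odd_perm g). Qed.

Definition conj_transposition (g : 'S_3) (t : transposition) : transposition :=
  Sub (g \circ val t \circ g^-1%g) (conj_transpositionP g t).

(* A function f stands for the sum of the f (ij) |ij>. *)
Definition sgn_type := {ffun transposition -> k^o}.
Definition sgn_ket (t : transposition) : sgn_type := [ffun s => (s == t)%:R].
Definition sgn_g (g : 'S_3) (f : sgn_type) : sgn_type :=
  [ffun t => (-1) ^+ odd_perm g * f (conj_transposition g^-1%g t)].
Definition sgn_d (h : 'S_3) (f : sgn_type) : sgn_type :=
  [ffun t => if val t == h then f t else 0].

Lemma conj_transposition1 t : conj_transposition 1%g t = t.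
Proof. by apply: val_inj; rewrite /= invg1 mulg1 mul1g. Qed.
Lemma conj_transpositionM g h t :
  conj_transposition (g \circ h) t = conj_transposition g (conj_transposition h t).
Proof. by apply: val_inj; rewrite /= invMg !mulgA. Qed.

Lemma sgn_g_ket g t :
  sgn_g g (sgn_ket t) = (-1) ^+ odd_perm g *: sgn_ket (conj_transposition g t).
Proof.
apply/ffunP => s; rewrite !ffunE; congr (_ * (_)%:R); congr nat_of_bool.
apply/eqP/eqP => [<-|->]; rewrite -conj_transpositionM ?mulVg ?mulgV;
  exact/esym/conj_transposition1 || exact/conj_transposition1.
Qed.

Lemma sgn_gL g : linear (sgn_g g).
Proof.
move=> a u v; apply/ffunP => t; rewrite !ffunE mulrDr; congr (_ + _).
by rewrite /GRing.scale /= mulrCA.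
Qed.
Lemma sgn_dL h : linear (sgn_d h).
Proof.
move=> a u v; apply/ffunP => t; rewrite !ffunE.
by case: ifP => // _; rewrite scaler0 addr0.
Qed.
Lemma sgn_g1 f : sgn_g 1%g f = f.
Proof.
by apply/ffunP => t; rewrite ffunE odd_perm1 mul1r invg1 conj_transposition1.
Qed.
Lemma sgn_gM g h f : sgn_g (g \circ h) f = sgn_g g (sgn_g h f).
Proof.
apply/ffunP => t; rewrite !ffunE odd_permM invMg conj_transpositionM.
by rewrite mulrA -signr_addb addbC.
Qed.
Lemma sgn_dM g h f : sgn_d g (sgn_d h f) = if g == h then sgn_d g f else 0.
Proof.
apply/ffunP => t; rewrite !ffunE; case: (g =P h) => [->|ne]; rewrite !ffunE.
  by case: eqP.
by case: eqP => // e1; case: eqP => // e2; case: ne; rewrite -e1 -e2.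
Qed.
Lemma sgn_d1 f : \sum_(h : 'S_3) sgn_d h f = f.
Proof.
apply/ffunP => t; rewrite sum_ffunE (bigD1 (val t)) //= ffunE eqxx big1 ?addr0 //.
by move=> g /negPf; rewrite ffunE eq_sym => ->.
Qed.
Lemma sgn_dg g h f :
  sgn_d h (sgn_g g f) = sgn_g g (sgn_d (g^-1%g \circ h \circ g) f).
Proof.
apply/ffunP => t; rewrite !ffunE /= invgK.
rewrite (inj_eq (mulgI g)) (inj_eq (mulIg _)).
by case: ifP; rewrite ?mulr0.
Qed.

Definition M_sigma_sgn : ds3Module k :=
  DS3Module sgn_gL sgn_dL sgn_g1 sgn_gM sgn_dM sgn_d1 sgn_dg.

End Sigma.

Section Tau.
Variable k : fieldType.

(* A function f stands for f true |tau> + f false |tau^-1>; even permutations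
   fix |tau> and |tau^-1>, odd ones exchange them. *)
Definition tau_deg (b : bool) : 'S_3 := if b then tau else tau^-1%g.
Definition tau_type := {ffun bool -> k^o}.
Definition tau_g (g : 'S_3) (f : tau_type) : tau_type :=
  [ffun b => f (b (+) odd_perm g)].
Definition tau_d (h : 'S_3) (f : tau_type) : tau_type :=
  [ffun b => if tau_deg b == h then f b else 0].

Lemma tau_gL g : linear (tau_g g).
Proof. by move=> a u v; apply/ffunP => b; rewrite !ffunE. Qed.
Lemma tau_dL h : linear (tau_d h).
Proof.
move=> a u v; apply/ffunP => t; rewrite !ffunE.
by case: ifP => // _; rewrite scaler0 addr0.
Qed.
Lemma tau_g1 f : tau_g 1%g f = f.
Proof. by apply/ffunP => b; rewrite ffunE odd_perm1 addbF. Qed.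
Lemma tau_gM g h f : tau_g (g \circ h) f = tau_g g (tau_g h f).
Proof. by apply/ffunP => b; rewrite !ffunE odd_permM addbA addbAC. Qed.
Lemma tau_dM g h f : tau_d g (tau_d h f) = if g == h then tau_d g f else 0.
Proof.
apply/ffunP => t; rewrite !ffunE; case: (g =P h) => [->|ne]; rewrite !ffunE.
  by case: eqP.
by case: eqP => // e1; case: eqP => // e2; case: ne; rewrite -e1 -e2.
Qed.
Lemma tau_d1 f : \sum_(h : 'S_3) tau_d h f = f.
Proof.
apply/ffunP => t; rewrite sum_ffunE (bigD1 (tau_deg t)) //= ffunE eqxx big1 ?addr0 //.
by move=> g /negPf; rewrite ffunE eq_sym => ->.
Qed.

Lemma tau_degJ b (g : 'S_3) :
  tau_deg (b (+) odd_perm g) = g^-1%g \circ tau_deg b \circ g.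
Proof.
have [[]|[]] := S3_cases g => ->; rewrite /tau_deg;
  rewrite /tau ?tauVE /s12 /s23 /s13 ?odd_permM ?odd_perm1 ?odd_tperm /=;
  case: b; rewrite ?tauVE /tau /s12 /s23 /s13 ?invMg ?tpermV ?invg1;
  by apply: S3_eq; rewrite ?permM ?perm1 ?tperm3E.
Qed.

Lemma tau_dg g h f :
  tau_d h (tau_g g f) = tau_g g (tau_d (g^-1%g \circ h \circ g) f).
Proof.
apply/ffunP => t; rewrite !ffunE tau_degJ.
by rewrite (inj_eq (mulgI g)) (inj_eq (mulIg _)).
Qed.

Definition M_tau_0 : ds3Module k :=
  DS3Module tau_gL tau_dL tau_g1 tau_gM tau_dM tau_d1 tau_dg.

End Tau.


Definition Dx (k : fieldType) (t : 'S_3) : Dalg k := dgen k (GX t).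
Definition Dy (k : fieldType) (t : 'S_3) : Dalg k := dgen k (GY t).
Definition Dg (k : fieldType) (g : 'S_3) : Dalg k := dgen k (GG g).
Definition Dd (k : fieldType) (h : 'S_3) : Dalg k := dgen k (GD h).

Section Verma.
Variables (k : fieldType) (M : ds3Module k).
Local Notation D := (Dalg k).

(* [ge0_act s m m'] says that s lies in the subalgebra of D generated by
   D(S_3) and the y's, and that m' = s m, where the y's act on M by 0. *)
Inductive ge0_act : D -> M -> M -> Prop :=
  | ge0_g g m : ge0_act (Dg k g) m (ds_g g m)
  | ge0_d h m : ge0_act (Dd k h) m (ds_d h m)
  | ge0_y t m : ge0_act (Dy k t) m 0
  | ge0_scalar (a : k) m : ge0_act a%:A m (a *: m)
  | ge0_add r s m m1 m2 :
      ge0_act r m m1 -> ge0_act s m m2 -> ge0_act (r + s) m (m1 + m2)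
  | ge0_mul r s m m1 m2 :
      ge0_act s m m1 -> ge0_act r m1 m2 -> ge0_act (r * s) m m2.

Record balanced (N : zmodType) (b : D -> M -> N) : Prop := {
  balancedDl : forall a a' m, b (a + a') m = b a m + b a' m;
  balancedDr : forall a m m', b a (m + m') = b a m + b a m';
  balancedA : forall a s m m', ge0_act s m m' -> b (a * s) m = b a m'
}.

(* The tensor product of D and M over the above subalgebra: formal sums of
   pure tensors, identified when every balanced map identifies them.  D acts by
   left multiplication. *)
Definition tensor_eval (N : zmodType) (b : D -> M -> N) (s : seq (D * M)) : N :=
  \sum_(p <- s) b p.1 p.2.

Definition tensor_eqv (s t : seq (D * M)) : Prop :=
  forall (N : zmodType) (b : D -> M -> N), balanced b ->
    tensor_eval b s = tensor_eval b t.

Definition tensor_eqvb s t : bool := `[< tensor_eqv s t >].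

Lemma tensor_eqvb_refl : reflexive tensor_eqvb.
Proof. by move=> t; apply/asboolP. Qed.

Lemma tensor_eqvb_sym : symmetric tensor_eqvb.
Proof.
by move=> t u; apply/asboolP/asboolP => h N b r; rewrite (h N b r).
Qed.

Lemma tensor_eqvb_trans : transitive tensor_eqvb.
Proof.
move=> u t w /asboolP h1 /asboolP h2; apply/asboolP => N b r.
by rewrite (h1 N b r) (h2 N b r).
Qed.

Canonical tensor_equiv :=
  EquivRel tensor_eqvb tensor_eqvb_refl tensor_eqvb_sym tensor_eqvb_trans.

Definition verma : Type := {eq_quot tensor_equiv}.
HB.instance Definition _ := EqQuotient.on verma.
HB.instance Definition _ := Choice.on verma.

Definition vpi s : verma := \pi_verma s.

Lemma vpiP s t : vpi s = vpi t <-> tensor_eqv s t.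
Proof. by split=> [/eqmodP/asboolP|h]; [|apply/eqmodP/asboolP]. Qed.

Lemma tensor_eval_repr (N : zmodType) (b : D -> M -> N) s :
  balanced b -> tensor_eval b (repr (vpi s)) = tensor_eval b s.
Proof. by move=> r; have /vpiP/(_ N b r) := reprK (vpi s). Qed.

Lemma vpiW (P : verma -> Prop) : (forall s, P (vpi s)) -> forall v, P v.
Proof. by move=> h v; rewrite -(reprK v); apply: h. Qed.

Definition tensor_act (a : D) (s : seq (D * M)) := [seq (a * p.1, p.2) | p <- s].

Lemma tensor_eval_nil (N : zmodType) (b : D -> M -> N) : tensor_eval b [::] = 0.
Proof. exact: big_nil. Qed.
Lemma tensor_eval_cat (N : zmodType) (b : D -> M -> N) s t :
  tensor_eval b (s ++ t) = tensor_eval b s + tensor_eval b t.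
Proof. exact: big_cat. Qed.
Lemma tensor_eval_act (N : zmodType) (b : D -> M -> N) a s :
  tensor_eval b (tensor_act a s) = tensor_eval (fun c m => b (a * c) m) s.
Proof. exact: big_map. Qed.

Lemma balanced_lmul (N : zmodType) (b : D -> M -> N) a :
  balanced b -> balanced (fun c m => b (a * c) m).
Proof.
move=> [bl br ba]; split=> [c c' m|c m m'|c s m m' sm]; first by rewrite mulrDr bl.
  by rewrite br.
by rewrite mulrA; apply: ba.
Qed.

Lemma balanced0 (N : zmodType) (b : D -> M -> N) m : balanced b -> b 0 m = 0.
Proof.
by move=> [bl _ _]; apply: (addrI (b 0 m)); rewrite -bl !addr0.
Qed.

Definition vzero := vpi [::].
Definition vadd (u v : verma) := vpi (repr u ++ repr v).
Definition vscale (a : D) (v : verma) := vpi (tensor_act a (repr v)).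
Definition vopp := vscale (-1).

Local Ltac vtac :=
  repeat (elim/vpiW=> ?); apply/vpiP => ? b r;
  do ?rewrite ?tensor_eval_repr ?tensor_eval_nil ?tensor_eval_cat
    ?tensor_eval_act //;
  try match goal with H : balanced _ |- _ =>
    first [exact (balanced_lmul _ H)
          |exact (balanced_lmul _ (balanced_lmul _ H))] end.

Lemma vaddA : associative vadd.
Proof. by vtac; rewrite addrA. Qed.
Lemma vaddC : commutative vadd.
Proof. by vtac; rewrite addrC. Qed.
Lemma vadd0 : left_id vzero vadd.
Proof. by vtac; rewrite add0r. Qed.

Lemma vscaleA (a c : D) v : vscale a (vscale c v) = vscale (a * c) v.
Proof.
move: v; vtac; rewrite /tensor_eval; apply: eq_bigr => p _; by rewrite mulrA.
Qed.
Lemma vscale1 : left_id 1 vscale.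
Proof. by vtac; rewrite /tensor_eval; apply: eq_bigr => p _; rewrite mul1r. Qed.
Lemma vscaleDr : right_distributive vscale vadd.
Proof. by move=> a; vtac. Qed.
Lemma vscaleDl v : {morph vscale^~ v : a c / a + c >-> vadd a c}.
Proof.
move=> a c; move: v; vtac; rewrite /tensor_eval -big_split; apply: eq_bigr => p _ /=.
by rewrite mulrDl (balancedDl r).
Qed.
Lemma vaddN : left_inverse vzero vopp vadd.
Proof.
move=> v; rewrite /vopp -[v in X in vadd _ X = _]vscale1 -vscaleDl addNr.
move: v; vtac; rewrite /tensor_eval big1 // => p _.
by rewrite mul0r (balanced0 _ r).
Qed.

HB.instance Definition _ := GRing.isZmodule.Build verma vaddA vaddC vadd0 vaddN.
HB.instance Definition _ := GRing.Zmodule_isLmodule.Build D verma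
  vscaleA vscale1 vscaleDr vscaleDl.

(* The class of a tensor m; thus x |h> is [x *: ket |h>]. *)
Definition ket (m : M) : verma := vpi [:: (1, m)].

End Verma.


Section Submodules.
Variables (R : pzRingType) (V : lmodType R).
Implicit Types (A B U W : set V).

Definition submodule W : Prop :=
  W 0 /\ forall (a : R) (u v : V), W u -> W v -> W (a *: u + v).

Definition submod_generated A : set V :=
  \bigcap_(W in [set W | submodule W /\ A `<=` W]) W.

(* A / B is a simple module. *)
Definition simple_factor A B : Prop :=
  [/\ submodule A, submodule B, B `<` A &
    forall U, submodule U -> B `<=` U -> U `<=` A -> U = B \/ U = A].

Definition simple_submodule U : Prop := simple_factor U [set 0].
Definition maximal_submodule W : Prop := simple_factor [set: V] W.

(* When V has a unique maximal submodule, this is it. *)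
Definition radical : set V := \bigcap_(W in maximal_submodule) W.
Definition socle : set V := submod_generated (\bigcup_(U in simple_submodule) U).

Lemma submodule_bigcap (P : set (set V)) :
  (forall W, P W -> submodule W) -> submodule (\bigcap_(W in P) W).
Proof.
move=> h; split=> [W /h[]//|a u v hu hv W PW].
by have [_ hW] := h W PW; apply: hW; [apply: hu | apply: hv].
Qed.

Lemma radical_submodule : submodule radical.
Proof. by apply: submodule_bigcap => W []. Qed.

Lemma submod_generated_submodule A : submodule (submod_generated A).
Proof. by apply: submodule_bigcap => W []. Qed.

Definition head_eqvb (u v : V) : bool := `[< radical (u - v) >].

Lemma head_eqvb_refl : reflexive head_eqvb.
Proof. by move=> u; apply/asboolP; rewrite subrr; case: radical_submodule. Qed.
Lemma radicalN u : radical u -> radical (- u).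
Proof.
have [r0 rl] := radical_submodule.
by move=> ru; have := rl (-1) u 0 ru r0; rewrite scaleN1r addr0.
Qed.
Lemma radicalD u v : radical u -> radical v -> radical (u + v).
Proof.
have [r0 rl] := radical_submodule.
by move=> ru rv; have := rl 1 u v ru rv; rewrite scale1r.
Qed.
Lemma radicalZ a u : radical u -> radical (a *: u).
Proof.
have [r0 rl] := radical_submodule.
by move=> ru; have := rl a u 0 ru r0; rewrite addr0.
Qed.
Lemma head_eqvb_sym : symmetric head_eqvb.
Proof.
by move=> u v; apply/asboolP/asboolP => /radicalN; rewrite opprB.
Qed.
Lemma head_eqvb_trans : transitive head_eqvb.
Proof.
move=> v u w /asboolP h1 /asboolP h2; apply/asboolP.
by rewrite -(subrK v u) -addrA; apply: radicalD.
Qed.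

Canonical head_equiv :=
  EquivRel head_eqvb head_eqvb_refl head_eqvb_sym head_eqvb_trans.

Definition head_module : Type := {eq_quot head_equiv}.
HB.instance Definition _ := EqQuotient.on head_module.
HB.instance Definition _ := Choice.on head_module.

Definition hpi (v : V) : head_module := \pi_head_module v.

Lemma hpiP u v : hpi u = hpi v <-> radical (u - v).
Proof. by split=> [/eqmodP/asboolP|h]; [|apply/eqmodP/asboolP]. Qed.
Lemma hpiW (P : head_module -> Prop) : (forall v, P (hpi v)) -> forall x, P x.
Proof. by move=> h x; rewrite -(reprK x); apply: h. Qed.
Lemma hpi_repr v : radical (repr (hpi v) - v).
Proof. by apply/hpiP; apply: reprK. Qed.

Definition hadd (x y : head_module) := hpi (repr x + repr y).
Definition hscale (a : R) (x : head_module) := hpi (a *: repr x).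
Definition hopp (x : head_module) := hpi (- repr x).

Lemma haddE u v : hadd (hpi u) (hpi v) = hpi (u + v).
Proof. by apply/hpiP; rewrite opprD addrACA; apply: radicalD; apply: hpi_repr. Qed.
Lemma hscaleE a v : hscale a (hpi v) = hpi (a *: v).
Proof. by apply/hpiP; rewrite -scalerBr; apply: radicalZ; apply: hpi_repr. Qed.
Lemma hoppE v : hopp (hpi v) = hpi (- v).
Proof. by apply/hpiP; rewrite -opprD; apply: radicalN; apply: hpi_repr. Qed.

Local Notation hE := (haddE, hscaleE, hoppE).
Lemma haddA : associative hadd.
Proof. by do 3!elim/hpiW => ?; rewrite !hE addrA. Qed.
Lemma haddC : commutative hadd.
Proof. by do 2!elim/hpiW => ?; rewrite !hE addrC. Qed.
Lemma hadd0 : left_id (hpi 0) hadd.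
Proof. by elim/hpiW => ?; rewrite !hE add0r. Qed.
Lemma haddN : left_inverse (hpi 0) hopp hadd.
Proof. by elim/hpiW => ?; rewrite !hE addNr. Qed.
HB.instance Definition _ := GRing.isZmodule.Build head_module haddA haddC hadd0 haddN.
Lemma hscaleA a b x : hscale a (hscale b x) = hscale (a * b) x.
Proof. by elim/hpiW: x => ?; rewrite !hE scalerA. Qed.
Lemma hscale1 : left_id 1 hscale.
Proof. by elim/hpiW => ?; rewrite !hE scale1r. Qed.
Lemma hscaleDr : right_distributive hscale hadd.
Proof. by move=> ?; do 2!elim/hpiW => ?; rewrite !hE scalerDr. Qed.
Lemma hscaleDl x : {morph hscale^~ x : a b / a + b >-> hadd a b}.
Proof. by move=> ? ?; elim/hpiW: x => ?; rewrite !hE scalerDl. Qed.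
HB.instance Definition _ := GRing.Zmodule_isLmodule.Build R head_module
  hscaleA hscale1 hscaleDr hscaleDl.

(* A / B is isomorphic to L: some linear map from A onto L has kernel B. *)
Definition factor_isog A B (L : lmodType R) : Prop :=
  exists f : V -> L,
    [/\ forall (a : R) (u v : V), A u -> A v -> f (a *: u + v) = a *: f u + f v,
        f @` A = [set: L] &
        forall u, A u -> (f u = 0 <-> B u)].

(* V has a composition series whose factors are, up to isomorphism and order,
   the L_i. *)
Definition composition_factors n (L : 'I_n -> lmodType R) : Prop :=
  exists (F : nat -> set V) (s : 'S_n),
    [/\ F 0%N = [set 0], F n = [set: V] &
      forall i : 'I_n, simple_factor (F i.+1) (F i) /\
        factor_isog (F i.+1) (F i) (L (s i))].

End Submodules.

Arguments radical {R} V.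
Arguments socle {R} V.
Arguments composition_factors {R} V {n} L.

Definition L_head (k : fieldType) (M : ds3Module k) : lmodType (Dalg k) :=
  head_module (verma M).


Section Weights.
Variables (k : fieldType) (V : lmodType (Dalg k)).

Definition kspan n (e : 'I_n -> V) : set V :=
  [set v | exists a : 'I_n -> k, v = \sum_i (a i)%:A *: e i].

Definition kfree n (e : 'I_n -> V) : Prop :=
  forall a : 'I_n -> k, \sum_i (a i)%:A *: e i = 0 -> forall i, a i = 0.

(* U is a D(S_3)-submodule isomorphic to M. *)
Definition has_weight (U : set V) (M : ds3Module k) : Prop :=
  exists f : M -> V,
    [/\ forall (a : k) (u v : M), f (a *: u + v) = a%:A *: f u + f v,
        injective f, range f = U,
        forall g m, f (ds_g g m) = Dg k g *: f m &
        forall h m, f (ds_d h m) = Dd k h *: f m].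

Definition highest_weight (W : set V) (M : ds3Module k) : Prop :=
  exists U : set V,
    [/\ has_weight U M, forall t v, U v -> Dy k t *: v = 0 & W = submod_generated U].

End Weights.

(* vdeg M n is B^n(V) M, the component of degree -n of the Verma module, where
   B^(n+1)(V) = V B^n(V). *)
Fixpoint vdeg (k : fieldType) (M : ds3Module k) (n : nat) : set (verma M) :=
  if n is n'.+1 then
    [set v | exists u : 'S_3 -> verma M,
       (forall t, vdeg n' (u t)) /\ v = \sum_(t : 'S_3) Dx k t *: u t]
  else range (@ket k M).

Arguments vdeg {k} M n.

Section Vectors.
Variables (k : fieldType) (zeta : k) (zetaP : 3.-primitive_root zeta).

Definition e_vec (i : 'I_3) : verma (M_e_rho zetaP) :=
  let s := sigma \circ (tau ^+ i)%g in
  ((zeta ^+ i)%:A * (1 - Dg k s) * Dx k s) *: ket (rho_ket zeta zeta : M_e_rho zetaP).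

Definition c_elt : verma (M_e_rho zetaP) :=
  (zeta%:A * Dx k s13 * Dx k s12 - Dx k s12 * Dx k s23)
    *: ket (rho_ket zeta zeta : M_e_rho zetaP)
  + (Dx k s12 * Dx k s23 - zeta^-1%:A * Dx k s13 * Dx k s12)
    *: ket (rho_ket zeta zeta^-1 : M_e_rho zetaP).

Definition c_vec (i : 'I_2) : verma (M_e_rho zetaP) :=
  if i == 0%N :> nat then c_elt else Dg k sigma *: c_elt.

End Vectors.

(* Main.v *)
(** In the basis 1 - 3, 2 - 3 of M(e,rho), the algebra D acts on
    B(V) (x) M(e,rho) by 24 x 24 integer matrices, which identify the Verma
    module with k^24.

    Let U be a D(S_3)-submodule killed by the y's.  Then A = B(V) U is the
    submodule generated by U, and if U is simple, a submodule containing an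
    element of A outside V A contains A, because V^5 A = 0 (Nakayama).  With
    U = M this gives the uniqueness of the maximal submodule of any Verma module.

    For U = M, E, C, which sit in degrees 0, -1, -2, consider the composites of
    a monomial in the y's with a coordinate functional of the degree of U.  One
    can choose 7 + 10 + 7 of them forming a basis of the dual of k^24 whose dual
    basis consists of elements of B(V) M, B(V) E, B(V) C respectively.  Hence an
    element outside X = B(V) E is moved by a monomial in the y's to an element
    with a nonzero component in degree 0, so it generates everything; likewise
    an element of X outside S = B(V) C generates X, and a nonzero element of S
    generates S.  So 0, S, X and the whole module are the only submodules. *)

(* [verma] identifies formal sums only when every balanced map does, so neither its dimension nor
   the injectivity of [ket] is known in advance. The table [xtab] is used twice to settle this: as
   matrices it gives a representation of D on k^24 ([vrep_relations]), and as rewriting rules in D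
   it shows that 24 vectors span. Hence [coords] is injective, and every later identity in the Verma
   module becomes a computation in k^24.

   These computations are done over the integers, which is why the basis 1 - 3, 2 - 3 replaces the
   kets of tau and its inverse. The root zeta enters where e_i and c are compared with integral
   vectors, up to the factor zeta^2 - zeta for c. Characteristic zero serves to invert 6 and 3: the
   dual basis has denominators dividing 6, three times an integral multiple of c is visibly in V E,
   and M(e,rho) is simple because 3 is nonzero.

   One matrix identity, [opcert_check], serves all three layers: X and S live in degrees at most -1
   and at most -2, so the functionals belonging to the layers above vanish on them. *)
From HB Require Import structures.
Require Import Defs.
From mathcomp Require Import all_boot all_order all_algebra fingroup perm.
From mathcomp Require Import ring.
From mathcomp Require Import boolp classical_sets generic_quotient.

Set Implicit Arguments.
Unset Strict Implicit.
Unset Printing Implicit Defensive.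

Import GRing.Theory.
Local Open Scope ring_scope.
Local Open Scope classical_set_scope.

(** * An integral model *)

(* Lists of values, on which products of permutations compute. *)
Definition pcode (g : 'S_3) : seq nat := [seq val (g i) | i <- [:: pt1; pt2; pt3]].
Definition pone : seq nat := iota 0 3.
Definition pmul (g h : seq nat) : seq nat := [seq nth 0%N g i | i <- h].
Definition pinv (g : seq nat) : seq nat := [seq index i g | i <- pone].
Definition ptr (i j : nat) : seq nat :=
  [seq if m == i then j else if m == j then i else m | m <- pone].
Definition perms3 : seq (seq nat) :=
  [:: pone; ptr 0 1; ptr 1 2; ptr 0 2; [:: 1; 2; 0]; [:: 2; 0; 1]]%N.
Definition podd (g : seq nat) : bool := g \in [:: ptr 0 1; ptr 1 2; ptr 0 2]%N.
Definition pconj (g h : seq nat) : seq nat := pmul (pmul g h) (pinv g).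

Lemma pcodeM (g h : 'S_3) : pcode (g \circ h) = pmul (pcode g) (pcode h).
Proof.
rewrite /pmul -map_comp; apply: eq_map => i /=.
by rewrite permM; case: (I3_cases (h i)) => ->.
Qed.

Lemma pcode1 : pcode 1%g = pone.
Proof. by rewrite /pcode /= !perm1. Qed.

Lemma pcode_tperm (i j : 'I_3) : pcode (tperm i j) = ptr i j.
Proof.
rewrite /pcode /= !tperm3E.
by case: (I3_cases i) => ->; case: (I3_cases j) => ->.
Qed.

Lemma pcode_tau : pcode tau = [:: 1; 2; 0]%N.
Proof. by rewrite /tau pcodeM !pcode_tperm. Qed.

Lemma pcode_tauV : pcode tau^-1%g = [:: 2; 0; 1]%N.
Proof. by rewrite tauVE pcodeM !pcode_tperm. Qed.

Lemma pcode_inj : injective pcode.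
Proof. by move=> g h [] e1 e2 e3; apply: S3_eq; apply: val_inj. Qed.

Lemma pcode_mem (g : 'S_3) : pcode g \in perms3.
Proof.
by have [[]|[]] := S3_cases g => ->;
  rewrite ?pcode1 ?pcode_tperm ?pcode_tau ?pcode_tauV.
Qed.

Lemma pcodeV (g : 'S_3) : pcode g^-1%g = pinv (pcode g).
Proof.
have [[]|[]] := S3_cases g => ->;
  by rewrite ?invgK ?invg1 ?tpermV ?pcode1 ?pcode_tperm ?pcode_tau ?pcode_tauV.
Qed.

Lemma pcode_odd (g : 'S_3) : odd_perm g = podd (pcode g).
Proof.
have [[]|[]] := S3_cases g => ->;
  rewrite ?pcode1 ?pcode_tperm ?pcode_tau ?pcode_tauV /tau;
  by rewrite ?odd_permV ?odd_permM ?odd_tperm ?odd_perm1.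
Qed.

(** Sparse integral vectors: lists of (coefficient, index) with repetitions allowed, so that
    addition is concatenation. *)
Definition svec := seq (int * nat).

Section IntegralModel.
Implicit Types (s : svec) (f : nat -> svec).

Definition scoef s (i : nat) : int := foldr (fun d c => if d.2 == i then d.1 + c else c) 0 s.
Definition sscale (c : int) s : svec := [seq (c * d.1, d.2) | d <- s].
(** Terms of index 24 or more are dropped because the matrices of [mxop] have 24 columns; this makes
    [mxop_vec] hold for every [f]. *)
Definition sext f s : svec :=
  flatten [seq if (d.2 < 24)%N then sscale d.1 (f d.2) else [::] | d <- s].
Definition seqv s s' : bool := all (fun i => scoef s i == scoef s' i) (iota 0 24).

Definition term1 (j : nat) : svec := [:: (1, j)].

Definition op1 : nat -> svec := term1.
Definition op0 (j : nat) : svec := [::].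
Definition opD f f' (j : nat) : svec := f j ++ f' j.
Definition opZ (c : int) f (j : nat) : svec := sscale c (f j).
Definition opM f f' (j : nat) : svec := sext f (f' j).
Definition opeq f f' : bool := all (fun j => seqv (f j) (f' j)) (iota 0 24).

Definition la := ptr 0 1.
Definition lb := ptr 1 2.
Definition lc := ptr 0 2.
(** The reduced words 1, a, b, ab, ba, aba of the nil-Coxeter algebra on a, b, then the same words
    followed by c: a basis of B(V). The list is closed under removal of the first letter, on which
    [opyw] relies. *)
Definition words : seq (seq (seq nat)) :=
  [:: [::]; [:: la]; [:: lb]; [:: la; lb]; [:: lb; la]; [:: la; lb; la]; [:: lc];
      [:: la; lc]; [:: lb; lc]; [:: la; lb; lc]; [:: lb; la; lc];
      [:: la; lb; la; lc]].

(* Left multiplication by a letter on words; it uses ca = -bc - ab,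
   cb = -ac - ba and bab = aba. *)
Definition xtab (t : seq nat) : seq svec :=
  if t == la then
    [:: term1 1; [::]; term1 3; [::]; term1 5; [::];
        term1 7; [::]; term1 9; [::]; term1 11; [::]]
  else if t == lb then
    [:: term1 2; term1 4; [::]; term1 5; [::]; [::];
        term1 8; term1 10; [::]; term1 11; [::]; [::]]
  else if t == lc then
    [:: term1 6; sscale (-1) (term1 3 ++ term1 8); sscale (-1) (term1 4 ++ term1 7);
        term1 10; term1 9; sscale (-1) (term1 11);
        [::]; sscale (-1) (term1 9); sscale (-1) (term1 10); [::]; [::]; [::]]
  else [::].

(* The index 2 w + e stands for the w-th word times the e-th vector of the basis
   1 - 3, 2 - 3 of M(e, rho). *)
Definition opx (t : seq nat) (j : nat) : svec :=
  [seq (d.1, d.2.*2 + odd j)%N | d <- nth [::] (xtab t) j./2].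

Definition psgn (g : seq nat) : int := if podd g then -1 else 1.

(* The i-th vector minus the third, so zero for i = 2. *)
Definition rhov (i : nat) : svec := if (i < 2)%N then term1 i else [::].
Definition oprho (g : seq nat) (e : nat) : svec :=
  rhov (nth 0%N g e) ++ sscale (-1) (rhov (nth 0%N g 2)).

Definition opg (g : seq nat) (j : nat) : svec :=
  foldr (fun t s => sscale (psgn g) (sext (opx (pconj g t)) s))
    (oprho g (odd j)) (nth [::] words j./2).

(** M(e,rho) has degree e, so the degree of a basis vector is the product of the letters of its
    word. *)
Definition opd (h : seq nat) (j : nat) : svec :=
  if foldr pmul pone (nth [::] words j./2) == h then term1 j else [::].

(* Moves y_t past the first letter of w by rel_yx and rel_yx'. *)
Fixpoint opyw (t : seq nat) (e : nat) (w : seq (seq nat)) : svec :=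
  if w is s :: w' then
    let u := term1 ((index w' words).*2 + e) in
    sscale (-1) (sext (opx s) (opyw (pconj s t) e w')) ++
    (if s == t then
       u ++ sext (opg s) (sext (opd s) u ++ sscale (-1) (sext (opd pone) u))
     else
       sext (opg s) (sext (opd t) u ++ sscale (-1) (sext (opd (pmul t s)) u)))
  else [::].
Definition opy (t : seq nat) (j : nat) : svec :=
  if podd t then opyw t (odd j) (nth [::] words j./2) else [::].

Definition opgen (z : gen) : nat -> svec :=
  match z with
  | GX t => opx (pcode t) | GY t => opy (pcode t)
  | GG g => opg (pcode g) | GD h => opd (pcode h)
  end.


(** * Matrices over k and the relations of D *)

Section Interp.
Variable k : fieldType.

Definition cvec s : 'cV[k]_24 := \col_i (scoef s i)%:~R.
Definition mxop f : 'M[k]_24 := \matrix_(i, j) (scoef (f j) i)%:~R.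

Lemma scoef_cat s s' i : scoef (s ++ s') i = scoef s i + scoef s' i.
Proof. by elim: s => [|d s IH] /=; rewrite ?add0r // IH; case: ifP; rewrite ?addrA. Qed.

Lemma scoef_scale c s i : scoef (sscale c s) i = c * scoef s i.
Proof. by elim: s => [|d s IH] /=; rewrite ?mulr0 // IH; case: ifP; rewrite ?mulrDr. Qed.

Lemma cvec_nil : cvec [::] = 0.
Proof. by apply/colP => i; rewrite !mxE. Qed.
Lemma cvec_cat s s' : cvec (s ++ s') = cvec s + cvec s'.
Proof. by apply/colP => i; rewrite !mxE scoef_cat intrD. Qed.
Lemma cvec_scale c s : cvec (sscale c s) = c%:~R *: cvec s.
Proof. by apply/colP => i; rewrite !mxE scoef_scale intrM. Qed.
Lemma cvec_eqv s s' : seqv s s' -> cvec s = cvec s'.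
Proof.
move=> /allP h; apply/colP => i; rewrite !mxE.
by rewrite (eqP (h i _)) // mem_iota ltn_ord.
Qed.

Lemma sext_cat f s s' : sext f (s ++ s') = sext f s ++ sext f s'.
Proof. by rewrite /sext map_cat flatten_cat. Qed.

Lemma sext1 f c j :
  sext f [:: (c, j)] = if (j < 24)%N then sscale c (f j) else [::].
Proof. by rewrite /sext /= cats0. Qed.

Lemma mxop_vec f s : mxop f *m cvec s = cvec (sext f s).
Proof.
elim: s => [|[c j] s IH]; first by rewrite !cvec_nil mulmx0.
rewrite -cat1s cvec_cat mulmxDr IH {IH}.
rewrite sext_cat cvec_cat; congr (_ + _).
rewrite sext1.
apply/colP => i; rewrite [LHS]mxE.
case: (ltnP j 24) => hj; last first.
  rewrite big1 ?cvec_nil ?mxE // => m _; rewrite [cvec _ _ _]mxE /=.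
  case: eqP => [e|_]; last by rewrite mulr0.
  by have := ltn_ord m; rewrite -e ltnNge hj.
rewrite (bigD1 (Ordinal hj)) //= big1 ?addr0 => [|m mj].
  by rewrite !mxE /= eqxx addr0 scoef_scale intrM mulrC.
rewrite [cvec _ _ _]mxE /=; case: eqP => [e|_]; last by rewrite mulr0.
by case/eqP: mj; apply: val_inj.
Qed.

Lemma mxopM f f' : mxop f * mxop f' = mxop (opM f f').
Proof.
apply/matrixP => i j; have /colP/(_ i) := mxop_vec f (f' j).
rewrite !mxE => <-; by apply: eq_bigr => m _; rewrite !mxE.
Qed.
Lemma mxopD f f' : mxop f + mxop f' = mxop (opD f f').
Proof. by apply/matrixP => i j; rewrite !mxE scoef_cat intrD. Qed.
Lemma mxopZ c f : c%:~R *: mxop f = mxop (opZ c f).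
Proof. by apply/matrixP => i j; rewrite !mxE scoef_scale intrM. Qed.
Lemma mxopN f : - mxop f = mxop (opZ (-1) f).
Proof. by rewrite -mxopZ scaleN1r. Qed.
Lemma mxop0 : 0 = mxop op0.
Proof. by apply/matrixP => i j; rewrite !mxE. Qed.
Lemma mxop1 : 1 = mxop op1.
Proof. by apply/matrixP => i j; rewrite !mxE /= -val_eqE eq_sym /=; case: eqP. Qed.
Lemma mxop_eq f f' : opeq f f' -> mxop f = mxop f'.
Proof.
move=> /allP h; apply/matrixP => i j; rewrite !mxE.
have /allP hj : seqv (f j) (f' j) by apply: h; rewrite mem_iota ltn_ord.
by rewrite (eqP (hj i _)) // mem_iota ltn_ord.
Qed.


(** Elements of ['S_3] do not compute, but their codes do. This lemma and the next ones turn a claim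
    about all permutations or points into a finite check for [vm_compute]. *)
Lemma forall_pcode (P : seq nat -> bool) : all P perms3 -> forall g, P (pcode g).
Proof. by move=> /allP h g; apply/h/pcode_mem. Qed.
Lemma forall_pcode2 (P : seq nat -> seq nat -> bool) :
  all (fun g => all (P g) perms3) perms3 -> forall g h, P (pcode g) (pcode h).
Proof. by move=> /forall_pcode h g; apply/forall_pcode/h. Qed.
Lemma forall_I3 (P : nat -> bool) : all P (iota 0 3) -> forall i : 'I_3, P i.
Proof. by move=> /allP h i; apply/h; rewrite mem_iota ltn_ord. Qed.
Lemma forall_distinct2 (P : nat -> nat -> bool) :
  all (fun i => all (fun j => (i != j) ==> P i j) (iota 0 3)) (iota 0 3) ->
  forall i j : 'I_3, i != j -> P i j.
Proof.
by move=> /forall_I3 h i j ij; have /forall_I3/(_ j)/implyP := h i; apply.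
Qed.
Lemma forall_distinct3 (P : nat -> nat -> nat -> bool) :
  all (fun i => all (fun j => (i != j) ==> all (fun l =>
    (i != l) && (j != l) ==> P i j l) (iota 0 3)) (iota 0 3)) (iota 0 3) ->
  forall i j l : 'I_3, i != j -> i != l -> j != l -> P i j l.
Proof.
move=> /(@forall_distinct2 (fun i j => all _ _)) h i j l ij il jl.
by have /forall_I3/(_ l)/implyP := h i j ij; apply; apply/andP.
Qed.

Lemma forall_pcode_distinct2 (P : seq nat -> nat -> nat -> bool) :
  all (fun g => all (fun i => all (fun j => (i != j) ==> P g i j) (iota 0 3))
    (iota 0 3)) perms3 ->
  forall g (i j : 'I_3), i != j -> P (pcode g) i j.
Proof. by move=> /forall_pcode h g; apply: forall_distinct2. Qed.

Lemma sum_perms3 (V : zmodType) (f : seq nat -> V) :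
  \sum_(g : 'S_3) f (pcode g) = \sum_(g <- perms3) f g.
Proof.
rewrite -(big_map pcode xpredT f); apply: perm_big; apply: uniq_perm => //.
  by rewrite map_inj_uniq ?index_enum_uniq //; exact: pcode_inj.
move=> g; apply/mapP/idP => [[h _ ->]|]; first exact: pcode_mem.
rewrite !inE; do 5?case/orP; move=> /eqP ->;
  [exists 1%g | exists s12 | exists s23 | exists s13 | exists tau | exists tau^-1%g];
  by rewrite ?mem_index_enum ?pcode1 ?pcode_tperm ?pcode_tau ?pcode_tauV.
Qed.

Definition vrep (z : gen) : 'M[k]_24 := mxop (opgen z).

Lemma sign_mxop (b : bool) f : (-1) ^+ b * mxop f = mxop (opZ (if b then -1 else 1) f).
Proof. by case: b; rewrite -mxopZ ?mulN1r ?scaleN1r ?mul1r ?scale1r. Qed.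

Local Notation opE := (sign_mxop, mxopM, mxopN, mxopD).


Local Ltac check2 g h :=
  match goal with |- is_true ?b =>
    match eval pattern (pcode g), (pcode h) in b with ?P _ _ =>
      apply: (@forall_pcode2 P _ g h); by vm_compute end end.
Local Ltac check_ij i j ij :=
  match goal with |- is_true ?b =>
    match eval pattern (nat_of_ord i), (nat_of_ord j) in b with ?P _ _ =>
      apply: (@forall_distinct2 P _ i j ij); by vm_compute end end.
Local Ltac check_ijl i j l ij il jl :=
  match goal with |- is_true ?b =>
    match eval pattern (nat_of_ord i), (nat_of_ord j), (nat_of_ord l) in b with ?P _ _ _ =>
      apply: (@forall_distinct3 P _ i j l ij il jl); by vm_compute end end.
Local Ltac check_gij g i j ij :=
  match goal with |- is_true ?b =>
    match eval pattern (pcode g), (nat_of_ord i), (nat_of_ord j) in b with ?P _ _ _ =>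
      apply: (@forall_pcode_distinct2 P _ g i j ij); by vm_compute end end.

(** This is the lower bound on the Verma module: D acts on k^24, so no unexpected relation can hold
    among the 24 basis vectors. *)
Lemma vrep_relations : Dalg_relations vrep.
Proof.
have pE := (pcode1, pcode_tperm, pcodeM, pcodeV, pcode_odd).
rewrite /vrep; split=> /=.
- move=> t; rewrite pcode_odd mxop0 => h; apply: mxop_eq.
  move: (pcode t) (pcode_mem t) h => g; rewrite !inE.
  by do 5?case/orP; move=> /eqP ->; vm_compute.
- by move=> t; rewrite pcode_odd mxop0 /opy => /negbTE ->; apply: mxop_eq; vm_compute.
- by rewrite mxop1 pcode1; apply: mxop_eq; vm_compute.
- by move=> g h; rewrite opE pE; apply: mxop_eq; check2 g h.
- move=> g h; rewrite -(inj_eq pcode_inj) opE mxop0 -fun_if; apply: mxop_eq.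
  by check2 g h.
- rewrite (sum_perms3 (fun g => mxop (opd g))) /perms3 !big_cons big_nil mxop0 mxop1.
  by rewrite !opE; apply: mxop_eq; vm_compute.
- by move=> i j ij; rewrite !pE opE mxop0; apply: mxop_eq; check_ij i j ij.
- by move=> i j l ij il jl; rewrite !pE !opE mxop0; apply: mxop_eq; check_ijl i j l ij il jl.
- by move=> i j ij; rewrite !pE opE mxop0; apply: mxop_eq; check_ij i j ij.
- by move=> i j l ij il jl; rewrite !pE !opE mxop0; apply: mxop_eq; check_ijl i j l ij il jl.
- by move=> g h; rewrite !opE !pE; apply: mxop_eq; check2 g h.
- by move=> g i j ij; rewrite !pE !opE; apply: mxop_eq; check_gij g i j ij.
- by move=> g i j ij; rewrite !pE !opE; apply: mxop_eq; check_gij g i j ij.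
- by move=> g i j ij; rewrite !pE !opE; apply: mxop_eq; check_gij g i j ij.
- by move=> g i j ij; rewrite !pE !opE; apply: mxop_eq; check_gij g i j ij.
- by move=> i j ij; rewrite !pE mxop1 !opE; apply: mxop_eq; check_ij i j ij.
- by move=> i j l ij il jl; rewrite !pE !opE; apply: mxop_eq; check_ijl i j l ij il jl.
Qed.

End Interp.

End IntegralModel.

(** * Submodules generated by highest weight vectors *)

Section Dalg_theory.
Variable k : fieldType.
Local Notation D := (Dalg k).
Local Notation rel := (dgen_relations k).

Lemma Dalg_ind (P : D -> Prop) :
  (forall z, P (dgen k z)) -> (forall a : k, P a%:A) ->
  (forall a b, P a -> P b -> P (a + b)) -> (forall a b, P a -> P b -> P (a * b)) ->
  forall a, P a.
Proof.
move=> hz hs hD hM; elim/dpiW; elim=> [z|a|t ht u hu|t ht u hu]; first exact: hz.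
- suff -> : dpi (TScal a) = a%:A :> D by exact: hs.
  by apply: Dalg_ext => A v r; rewrite dliftE /= linearZ rmorph1.
- suff -> : dpi (TAdd t u) = dpi t + dpi u :> D by exact: hD.
  by apply: Dalg_ext => A v r; rewrite rmorphD /= !dliftE.
- suff -> : dpi (TMul t u) = dpi t * dpi u :> D by exact: hM.
  by apply: Dalg_ext => A v r; rewrite rmorphM /= !dliftE.
Qed.

(** The modules below are modules over D; scalars of k act on them through the central elements
    [a%:A]. *)
Lemma scalarC (a : k) (b : D) : a%:A * b = b * a%:A.
Proof. by rewrite mulr_algl -scalerAr mulr1. Qed.

Lemma scalarM (a b : k) : a%:A * b%:A = (a * b)%:A :> D.
Proof. by rewrite -scalerAl mul1r scalerA. Qed.

Lemma scalar_swap (V : lmodType D) (a : k) (b : D) (v : V) :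
  b *: (a%:A *: v) = a%:A *: (b *: v).
Proof. by rewrite !scalerA scalarC. Qed.

Lemma scalar_int (V : lmodType D) (n : int) (v : V) : v *~ n = (n%:~R : k)%:A *: v.
Proof. by rewrite !scaler_int. Qed.

Lemma odd_tperm3 (t : 'S_3) : odd_perm t -> exists i j : 'I_3, i != j /\ t = tperm i j.
Proof.
have [[]|[]] := S3_cases t => ->;
  rewrite ?odd_permV /tau ?odd_permM ?odd_tperm ?odd_perm1 // => _.
- by exists pt1, pt2.
- by exists pt2, pt3.
- by exists pt1, pt3.
Qed.

Lemma odd_tperm3_neq (s t : 'S_3) : odd_perm s -> odd_perm t -> s != t ->
  exists i j l : 'I_3, [/\ i != j, i != l, j != l, s = tperm i j & t = tperm i l].
Proof.
have odd_cases u : odd_perm u -> [\/ u = s12, u = s23 | u = s13].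
  have [[]|[]] := S3_cases u => ->;
  rewrite ?odd_permV /tau ?odd_permM ?odd_tperm ?odd_perm1 // => _.
  - by constructor 1.
  - by constructor 2.
  - by constructor 3.
move=> /odd_cases [] -> /odd_cases [] -> //; rewrite ?eqxx // => _.
- by exists pt2, pt1, pt3; rewrite tpermC.
- by exists pt1, pt2, pt3.
- by exists pt2, pt3, pt1; rewrite [tperm pt2 pt1]tpermC.
- by exists pt3, pt2, pt1; rewrite [tperm pt3 _]tpermC [tperm pt3 pt1]tpermC.
- by exists pt1, pt3, pt2.
- by exists pt3, pt1, pt2; rewrite [tperm pt3 _]tpermC [tperm pt3 pt2]tpermC.
Qed.

(** For even t both sides vanish, as x_t = 0. Allowing every t spares the inductions over [xmul] and
    [xspan] a parity condition. *)
Lemma gx_comm (g t : 'S_3) : exists t' : 'S_3,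
  Dg k g * Dx k t = ((-1) ^+ odd_perm g)%:A * (Dx k t' * Dg k g).
Proof.
exists (g \circ t \circ g^-1%g); case: (boolP (odd_perm t)) => [/odd_tperm3 [i [j [ij ->]]]|ht].
  rewrite /Dg (rel_gx rel) // -mulrA; congr (_ * _).
  by case: (odd_perm g); rewrite ?expr0 ?expr1 ?scaleN1r ?scale1r.
have ht' : ~~ odd_perm (g \circ t \circ g^-1%g).
  by rewrite !odd_permM odd_permV (negbTE ht); case: (odd_perm g).
by rewrite /Dx (rel_x0 rel ht) (rel_x0 rel ht') mul0r !mulr0.
Qed.

Lemma dx_comm (h t : 'S_3) : exists h' : 'S_3, Dd k h * Dx k t = Dx k t * Dd k h'.
Proof.
exists (t \circ h); case: (boolP (odd_perm t)) => [/odd_tperm3 [i [j [ij ->]]]|ht].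
  exact: (rel_dx rel).
by rewrite /Dx (rel_x0 rel ht) mul0r mulr0.
Qed.

(** Merges [rel_yx] and [rel_yx'] with the trivial cases of even s or t. Of K only the shape
    matters: it lies in D(S_3), hence preserves every D(S_3)-stable set. *)
Lemma yx_comm (t s : 'S_3) : exists t' : 'S_3, exists K : D,
  [/\ Dy k t * Dx k s = K - Dx k s * Dy k t' &
     K = 0 \/ exists g h h' : 'S_3,
       K = 1 + Dg k g * (Dd k h - Dd k h') \/ K = Dg k g * (Dd k h - Dd k h')].
Proof.
case: (boolP (odd_perm s)) => [os|es]; last first.
  exists 1%g, 0; rewrite /Dx (rel_x0 rel es) mulr0 mul0r subr0.
  by split=> //; left.
case: (boolP (odd_perm t)) => [ot|et]; last first.
  exists 1%g, 0; rewrite /Dy (rel_y0 rel et) (@rel_y0 _ _ _ rel 1%g) ?odd_perm1 //.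
  by rewrite mulr0 mul0r subr0; split=> //; left.
case: (eqVneq s t) => [<-|st].
  have [i [j [ij es]]] := odd_tperm3 os; exists s.
  exists (1 + Dg k s * (Dd k s - Dd k 1%g)); split; last by right; exists s, s, 1%g; left.
  by rewrite es -(rel_yx rel) // addrK.
have [i [j [l [ij il jl -> ->]]]] := odd_tperm3_neq os ot st.
exists (tperm j l), (Dg k (tperm i j) * (Dd k (tperm i l) - Dd k (tperm i l \circ tperm i j))).
split; first by rewrite -(rel_yx' rel) // addrK.
by right; do 3!eexists; right.
Qed.

(** This is p V^n = 0, in the form suited to an induction that appends one x at a time to p. *)
Fixpoint xkills (n : nat) (p : D) : Prop :=
  if n is n'.+1 then forall t, xkills n' (p * Dx k t) else p = 0.

End Dalg_theory.

Section Stable.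
Variables (k : fieldType) (V : lmodType (Dalg k)).
Implicit Types (U W A N : set V).
Local Notation D := (Dalg k).

Record ds3_stable W : Prop := DS3Stable {
  ds3_0 : W 0;
  ds3_D : forall u v, W u -> W v -> W (u + v);
  ds3_Z : forall (a : k) v, W v -> W (a%:A *: v);
  ds3_g : forall g v, W v -> W (Dg k g *: v);
  ds3_d : forall h v, W v -> W (Dd k h *: v)
}.

Definition ds3_simple U : Prop :=
  ds3_stable U /\ forall W, ds3_stable W -> W `<=` U ->
    (exists2 w, W w & w <> 0) -> U `<=` W.

Lemma ds3_N W v : ds3_stable W -> W v -> W (- v).
Proof. by move=> sW /(ds3_Z sW (-1)); rewrite !scaleN1r. Qed.

Lemma submoduleP W :
  W 0 -> (forall u v, W u -> W v -> W (u + v)) ->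
  (forall (a : k) v, W v -> W (a%:A *: v)) ->
  (forall z v, W v -> W (dgen k z *: v)) -> submodule W.
Proof.
move=> w0 wD wZ wg; split=> // a u v wu wv; apply: (wD) => //; move: u wu {v wv}.
elim/Dalg_ind: a => [z|a|a b ha hb|a b ha hb] u wu; [exact: wg|exact: wZ| |].
  by rewrite scalerDl; apply: (wD); [apply: ha | apply: hb].
by rewrite -scalerA; apply/ha/hb.
Qed.

Lemma submodule_act W a v : submodule W -> W v -> W (a *: v).
Proof. by move=> [w0 wL] wv; rewrite -[_ *: _]addr0; apply: wL. Qed.
Lemma submoduleD W u v : submodule W -> W u -> W v -> W (u + v).
Proof. by move=> [w0 wL] wu wv; rewrite -[u]scale1r; apply: wL. Qed.
Lemma submoduleN W v : submodule W -> W v -> W (- v).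
Proof. by move=> sW /(submodule_act (-1) sW); rewrite scaleN1r. Qed.
Lemma submodule_stable W : submodule W -> ds3_stable W.
Proof.
move=> sW; split; first by case: sW.
- by move=> u v; apply: submoduleD.
- by move=> a v; apply: submodule_act.
- by move=> g v; apply: submodule_act.
- by move=> h v; apply: submodule_act.
Qed.
Lemma submodule_sum (I : Type) (r : seq I) (P : pred I) (F : I -> V) W :
  submodule W -> (forall i, P i -> W (F i)) -> W (\sum_(i <- r | P i) F i).
Proof.
move=> sW hF; apply: (big_ind W) => //; first by case: sW.
by move=> u v; apply: submoduleD.
Qed.

(** This has the form of the successor case of [vdeg], so that results on [xmul] apply to [vdeg] by
    conversion. *)
Definition xmul A : set V :=
  [set v | exists u : 'S_3 -> V, (forall t, A (u t)) /\ v = \sum_(t : 'S_3) Dx k t *: u t].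

Lemma xmulD A : (forall u v, A u -> A v -> A (u + v)) ->
  forall u v, xmul A u -> xmul A v -> xmul A (u + v).
Proof.
move=> AD u v [f [hf ->]] [g [hg ->]]; exists (fun t => f t + g t).
split=> [t|]; first exact: AD.
by rewrite -big_split; apply: eq_bigr => t _; rewrite scalerDr.
Qed.

Lemma xmul0 A : A 0 -> xmul A 0.
Proof. by move=> A0; exists (fun=> 0); split=> //; rewrite big1 // => t _; rewrite scaler0. Qed.

Lemma xmul_x A t v : A 0 -> A v -> xmul A (Dx k t *: v).
Proof.
move=> A0 Av; exists (fun s => if s == t then v else 0); split=> [s|]; first by case: ifP.
rewrite (bigD1 t) //= eqxx big1 ?addr0 // => s /negPf ->; exact: scaler0.
Qed.

Lemma xmulZ A (a : k) v : (forall v, A v -> A (a%:A *: v)) -> xmul A v -> xmul A (a%:A *: v).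
Proof.
move=> AZ [f [hf ->]]; exists (fun t => a%:A *: f t); split=> [t|]; first exact: AZ.
by rewrite scaler_sumr; apply: eq_bigr => t _; rewrite !scalerA scalarC.
Qed.

Lemma xmul_ind A (P : V -> Prop) : P 0 -> (forall u v, P u -> P v -> P (u + v)) ->
  (forall t v, A v -> P (Dx k t *: v)) -> forall v, xmul A v -> P v.
Proof. by move=> P0 PD Px v [f [hf ->]]; apply: big_ind => // t _; apply: Px. Qed.

Lemma xmul_stable A : ds3_stable A -> ds3_stable (xmul A).
Proof.
move=> [A0 AD AZ Ag Ad].
have x0 := xmul0 A0; have xD := xmulD AD; have xZ a v := @xmulZ A a v (AZ a).
split=> // [g v|h v]; elim/xmul_ind => [|u w|t w Aw];
  rewrite ?scaler0 ?scalerDr //; try exact: xD.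
  have [t' e] := gx_comm k g t.
  by rewrite scalerA e -!scalerA; apply/xZ/xmul_x => //; apply: Ag.
have [h' e] := dx_comm k h t.
by rewrite scalerA e -scalerA; apply: xmul_x => //; apply: Ad.
Qed.

(** This is B(V) U when U is D(S_3)-stable: scalars and elements of D(S_3) move through the x's down
    to U. *)
Inductive xspan U : set V :=
  | xspan_base u : U u -> xspan U u
  | xspan_add u v : xspan U u -> xspan U v -> xspan U (u + v)
  | xspan_mul t v : xspan U v -> xspan U (Dx k t *: v).

Section Span.
Variable U : set V.
Hypotheses (sU : ds3_stable U) (yU : forall t u, U u -> Dy k t *: u = 0).

Lemma xspan_stable : ds3_stable (xspan U).
Proof.
have hZ (a : k) v : xspan U v -> xspan U (a%:A *: v).
  elim=> [u Uu|u w _ hu _ hw|t w _ hw].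
  - by apply: xspan_base; apply: (ds3_Z sU).
  - by rewrite scalerDr; apply: xspan_add.
  - by rewrite scalerA scalarC -scalerA; apply: xspan_mul.
split=> // [||g v|h v]; first by apply: xspan_base; case: sU.
- exact: xspan_add.
- elim=> [u Uu|u w _ hu _ hw|t w _ hw].
  + by apply: xspan_base; apply: (ds3_g sU).
  + by rewrite scalerDr; apply: xspan_add.
  + have [t' e] := gx_comm k g t.
    by rewrite scalerA e -!scalerA; apply/hZ/xspan_mul.
- move=> hv; elim: hv h => [u Uu|u w _ hu _ hw|t w _ hw] h.
  + by apply: xspan_base; apply: (ds3_d sU).
  + by rewrite scalerDr; apply: xspan_add.
  + have [h' e] := dx_comm k h t.
    by rewrite scalerA e -!scalerA; apply/xspan_mul.
Qed.

(** The point is stability under the y's: y_t passes each x_s at the cost of an element of D(S_3),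
    which preserves the span, until it reaches U and kills it. *)
Lemma xspan_submodule : submodule (xspan U).
Proof.
have [h0 hD hZ hg hd] := xspan_stable.
apply: submoduleP => // -[t|t|g|h] v hv; [exact: xspan_mul| |exact: hg|exact: hd].
(* The letter t is generalized because passing x_s changes it. *)
elim: hv t => [u Uu|u w _ hu _ hw|s w hw IH] t.
- by rewrite [_ *: _]yU.
- by rewrite scalerDr; apply: (hD).
have [t' [K [e hK]]] := yx_comm k t s.
rewrite scalerA -[dgen k (GY t) * _]/(Dy k t * Dx k s) e scalerBl.
apply: (hD); last by apply/(ds3_N xspan_stable); rewrite -scalerA; apply/xspan_mul/IH.
case: hK => [->|[g [h [h' [] ->]]]]; first by rewrite scale0r.
  rewrite scalerDl scale1r -scalerA scalerBl; apply: (hD) => //; apply: (hg).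
  by apply: (hD); [|apply: (ds3_N xspan_stable)]; apply: hd.
rewrite -scalerA scalerBl; apply: (hg).
by apply: (hD); [|apply: (ds3_N xspan_stable)]; apply: hd.
Qed.

Lemma submod_generatedE : submod_generated U = xspan U.
Proof.
apply/seteqP; split=> v.
  by apply; split; [exact: xspan_submodule | exact: xspan_base].
elim=> [u Uu W [_ UW]|u w _ hu _ hw W hW|t w _ hw W hW]; first exact: UW.
  by apply: submoduleD; [case: hW | apply: hu | apply: hw].
by apply: submodule_act; [case: hW | apply: hw].
Qed.

Lemma xspanE v : xspan U v -> exists u z, [/\ U u, xmul (xspan U) z & v = u + z].
Proof.
have h0 := ds3_0 xspan_stable.
elim=> [u Uu|u w _ [u1 [z1 [hu1 hz1 ->]]] _ [u2 [z2 [hu2 hz2 ->]]]|t w hw _].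
- by exists u, 0; rewrite addr0; split=> //; apply: xmul0.
- exists (u1 + u2), (z1 + z2); rewrite addrACA; split=> //; first exact: ds3_D.
  by apply: xmulD => // *; apply: xspan_add.
- exists 0, (Dx k t *: w); rewrite add0r; split=> //; first by case: sU.
  exact: xmul_x.
Qed.

Hypothesis x5 : xkills 5 (1 : D).

(** Nakayama's lemma for A = B(V) U and the nilpotent V. By induction on n, every p with p V^n = 0
    maps A into N: for u in U, p u = p (u + z) - p z, where p z is a sum of terms (p x_t) w with w
    in A, and p x_t is annihilated by V^(n-1). *)
Lemma xspan_sub N : submodule N ->
  (forall u, U u -> exists2 z, xmul (xspan U) z & N (u + z)) -> xspan U `<=` N.
Proof.
move=> sN hU.
have key n : forall p : D, xkills n p -> forall v, xspan U v -> N (p *: v).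
  elim: n => [|n IH] p /= hp v; first by rewrite hp scale0r; case: sN.
  elim=> [u Uu|u w _ hu _ hw|t w hw _].
  - have [z hz huz] := hU u Uu.
    rewrite -[u](addrK z) scalerBr; apply: (submoduleD sN); first exact: (submodule_act p sN huz).
    apply: (submoduleN sN); move: z hz {huz}; apply: xmul_ind => [|u1 u2 h1 h2|t w hw].
    + by rewrite scaler0; case: sN.
    + by rewrite scalerDr; apply: submoduleD.
    + by rewrite scalerA; apply: IH.
  - by rewrite scalerDr; apply: submoduleD.
  - by rewrite scalerA; apply: IH.
by move=> v hv; rewrite -[v]scale1r; exact: (key 5 1 x5 v hv).
Qed.

Lemma xspan_nakayama N v : ds3_simple U -> submodule N ->
  N v -> xspan U v -> ~ xmul (xspan U) v -> xspan U `<=` N.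
Proof.
move=> [_ simU] sN Nv Av nAv; apply: xspan_sub => // u Uu.
(* W is the intersection of U with N + VA. It is D(S_3)-stable, and nonzero because the component of
   v in U cannot vanish when v is outside VA; simplicity makes it all of U. *)
pose W := [set u | U u /\ exists2 z, xmul (xspan U) z & N (u + z)].
have sx := xmul_stable xspan_stable.
suff /(_ u Uu) [] : U `<=` W by [].
apply: simU => [|w [] //|]; first split.
- split; first by case: sU.
  by exists 0; [exact: ds3_0 | rewrite addr0; case: sN].
- move=> u1 u2 [h1 [z1 hz1 n1]] [h2 [z2 hz2 n2]]; split; first exact: ds3_D.
  by exists (z1 + z2); [exact: ds3_D | rewrite addrACA; exact: (submoduleD sN)].
- move=> a w [hw [z hz nz]]; split; first exact: ds3_Z.
  by exists (a%:A *: z); [exact: ds3_Z | rewrite -scalerDr; exact: (submodule_act _ sN)].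
- move=> g w [hw [z hz nz]]; split; first exact: ds3_g.
  by exists (Dg k g *: z); [exact: ds3_g | rewrite -scalerDr; exact: (submodule_act _ sN)].
- move=> h w [hw [z hz nz]]; split; first exact: ds3_d.
  by exists (Dd k h *: z); [exact: ds3_d | rewrite -scalerDr; exact: (submodule_act _ sN)].
have [w [z [Uw hz e]]] := xspanE Av; exists w.
  by split=> //; exists z => //; rewrite -e.
by move=> w0; apply: nAv; rewrite e w0 add0r.
Qed.

End Span.

Lemma simple_factorP A B : submodule A -> submodule B -> B `<` A ->
  (forall N v, submodule N -> N v -> A v -> ~ B v -> A `<=` N) -> simple_factor A B.
Proof.
move=> sA sB BA h; split=> // W sW BW WA.
have [WB|] := pselect (W `<=` B); first by left; apply/seteqP.
move=> /existsNP [v /not_implyP [Wv nBv]]; right; apply/seteqP; split=> //.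
by apply: (h W v) => //; apply: WA.
Qed.

End Stable.

(** * Straightening of monomials in the x's *)

Section Monomials.
Variable k : fieldType.
Local Notation D := (Dalg k).
Local Notation rel := (dgen_relations k).

Definition xlet (l : seq nat) : D :=
  if l == la then Dx k s12 else if l == lb then Dx k s23
  else if l == lc then Dx k s13 else 0.

Lemma xletE t : Dx k t = xlet (pcode t).
Proof.
have hx u : ~~ odd_perm u -> Dx k u = 0 by exact: (rel_x0 rel).
have [[]|[]] := S3_cases t => ->; rewrite ?pcode1 ?pcode_tperm ?pcode_tau ?pcode_tauV //;
  by rewrite hx ?odd_permV /tau ?odd_permM ?odd_tperm ?odd_perm1.
Qed.

Definition xmon (w : seq (seq nat)) : D := foldr (fun l p => xlet l * p) 1 w.
Definition xword (i : nat) : D := xmon (nth [::] words i).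

(** The factor p lets the relations rewrite right-nested products. The braid relation follows from c
    a a = 0: expanding ca twice gives 0 = bab - aba. *)
Lemma x_relations (p : D) (a := Dx k s12) (b := Dx k s23) (c := Dx k s13) :
  [/\ a * (a * p) = 0, b * (b * p) = 0, c * (c * p) = 0 &
    [/\ c * (a * p) = - (b * (c * p)) - a * (b * p),
        c * (b * p) = - (a * (c * p)) - b * (a * p) &
        b * (a * (b * p)) = a * (b * (a * p))]].
Proof.
have aa q : a * (a * q) = 0 by rewrite mulrA [a * a](rel_xx rel) ?mul0r.
have bb q : b * (b * q) = 0 by rewrite mulrA [b * b](rel_xx rel) ?mul0r.
have cc q : c * (c * q) = 0 by rewrite mulrA [c * c](rel_xx rel) ?mul0r.
have cb q : c * (b * q) = - (a * (c * q)) - b * (a * q).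
  have /(congr1 (fun r => r * q)) := @rel_xxx _ _ _ rel pt1 pt2 pt3 isT isT isT.
  rewrite mul0r !mulrDl -!mulrA -!/(Dx k _) -/s12 -/s23 -/s13 -/a -/b -/c => /eqP.
  by rewrite addrC addr_eq0 opprD => /eqP.
have ca q : c * (a * q) = - (b * (c * q)) - a * (b * q).
  have /(congr1 (fun r => r * q)) := @rel_xxx _ _ _ rel pt1 pt3 pt2 isT isT isT.
  rewrite [tperm pt3 pt2]tpermC.
  rewrite mul0r !mulrDl -!mulrA -!/(Dx k _) -/s12 -/s23 -/s13 -/a -/b -/c -addrA => /eqP.
  by rewrite addr_eq0 opprD => /eqP.
have bca q : b * (c * (a * q)) = - (b * (a * (b * q))).
  by rewrite ca mulrDr !mulrN bb oppr0 add0r.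
do 2?split=> //.
have := ca (a * p); rewrite aa mulr0 bca opprK => /esym/eqP.
by rewrite subr_eq0 => /eqP.
Qed.

Definition xval (s : svec) : D := \sum_(d <- s) xword d.2 *~ d.1.

(** The rules behind [xtab] already hold in D. This yields the upper bound that matches
    [vrep_relations]: the twelve words span all monomials in the x's. *)
Lemma xlet_xword t i : (i < 12)%N -> xlet t * xword i = xval (nth [::] (xtab t) i).
Proof.
pose a := Dx k s12; pose b := Dx k s23; pose c := Dx k s13.
have aa p : a * (a * p) = 0 by have [] := x_relations p.
have bb p : b * (b * p) = 0 by have [] := x_relations p.
have cc p : c * (c * p) = 0 by have [] := x_relations p.
have ca p : c * (a * p) = - (b * (c * p)) - a * (b * p) by have [_ _ _ []] := x_relations p.
have cb p : c * (b * p) = - (a * (c * p)) - b * (a * p) by have [_ _ _ []] := x_relations p.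
have bab p : b * (a * (b * p)) = a * (b * (a * p)) by have [_ _ _ []] := x_relations p.
rewrite {1}/xlet /xtab; do ![case: eqP => _]; last by rewrite mul0r nth_nil /xval big_nil.
all: do 12?[case: i => [|i] //]; move=> _; rewrite /xval /sscale /= ?big_cons big_nil /=
  ?mulr1z ?mulrN1z /xword /xmon /= /xlet /= -/a -/b -/c ?addr0.
all: rewrite ?(aa, bb, cc, ca, cb, bab, mulrDr, mulrN, mulr0, oppr0, opprD, opprK, addr0, add0r) //.
all: exact: addrC.
Qed.

Definition xstep t s : svec :=
  flatten [seq sscale d.1 (nth [::] (xtab t) d.2) | d <- s].

Lemma xlet_xval t s : all (fun d => d.2 < 12)%N s ->
  xlet t * xval s = xval (xstep t s).
Proof.
have hZ c u : xval (sscale c u) = xval u *~ c.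
  rewrite /xval big_map mulrz_suml; apply: eq_bigr => d _ /=.
  by rewrite mulrC -mulrzA.
elim: s => [|d s IH] /=; first by rewrite /xval big_nil mulr0.
case/andP=> hd /IH {IH} IH.
have -> : xval (d :: s) = xword d.2 *~ d.1 + xval s by rewrite /xval big_cons.
have hcat u u' : xval (u ++ u') = xval u + xval u' by rewrite /xval big_cat.
by rewrite hcat mulrDr IH mulrzAr xlet_xword // -hZ.
Qed.

(* B(V) is concentrated in degrees at most 4. *)
Lemma xkills5 : xkills 5 (1 : D).
Proof.
move=> /= t1 t2 t3 t4 t5; rewrite mul1r -!mulrA !xletE.
have -> : xlet (pcode t5) = xlet (pcode t5) * xval (term1 0).
  by rewrite /xval big_seq1 /= mulr1z mulr1.
pose P t1 t2 t3 t4 t5 :=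
  let s5 := xstep t5 (term1 0) in let s4 := xstep t4 s5 in
  let s3 := xstep t3 s4 in let s2 := xstep t2 s3 in
  [&& all (fun d => d.2 < 12)%N s5, all (fun d => d.2 < 12)%N s4,
      all (fun d => d.2 < 12)%N s3, all (fun d => d.2 < 12)%N s2 & nilp (xstep t1 s2)].
have h : all (fun t1 => all (fun t2 => all (fun t3 => all (fun t4 => all (P t1 t2 t3 t4)
    perms3) perms3) perms3) perms3) perms3 by vm_compute.
have /allP/(_ _ (pcode_mem t2))/allP/(_ _ (pcode_mem t3))/allP/(_ _ (pcode_mem t4))
  /allP/(_ _ (pcode_mem t5)) := allP h _ (pcode_mem t1).
case/and5P=> h5 h4 h3 h2 /nilP h1.
have step t (p : D) s : p = xval s -> all (fun d => d.2 < 12)%N s ->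
  xlet t * p = xval (xstep t s) by move=> ->; exact: xlet_xval.
have e5 := step (pcode t5) _ (term1 0) erefl isT.
have e4 := step (pcode t4) _ _ e5 h5; have e3 := step (pcode t3) _ _ e4 h4.
have e2 := step (pcode t2) _ _ e3 h3; apply: (etrans (step (pcode t1) _ _ e2 h2)).
by rewrite h1 /xval big_nil.
Qed.

End Monomials.

(** * The universal property of the Verma module *)

Section VermaLift.
Variables (k : fieldType) (M : ds3Module k).
Local Notation D := (Dalg k).

Section Balanced.
Variables (N : zmodType) (b : D -> M -> N) (bal : balanced b).
Definition vlift (v : verma M) : N := tensor_eval b (repr v).
Lemma vliftE s : vlift (vpi s) = tensor_eval b s.
Proof. exact: tensor_eval_repr. Qed.
Lemma vliftD u v : vlift (u + v) = vlift u + vlift v.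
Proof. by rewrite [vlift (u + v)]vliftE tensor_eval_cat. Qed.
End Balanced.

Lemma vpiE s : vpi s = \sum_(p <- s) p.1 *: ket p.2 :> verma M.
Proof.
elim: s => [|[a m] s IH]; first by rewrite big_nil.
rewrite big_cons -IH; apply/vpiP => N b bal.
rewrite -cat1s !tensor_eval_cat.
congr (_ + _); last by rewrite (tensor_eval_repr _ bal).
rewrite /= -[a *: ket m]/(vpi (tensor_act a (repr (vpi [:: (1, m)])))).
rewrite (tensor_eval_repr _ bal) tensor_eval_act tensor_eval_repr; last exact: balanced_lmul.
by rewrite /tensor_eval !big_seq1 /= mulr1.
Qed.

Lemma verma_ind (P : verma M -> Prop) : P 0 -> (forall u v, P u -> P v -> P (u + v)) ->
  (forall a m, P (a *: ket m)) -> forall v, P v.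
Proof.
move=> P0 PD Pk; elim/vpiW => s; rewrite vpiE.
by apply: big_ind => // p _; apply: Pk.
Qed.

Lemma ketD m m' : ket (m + m') = ket m + ket m' :> verma M.
Proof.
rewrite -[ket m]scale1r -[ket m']scale1r.
transitivity (vpi [:: (1, m); (1, m')] : verma M); last by rewrite vpiE !big_cons big_nil addr0.
apply/vpiP => N b bal; rewrite /tensor_eval !big_cons !big_nil !addr0 /=.
exact: (balancedDr bal).
Qed.

Lemma ket_act s m m' : ge0_act s m m' -> s *: ket m = ket m' :> verma M.
Proof.
move=> h; transitivity (vpi [:: (s, m)] : verma M); first by rewrite vpiE big_seq1.
apply/vpiP => N b bal; rewrite /tensor_eval !big_seq1 /=.
by rewrite -{1}[s]mul1r (balancedA bal _ h).
Qed.

Lemma ketZ (a : k) m : ket (a *: m) = a%:A *: ket m :> verma M.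
Proof. exact/esym/ket_act/ge0_scalar. Qed.
Lemma ketg g m : ket (ds_g g m) = Dg k g *: ket m :> verma M.
Proof. exact/esym/ket_act/ge0_g. Qed.
Lemma ketd h m : ket (ds_d h m) = Dd k h *: ket m :> verma M.
Proof. exact/esym/ket_act/ge0_d. Qed.
Lemma kety t m : Dy k t *: ket m = ket 0 :> verma M.
Proof. exact/ket_act/ge0_y. Qed.
Lemma ket0 : ket 0 = 0 :> verma M.
Proof. by rewrite -[0 in LHS](scale0r 0) ketZ scale0r scale0r. Qed.

Lemma range_ket_stable : ds3_stable (range (@ket k M)).
Proof.
split=> [|u v [m _ <-] [m' _ <-]|a v [m _ <-]|g v [m _ <-]|h v [m _ <-]].
- by exists 0 => //; exact: ket0.
- by exists (m + m') => //; exact: ketD.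
- by exists (a *: m) => //; exact: ketZ.
- by exists (ds_g g m) => //; exact: ketg.
- by exists (ds_d h m) => //; exact: ketd.
Qed.

Lemma range_ket_y t v : range (@ket k M) v -> Dy k t *: v = 0.
Proof. by case=> m _ <-; rewrite kety ket0. Qed.

(** The span of x-monomials on the kets is a submodule, as the y's kill the kets, and the kets
    generate. *)
Lemma verma_xspan v : xspan (range (@ket k M)) v.
Proof.
have sA := xspan_submodule range_ket_stable range_ket_y.
elim/verma_ind: v => [|u v|a m]; first by case: sA.
  exact: submoduleD.
by apply: (submodule_act _ sA); apply: xspan_base; exists m.
Qed.

Section Hom.
Variables (V : lmodType D) (f : M -> V).
Hypotheses (fL : forall (a : k) (u v : M), f (a *: u + v) = a%:A *: f u + f v)
  (fg : forall g m, f (ds_g g m) = Dg k g *: f m)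
  (fd : forall h m, f (ds_d h m) = Dd k h *: f m)
  (fy : forall t m, Dy k t *: f m = 0).

Definition verma_hom (v : verma M) : V := vlift (fun a m => a *: f m) v.

(** Only compatibility with [ge0_act] has content. Induction over its constructors reduces it to the
    hypotheses on g, delta_h and y_t, that is, to [f] being linear over the subalgebra that is
    induced from. *)
Lemma verma_hom_bal : balanced (fun a m => a *: f m).
Proof.
have fD u v : f (u + v) = f u + f v by rewrite -[u]scale1r fL !scale1r.
have f0 : f 0 = 0 by apply: (addrI (f 0)); rewrite -fD !addr0.
have fZ a u : f (a *: u) = a%:A *: f u by rewrite -[a *: u]addr0 fL f0 addr0.
split=> [a a' m|a m m'|a s m m']; first exact: scalerDl.
  by rewrite fD scalerDr.
move=> h; rewrite -scalerA; congr (_ *: _).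
elim: h => {s m m'} [g m|h m|t m|c m|r s m m1 m2 _ IH1 _ IH2|r s m m1 m2 _ IH1 _ IH2];
  rewrite ?fg ?fd ?fy ?f0 ?fZ //.
  by rewrite fD scalerDl IH1 IH2.
by rewrite -scalerA IH1.
Qed.

Lemma verma_hom_ket m : verma_hom (ket m) = f m.
Proof.
rewrite /verma_hom vliftE; last exact: verma_hom_bal.
by rewrite /tensor_eval big_seq1 scale1r.
Qed.

Lemma verma_homL a u v : verma_hom (a *: u + v) = a *: verma_hom u + verma_hom v.
Proof.
have bal := verma_hom_bal.
rewrite /verma_hom vliftD //; congr (_ + _); rewrite /vlift.
rewrite -[a *: u]/(vpi (tensor_act a (repr u))) (tensor_eval_repr _ bal) tensor_eval_act.
by rewrite /tensor_eval scaler_sumr; apply: eq_bigr => p _; rewrite scalerA.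
Qed.

End Hom.

End VermaLift.

(** * Heads of Verma modules *)

Section Heads.
Variable k : fieldType.
Local Notation D := (Dalg k).

Definition module_simple (M : ds3Module k) : Prop :=
  forall P : set M, P 0 -> (forall u v, P u -> P v -> P (u + v)) ->
    (forall (a : k) v, P v -> P (a *: v)) ->
    (forall g v, P v -> P (ds_g g v)) -> (forall h v, P v -> P (ds_d h v)) ->
    (exists2 m, P m & m <> 0) -> forall m, P m.

Section Weight.
Variables (V : lmodType D) (M : ds3Module k) (f : M -> V).
Hypotheses (fL : forall (a : k) (u v : M), f (a *: u + v) = a%:A *: f u + f v)
  (fg : forall g m, f (ds_g g m) = Dg k g *: f m)
  (fd : forall h m, f (ds_d h m) = Dd k h *: f m).

Lemma weight_map0 : f 0 = 0.
Proof.
have := fL 1 0 0; rewrite !scale1r addr0 => h.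
by apply: (addrI (f 0)); rewrite addr0.
Qed.
Lemma weight_mapD u v : f (u + v) = f u + f v.
Proof. by rewrite -[u]scale1r fL !scale1r. Qed.
Lemma weight_mapZ (a : k) u : f (a *: u) = a%:A *: f u.
Proof. by rewrite -[a *: u]addr0 fL weight_map0 addr0. Qed.

Lemma range_simple : module_simple M -> ds3_simple (range f).
Proof.
move=> simM; split.
  split=> [|u v [m _ <-] [m' _ <-]|a v [m _ <-]|g v [m _ <-]|h v [m _ <-]].
  - by exists 0 => //; exact: weight_map0.
  - by exists (m + m') => //; exact: weight_mapD.
  - by exists (a *: m) => //; exact: weight_mapZ.
  - by exists (ds_g g m) => //; exact: fg.
  - by exists (ds_d h m) => //; exact: fd.
move=> W [W0 WD WZ Wg Wd] WU [w Ww w0] _ [m _ <-].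
apply: (simM [set m | W (f m)]) => /=.
- by rewrite weight_map0.
- by move=> u v; rewrite weight_mapD; exact: WD.
- by move=> a v; rewrite weight_mapZ; exact: WZ.
- by move=> g v; rewrite fg; exact: Wg.
- by move=> h v; rewrite fd; exact: Wd.
have [m' _ e] := WU w Ww; exists m'; first by rewrite e.
by move=> m0; apply: w0; rewrite -e m0 weight_map0.
Qed.

End Weight.

Lemma verma_proper (M : ds3Module k) (N : set (verma M)) v : module_simple M ->
  submodule N -> N v -> ~ xmul [set: verma M] v -> N = [set: verma M].
Proof.
move=> simM sN Nv nv; have xT : xspan (range (@ket k M)) = [set: verma M].
  by apply/seteqP; split=> // u _; exact: verma_xspan.
have hs : ds3_simple (range (@ket k M)).
  apply: range_simple simM => [a u w|g m|h m]; first by rewrite ketD ketZ.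
    exact: ketg.
  exact: ketd.
apply/seteqP; split=> //; rewrite -{1}xT.
apply: (xspan_nakayama (range_ket_stable M) (xkills5 k) hs sN Nv).
  exact: verma_xspan.
by rewrite xT.
Qed.

(** Both submodules lie in V times the Verma module, hence so does their sum, which must be shown to
    be proper. For general M no coordinates are at hand, so this is drawn from W being proper, again
    by Nakayama. *)
Lemma verma_maximal_unique (M : ds3Module k) (W W' : set (verma M)) :
  module_simple M -> maximal_submodule W -> maximal_submodule W' -> W = W'.
Proof.
move=> simM [_ sW [_ nW] hW] [_ sW' [_ nW'] hW'].
have sub N : submodule N -> ~ [set: verma M] `<=` N -> N `<=` xmul [set: verma M].
  move=> sN hN v Nv; apply: contrapT => nv; apply: hN.
  by rewrite (verma_proper simM sN Nv nv).
pose S := [set v | exists w w', [/\ W w, W' w' & v = w + w']].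
have sS : submodule S.
  split; first by exists 0, 0; rewrite addr0; split=> //; [case: sW | case: sW'].
  move=> a _ _ [u [u' [h1 h2 ->]]] [w [w' [h3 h4 ->]]].
  exists (a *: u + w), (a *: u' + w'); rewrite scalerDr addrACA; split=> //.
    by case: sW => _; apply.
  by case: sW' => _; apply.
have WS : W `<=` S.
  by move=> w Ww; exists w, 0; rewrite addr0; split=> //; case: sW'.
have WS' : W' `<=` S.
  by move=> w Ww; exists 0, w; rewrite add0r; split=> //; case: sW.
have nS : S <> [set: verma M].
  move=> ST; apply: (nW).
  have xT : xmul [set: verma M] = [set: verma M].
    apply/seteqP; split=> // v _; have [w [w' [h1 h2 ->]]] : S v by rewrite ST.
    by apply: xmulD => //; [exact: (sub W sW nW w h1) | exact: (sub W' sW' nW' w' h2)].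
  have xs : xspan (range (@ket k M)) = [set: verma M].
    by apply/seteqP; split=> // u _; exact: verma_xspan.
  rewrite -{1}xs; apply: (xspan_sub (xkills5 k) sW) => u _.
  (* If the sum is everything, then V times the Verma module is everything and contains -u, so every
     u is congruent modulo W to an element of it. *)
  exists (- u); first by rewrite xs xT.
  by rewrite subrr; case: sW.
have [] := hW S sS WS; first by [].
  have [] := hW' S sS WS'; first by [].
    by move=> -> ->.
  by move=> /nS.
by move=> /nS.
Qed.

Lemma radicalE (M : ds3Module k) (W : set (verma M)) :
  module_simple M -> maximal_submodule W -> radical (verma M) = W.
Proof.
move=> simM mW; apply/seteqP; split=> v; first exact.
by move=> Wv W' mW'; rewrite (verma_maximal_unique simM mW' mW).
Qed.

(** The universal property gives a map [phi] from the Verma module onto A. The preimage K of B is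
    maximal since A / B is simple, so K is the radical, and A / B is isomorphic to the head. *)
Lemma factor_head (V : lmodType D) (M : ds3Module k) (U A B : set V) :
  module_simple M -> has_weight U M -> (forall t v, U v -> Dy k t *: v = 0) ->
  A = xspan U -> simple_factor A B -> factor_isog A B (L_head M).
Proof.
move=> simM [f [fL finj fU fg fd]] yU AE [sA sB [BA nAB] hAB].
have fy t m : Dy k t *: f m = 0 by apply: yU; rewrite -fU; exists m.
pose phi := verma_hom f.
have phiL a u v : phi (a *: u + v) = a *: phi u + phi v by exact: verma_homL.
have phik m : phi (ket m) = f m by exact: verma_hom_ket.
have phi0 : phi 0 = 0.
  by have := phiL 1 0 0; rewrite !scale1r addr0 => h; apply: (addrI (phi 0)); rewrite addr0.
have phiA v : A (phi v).
  rewrite AE; elim: (verma_xspan v) => [_ [m _ <-]|u w _ hu _ hw|t w _ hw].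
  - by rewrite phik; apply: xspan_base; rewrite -fU; exists m.
  - by rewrite -[u]scale1r phiL scale1r; apply: xspan_add.
  - by rewrite -[_ *: w]addr0 phiL phi0 addr0; apply: xspan_mul.
have phi_surj v : A v -> exists w, phi w = v.
  rewrite AE; elim=> [u|u w _ [u' <-] _ [w' <-]|t w _ [w' <-]].
  - by rewrite -fU => -[m _ <-]; exists (ket m).
  - by exists (u' + w'); rewrite -[u']scale1r phiL !scale1r.
  - by exists (Dx k t *: w'); rewrite -[_ *: w']addr0 phiL phi0 addr0.
pose K := [set v | B (phi v)].
have sK : submodule K.
  split=> [|a u v]; rewrite /K /= ?phi0; first by case: sB.
  by rewrite phiL; case: sB => _; apply.
have mK : maximal_submodule K.
  split=> //.
    split=> // h; apply: nAB => v /phi_surj [w <-]; exact: h.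
  move=> N sN KN _; pose N' := [set v | exists2 w, N w & v = phi w].
  have sN' : submodule N'.
    split; first by exists 0; [case: sN | rewrite phi0].
    move=> a _ _ [u hu ->] [v hv ->]; exists (a *: u + v); last by rewrite phiL.
    by case: sN => _; apply.
  have [] := hAB N' sN'.
  - move=> b Bb; have [w e] := phi_surj b (BA b Bb); exists w => //.
    by apply: KN; rewrite /K /= e.
  - by move=> _ [w _ ->]; apply: phiA.
  - move=> e; left; apply/seteqP; split=> // w Nw; rewrite /K /= -e; by exists w.
  - move=> e; right; apply/seteqP; split=> // v _.
    have [w Nw ew] : N' (phi v) by rewrite e; apply: phiA.
    rewrite -[v](subrK w); apply: submoduleD => //; apply: KN.
    rewrite /K /= -[- w]scaleN1r addrC phiL scaleN1r -ew addNr.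
    by case: sB.
have rK := radicalE simM mK.
(* [factor_isog] asks for a map from A to the head, against the direction of [phi]; a set-theoretic
   section suffices, being linear on A modulo K. *)
have [psi hpsi] : exists psi : V -> verma M, forall v, A v -> phi (psi v) = v.
  have /choice [psi h] : forall v, exists w, A v -> phi w = v.
    move=> v; case: (pselect (A v)) => [/phi_surj [w <-]|nA]; first by exists w.
    by exists 0.
  by exists psi.
have phiB u v : phi (u - v) = phi u - phi v.
  by rewrite -[- v]scaleN1r addrC phiL scaleN1r addrC.
exists (fun v => hpi (psi v)); split.
- move=> a u v Au Av.
  have -> : a *: hpi (psi u) + hpi (psi v) = hpi (a *: psi u + psi v).
    by rewrite -[RHS]haddE -hscaleE.
  apply/hpiP; rewrite rK /K /= phiB phiL !hpsi ?subrr //; first by case: sB.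
  by apply: (submoduleD sA) => //; apply: (submodule_act a sA).
- apply/seteqP; split=> // x _; elim/hpiW: x => w; exists (phi w) => //.
  by apply/hpiP; rewrite rK /K /= phiB hpsi ?subrr //; case: sB.
- move=> u Au; rewrite -[0]/(hpi 0) hpiP subr0 rK /K /= hpsi //.
Qed.

End Heads.

(** * Simplicity of the modules of weight (tau,0) and (sigma,-) *)

Section SimpleModules.
Variable k : fieldType.

(** The basis vectors have distinct degrees, so some delta_h isolates one of them from any nonzero
    vector; the group then exchanges them. The next module is treated alike, with transitivity of
    conjugation on transpositions. *)
Lemma M_tau_simple : module_simple (M_tau_0 k).
Proof.
move=> P P0 PD PZ Pg Pd [f Pf f0] m.
have [b fb] : exists b, (f : tau_type k) b != 0.
  apply: contrapT => h; apply: f0; apply/ffunP => b; rewrite ffunE.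
  by apply/eqP; apply: contrapT => /negP hb; apply: h; exists b.
pose ket c : M_tau_0 k := [ffun d => (d == c)%:R] : tau_type k.
have tau_inj : injective tau_deg.
  by move=> -[] [] // /(congr1 pcode); rewrite pcode_tau pcode_tauV.
have Pb : P (ket b).
  have -> : ket b = (f b)^-1 *: ds_d (tau_deg b) f.
    apply/ffunP => d; rewrite !ffunE /GRing.scale /=.
    rewrite (inj_eq tau_inj).
    by case: eqP => [->|_]; rewrite ?mulVf ?mulr0.
  by apply/PZ/Pd.
have Pk c : P (ket c).
  case: (eqVneq b c) => [<- //|bc].
  have -> : ket c = ds_g s12 (ket b); last exact: Pg.
  apply/ffunP => d; rewrite !ffunE odd_tperm.
  by case: b c d bc {Pb fb} => -[] -[].
have -> : m = (m true) *: ket true + (m false) *: ket false.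
  apply/ffunP => d; rewrite !ffunE /GRing.scale /=.
  by case: d; rewrite mulr1 mulr0 ?addr0 ?add0r.
by apply: PD; apply: PZ.
Qed.

Lemma sgn_decomp (f : sgn_type k) : f = \sum_t f t *: sgn_ket k t.
Proof.
apply/ffunP => s; rewrite sum_ffunE (bigD1 s) //= big1 => [|u us].
  by rewrite addr0 !ffunE eqxx [RHS]mulr1.
by rewrite !ffunE eq_sym (negPf us) [_ *: _]mulr0.
Qed.

Lemma M_sigma_simple : module_simple (M_sigma_sgn k).
Proof.
move=> P P0 PD PZ Pg Pd [f Pf f0] m.
have [t ft] : exists t, (f : sgn_type k) t != 0.
  apply: contrapT => h; apply: f0; apply/ffunP => t; rewrite ffunE.
  by apply/eqP; apply: contrapT => /negP ht; apply: h; exists t.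
have Pt : P (sgn_ket k t).
  have -> : sgn_ket k t = (f t)^-1 *: ds_d (val t) f.
    apply/ffunP => s; rewrite !ffunE /GRing.scale /= (inj_eq val_inj).
    by case: eqP => [->|_]; rewrite ?mulVf ?mulr0.
  by apply/PZ/Pd.
have Pk s : P (sgn_ket k s).
  have [g e] : exists g, conj_transposition g t = s.
    have [i [j [ij ei]]] := odd_tperm3 (valP t).
    have [i' [j' [ij' ei']]] := odd_tperm3 (valP s).
    have i'' : tperm i i' j != i' by rewrite -{2}(tpermL i i') (inj_eq perm_inj) eq_sym.
    (* First i is sent to i', then the image of j to j'; the second transposition fixes i' because
       neither the image of j nor j' equals i'. *)
    exists (tperm (tperm i i' j) j' \circ tperm i i').
    apply: val_inj; rewrite /= ei ei' -conjgE conjgM !tpermJ tpermL.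
    by rewrite [tperm _ j' i']tpermD ?tpermL // eq_sym.
  have := Pg g _ Pt; rewrite /= sgn_g_ket e => /(PZ ((-1) ^+ odd_perm g)).
  by rewrite scalerA -signr_addb addbb expr0 scale1r.
have -> : m = \sum_t ((m : sgn_type k) t) *: sgn_ket k t :> sgn_type k by exact: sgn_decomp.
apply: (big_ind (fun u : sgn_type k => P u)) => [|u v|u _]; [exact: P0 | exact: PD |].
by apply: PZ; exact: Pk.
Qed.

End SimpleModules.

(** * Coordinates on the Verma module *)

Section Rho.
Variables (k : fieldType) (char0 : [pchar k] =i pred0).
Variables (zeta : k) (zetaP : 3.-primitive_root zeta).
Local Notation M := (M_e_rho zetaP).
Local Notation rho := (rho_type zeta).

Definition rho_coord (m : M) (i : 'I_3) : k := vsval (m : rho) 0 i.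
Definition rho_diff (i j : 'I_3) : M := vsproj (rho_space zeta) (perm_vec k i - perm_vec k j).

Lemma rho_diffE i j l : rho_coord (rho_diff i j) l = (l == i)%:R - (l == j)%:R.
Proof.
rewrite /rho_coord vsprojK; first by rewrite !mxE eqxx.
rewrite (rho_spaceP zetaP) !mxE /=.
by case: (I3_cases i) => ->; case: (I3_cases j) => ->; rewrite /=; apply/eqP; ring.
Qed.

Lemma rho_coord_inj (m m' : M) : rho_coord m =1 rho_coord m' -> m = m'.
Proof. by move=> h; apply: val_inj; apply/rowP => i; exact: h. Qed.

Lemma rho_coordL (a : k) (m m' : M) i :
  rho_coord (a *: m + m') i = a * rho_coord m i + rho_coord m' i.
Proof. by rewrite /rho_coord linearP !mxE. Qed.
Lemma rho_coordZ (a : k) (m : M) i : rho_coord (a *: m) i = a * rho_coord m i.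
Proof. by rewrite /rho_coord linearZ !mxE. Qed.
Lemma rho_coordD (m m' : M) i : rho_coord (m + m') i = rho_coord m i + rho_coord m' i.
Proof. by rewrite /rho_coord linearD !mxE. Qed.
Lemma rho_coord0 i : rho_coord 0 i = 0.
Proof. by rewrite -[0 in LHS](scale0r (0 : M)) rho_coordZ mul0r. Qed.
Lemma rho_coordg g (m : M) i : rho_coord (ds_g g m) i = rho_coord m (g^-1%g i).
Proof. by rewrite /rho_coord /= (rho_val zetaP) mxE. Qed.

Lemma big_I3 (V : nmodType) (f : 'I_3 -> V) : \sum_i f i = f pt1 + f pt2 + f pt3.
Proof.
by rewrite !big_ord_recl big_ord0 addr0 addrA; congr (f _ + f _ + f _); apply: val_inj.
Qed.

Lemma rho_coord_sum (m : M) : \sum_i rho_coord m i = 0.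
Proof. by rewrite big_I3; apply/eqP; rewrite -(rho_spaceP zetaP) subvsP. Qed.

Lemma rho_decomp (m : M) :
  m = rho_coord m pt1 *: rho_diff pt1 pt3 + rho_coord m pt2 *: rho_diff pt2 pt3.
Proof.
have /eqP := rho_coord_sum m; rewrite big_I3 addr_eq0 => /eqP h.
apply: rho_coord_inj => i; rewrite rho_coordL rho_coordZ !rho_diffE.
by case: (I3_cases i) => -> /=; [ring | ring | rewrite -[LHS]opprK -h; ring].
Qed.

(** Everything has degree e, so the group alone must do the work. A nonzero vector has two distinct
    coordinates m_i and m_j: equal coordinates with sum 0 would satisfy 3 m_l = 0. Then (ij) m - m
    is a nonzero multiple of the difference of the i-th and j-th points, and the conjugates of that
    difference span. *)
Lemma M_rho_simple : module_simple M.
Proof.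
move=> P P0 PD PZ Pg Pd [m Pm m0].
have n3 : (3%:R : k) != 0 by move/pcharf0P: char0 => ->.
have [i [j [ij hij]]] : exists i j, i != j /\ rho_coord m i != rho_coord m j.
  apply: contrapT => h; apply: m0; apply: rho_coord_inj => l.
  have e i : rho_coord m i = rho_coord m l.
    case: (eqVneq i l) => [-> //|il]; apply/eqP; apply: contrapT => /negP hil.
    by apply: h; exists i, l.
  have : 3%:R * rho_coord m l = 0.
    by have := rho_coord_sum m; rewrite big_I3 !e => h0; rewrite -[RHS]h0; ring.
  by move/eqP; rewrite mulf_eq0 (negPf n3) rho_coord0 => /eqP.
have Pij : P (rho_diff i j).
  have -> : rho_diff i j = (rho_coord m j - rho_coord m i)^-1 *:
      (ds_g (tperm i j) m + (-1) *: m).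
    apply: rho_coord_inj => l; rewrite rho_coordZ rho_coordD rho_coordZ rho_coordg.
    rewrite rho_diffE tpermV tperm3E.
    have d0 : rho_coord m j - rho_coord m i != 0 by rewrite subr_eq0 eq_sym.
    apply: (mulfI d0); rewrite mulVKf //.
    case: (eqVneq l i) => [->|li]; first by rewrite (negPf ij) /=; ring.
    by case: (eqVneq l j) => [->|lj] /=; ring.
  by apply/PZ/PD; [apply: Pg | apply: PZ].
have Pab a b : a != b -> P (rho_diff a b).
  move=> ab; have ai : tperm i a j != a.
    by rewrite -{2}(tpermL i a) (inj_eq perm_inj) eq_sym.
  have -> : rho_diff a b = ds_g (tperm (tperm i a j) b \circ tperm i a) (rho_diff i j).
    apply: rho_coord_inj => l; rewrite rho_coordg !rho_diffE.
    have e (g : 'S_3) u : ((g^-1)%g l == u) = (l == g u).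
      by rewrite -(inj_eq (@perm_inj _ g)) permKV.
    by rewrite !e !permM !tpermL (tpermD ai) // eq_sym.
  exact: Pg.
by move=> u; rewrite (rho_decomp u); apply: PD; apply/PZ/Pab.
Qed.

End Rho.

(** A separate name, so that the D-module structure does not compete with the k-module structure of
    column vectors. *)
Definition vmod (k : fieldType) : Type := 'cV[k]_24.

Section Model.
Variable k : fieldType.
Local Notation D := (Dalg k).

HB.instance Definition _ := GRing.Zmodule.on (vmod k).

Definition vact (a : D) (v : vmod k) : vmod k := dlift (vrep_relations k) a *m (v : 'cV_24).
Lemma vactA a b v : vact a (vact b v) = vact (a * b) v.
Proof. by rewrite /vact mulmxA [dlift _ (a * b)]rmorphM. Qed.
Lemma vact1 : left_id 1 vact.
Proof. by move=> v; rewrite /vact rmorph1 mul1mx. Qed.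
Lemma vactDr : right_distributive vact +%R.
Proof. by move=> a u v; rewrite /vact mulmxDr. Qed.
Lemma vactDl v : {morph vact^~ v : a b / a + b}.
Proof. by move=> a b; rewrite /vact rmorphD mulmxDl. Qed.
HB.instance Definition _ := GRing.Zmodule_isLmodule.Build D (vmod k) vactA vact1 vactDr vactDl.

Definition mvec (s : svec) : vmod k := cvec k s.

Lemma gen_mvec z s : dgen k z *: mvec s = mvec (sext (opgen z) s).
Proof. by rewrite /mvec -mxop_vec -[LHS]/(vact _ _) /vact dlift_gen. Qed.
Lemma scalar_vmod (a : k) (v : vmod k) : a%:A *: v = (a *: (v : 'cV_24) : 'cV_24).
Proof. by rewrite -[LHS]/(vact _ _) /vact linearZ /= rmorph1 -scalemxAl mul1mx. Qed.
Lemma mvec_eqv s s' : seqv s s' -> mvec s = mvec s'.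
Proof. exact: cvec_eqv. Qed.
Lemma mvec_nil : mvec [::] = 0.
Proof. exact: cvec_nil. Qed.
Lemma mvec_cat s s' : mvec (s ++ s') = mvec s + mvec s'.
Proof. exact: cvec_cat. Qed.
Lemma mvec_scale c s : mvec (sscale c s) = mvec s *~ c.
Proof. by rewrite /mvec cvec_scale scaler_int. Qed.

Lemma xlet_mvec l s : podd l -> xlet k l *: mvec s = mvec (sext (opx l) s).
Proof.
rewrite /podd !inE => h; have [t <-] : exists t, pcode t = l.
  by case/or3P: h => /eqP ->; [exists s12 | exists s23 | exists s13]; rewrite pcode_tperm.
by rewrite -xletE; exact: (gen_mvec (GX t)).
Qed.

Definition sxmon (w : seq (seq nat)) (s : svec) : svec :=
  foldr (fun l u => sext (opx l) u) s w.

Lemma xmon_mvec w s : all podd w -> xmon k w *: mvec s = mvec (sxmon w s).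
Proof.
elim: w => [|l w IH] /=; first by rewrite scale1r.
by case/andP=> hl /IH {IH} IH; rewrite -scalerA IH xlet_mvec.
Qed.

End Model.

Section Coordinates.
Variables (k : fieldType) (zeta : k) (zetaP : 3.-primitive_root zeta).
Local Notation D := (Dalg k).
Local Notation M := (M_e_rho zetaP).
Local Notation V := (verma M).

(** As the coordinates of m sum to 0, m is the sum of its coordinates times the i-th point minus the
    third. Keeping the zero term i = 3 makes reindexing by a permutation possible. *)
Definition rho_vmod (m : M) : vmod k :=
  \sum_(i : 'I_3) (rho_coord m i)%:A *: mvec k (rhov i).

Lemma rho_vmodL (a : k) (u v : M) :
  rho_vmod (a *: u + v) = a%:A *: rho_vmod u + rho_vmod v.
Proof.
rewrite /rho_vmod scaler_sumr -big_split; apply: eq_bigr => i _ /=.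
by rewrite rho_coordL scalerA -scalerDl -scalerAl mul1r scalerA -scalerDl.
Qed.

Lemma rho_vmodg g m : rho_vmod (ds_g g m) = Dg k g *: rho_vmod m.
Proof.
have hg (i : 'I_3) : Dg k g *: mvec k (rhov i) = mvec k (rhov (g i)) - mvec k (rhov (g pt3)).
  rewrite [LHS]gen_mvec -[- mvec _ _]mulrN1z -mvec_scale -mvec_cat; apply: mvec_eqv.
  have ge (j : 'I_3) : nat_of_ord (g j) = nth 0%N (pcode g) j.
    by case: (I3_cases j) => ->.
  rewrite !ge /=.
  have ck : all (fun i => all (fun p => seqv (sext (opg p) (rhov i))
    (rhov (nth 0%N p i) ++ sscale (-1) (rhov (nth 0%N p 2)))) perms3) (iota 0 3) by vm_compute.
  exact: (allP (forall_I3 ck i) _ (pcode_mem g)).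
rewrite /rho_vmod scaler_sumr.
under [RHS]eq_bigr => i _ do rewrite scalerA -scalarC -scalerA hg scalerBr.
(* The term coming from [g pt3] is the same for all i, and the coordinates of m sum to 0. *)
rewrite sumrB -scaler_suml -scaler_suml rho_coord_sum !scale0r subr0.
rewrite (reindex_inj (@perm_inj _ g)); apply: eq_bigr => i _.
by rewrite rho_coordg permK.
Qed.

Lemma rho_vmodd h m : rho_vmod (ds_d h m) = Dd k h *: rho_vmod m.
Proof.
have hd (i : 'I_3) : Dd k h *: mvec k (rhov i) = if h == 1%g then mvec k (rhov i) else 0.
  rewrite [LHS]gen_mvec -(inj_eq pcode_inj) pcode1 -mvec_nil -fun_if; apply: mvec_eqv.
  have ck : all (fun i => all (fun p => seqv (sext (opd p) (rhov i))
    (if p == pone then rhov i else [::])) perms3) (iota 0 3) by vm_compute.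
  exact: (allP (forall_I3 ck i) _ (pcode_mem h)).
rewrite /rho_vmod scaler_sumr; apply: eq_bigr => i _.
rewrite scalerA -scalarC -scalerA hd /=; rewrite /rho_d; case: ifP => // _.
by rewrite rho_coord0 !scale0r scaler0.
Qed.

Lemma rho_vmody t m : Dy k t *: rho_vmod m = 0.
Proof.
rewrite /rho_vmod scaler_sumr big1 // => i _; rewrite scalerA -scalarC -scalerA.
rewrite [Dy k t *: _]gen_mvec -[RHS](scaler0 _ ((rho_coord m i)%:A)) -mvec_nil.
congr (_ *: _); apply: mvec_eqv.
have ck : all (fun i => all (fun p => seqv (sext (opy p) (rhov i)) [::]) perms3) (iota 0 3)
  by vm_compute.
exact: (allP (forall_I3 ck i) _ (pcode_mem t)).
Qed.

Definition coords : V -> vmod k := verma_hom rho_vmod.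

Lemma coords_ket m : coords (ket m) = rho_vmod m.
Proof. exact: (verma_hom_ket rho_vmodL rho_vmodg rho_vmodd rho_vmody). Qed.
Lemma coordsL a u v : coords (a *: u + v) = a *: coords u + coords v.
Proof. exact: (verma_homL rho_vmodL rho_vmodg rho_vmodd rho_vmody). Qed.
Lemma coordsD u v : coords (u + v) = coords u + coords v.
Proof. by rewrite -[u]scale1r coordsL !scale1r. Qed.
Lemma coords0 : coords 0 = 0.
Proof. by apply: (addrI (coords 0)); rewrite -coordsD !addr0. Qed.
Lemma coordsZ a u : coords (a *: u) = a *: coords u.
Proof. by rewrite -[a *: u]addr0 coordsL coords0 addr0. Qed.
Lemma coordsB u v : coords (u - v) = coords u - coords v.
Proof. by rewrite coordsD -scaleN1r coordsZ scaleN1r. Qed.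
Lemma coords_sum (I : Type) (r : seq I) (P : pred I) (f : I -> V) :
  coords (\sum_(i <- r | P i) f i) = \sum_(i <- r | P i) coords (f i).
Proof. exact: (big_morph _ coordsD coords0). Qed.
Lemma coordsMz u n : coords (u *~ n) = coords u *~ n.
Proof.
have e (W : lmodType D) (w : W) : w *~ n = n%:~R *: w by rewrite scaler_int.
by rewrite !e coordsZ.
Qed.

Lemma rho_vmod_diff (e : nat) (i : 'I_3) : nat_of_ord i = e -> (e < 2)%N ->
  rho_vmod (rho_diff zetaP i pt3) = mvec k (term1 e).
Proof.
move=> <- e2; rewrite /rho_vmod big_I3 !rho_diffE.
rewrite [rhov pt3]/= mvec_nil scaler0 addr0.
by case: (I3_cases i) e2 => -> // _ /=; rewrite ?subr0 ?scale1r ?scale0r ?addr0 ?add0r.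
Qed.

Definition basis_vec (j : nat) : V :=
  xword k j./2 *: ket (rho_diff zetaP (if odd j then pt2 else pt1) pt3).

Lemma coords_basis j : (j < 24)%N -> coords (basis_vec j) = mvec k (term1 j).
Proof.
move=> hj; rewrite coordsZ coords_ket (@rho_vmod_diff (odd j)); [|by case: odd..].
have ck : all (fun j => all podd (nth [::] words j./2) &&
  seqv (sxmon (nth [::] words j./2) (term1 (odd j))) (term1 j)) (iota 0 24) by vm_compute.
have j_in : j \in iota 0 24 by rewrite mem_iota.
have /andP [h1 h2] := allP ck j j_in.
by rewrite xmon_mvec //; apply: mvec_eqv.
Qed.

(** By induction along [verma_xspan]: each x_t maps a basis vector to a combination of basis
    vectors, by [xlet_xword]. *)
Lemma verma_basis v : exists c : nat -> k, v = \sum_(j <- iota 0 24) (c j)%:A *: basis_vec j.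
Proof.
pose T := [set v | exists c : nat -> k, v = \sum_(j <- iota 0 24) (c j)%:A *: basis_vec j].
have TD u w : T u -> T w -> T (u + w).
  move=> [c ->] [d ->]; exists (fun j => c j + d j); rewrite -big_split.
  by apply: eq_bigr => j _; rewrite scalerDl scalerDl.
have TZ (a : k) u : T u -> T (a%:A *: u).
  move=> [c ->]; exists (fun j => a * c j); rewrite scaler_sumr.
  by apply: eq_bigr => j _; rewrite scalerA scalarM.
have Tb j : (j < 24)%N -> T (basis_vec j).
  move=> hj; exists (fun i => (i == j)%:R).
  rewrite (bigD1_seq j) ?iota_uniq ?mem_iota //= eqxx !scale1r big1 ?addr0 //.
  by move=> i /negPf ->; rewrite !scale0r.
have T0 : T 0 by exists (fun=> 0); rewrite big1 // => j _; rewrite !scale0r.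
suff : T v by [].
elim: (verma_xspan v) => [_ [m _ <-]|u w _ hu _ hw|t w _ [c ->]].
- rewrite [m in ket m]rho_decomp ketD !ketZ; apply: (TD); apply: (TZ).
    by have := Tb 0%N isT; rewrite /basis_vec /= [xword _ _]/(1 : D) scale1r.
  by have := Tb 1%N isT; rewrite /basis_vec /= [xword _ _]/(1 : D) scale1r.
- exact: TD.
rewrite scaler_sumr big_seq; apply: big_ind => // j; rewrite mem_iota => hj.
rewrite scalerA -scalarC -scalerA; apply: (TZ).
rewrite scalerA xletE xlet_xword; last by case/andP: hj => _; rewrite -divn2 ltn_divLR.
rewrite /xval scaler_suml big_seq; apply: big_ind => // d hd.
have -> : (xword k d.2 *~ d.1) *: ket (rho_diff zetaP (if odd j then pt2 else pt1) pt3)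
  = ((d.1)%:~R : k)%:A *: basis_vec (d.2.*2 + odd j).
  by rewrite /basis_vec [(_ + odd j)%N]addnC half_bit_double oddD odd_double oddb addbF
    scaler_int scalerA mulrzl.
apply/TZ/Tb.
have ck : all (fun p => all (fun j => all (fun d => (d.2 < 12)%N) (nth [::] (xtab p) j))
  (iota 0 12)) perms3 by vm_compute.
have d12 : (d.2 < 12)%N.
  have hj2 : j./2 \in iota 0 12 by rewrite mem_iota -divn2 ltn_divLR //; case/andP: hj.
  exact: (allP (allP (allP ck _ (pcode_mem t)) _ hj2) _ hd).
by rewrite (leq_ltn_trans (leq_add (leqnn _) (leq_b1 _))) // addn1 -[24%N]/(12.*2)%N ltn_Sdouble.
Qed.

(** The spanning family [basis_vec] is mapped to the standard basis of k^24, so upper and lower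
    bounds meet. *)
Lemma coords_inj : injective coords.
Proof.
have ker v : coords v = 0 -> v = 0.
  have [c ->] := verma_basis v => h; rewrite big_seq big1 // => j; rewrite mem_iota => hj.
  have h' : \sum_(i <- iota 0 24) c i *: cvec k (term1 i) = 0.
    rewrite -[RHS]h coords_sum; rewrite !big_seq; apply: eq_bigr => i; rewrite mem_iota => hi.
    by rewrite coordsZ coords_basis // scalar_vmod.
  have /colP/(_ (Ordinal hj)) := h'.
  rewrite summxE (bigD1_seq j) ?iota_uniq ?mem_iota //= big1 => [|i /negPf ij].
    by rewrite !mxE /= eqxx !addr0 mulr1 => ->; rewrite !scale0r.
  by rewrite !mxE /= ij mulr0.
move=> u v e; apply/eqP; rewrite -subr_eq0; apply/eqP/ker.
by rewrite coordsB e subrr.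
Qed.

End Coordinates.

(** * A dual basis *)

Definition wsize (j : nat) : nat := size (nth [::] words j./2).

(* e_0, e_1, e_2, then c and sigma c divided by zeta^2 - zeta, then the basis of
   M(e, rho). *)
Definition hwtab : seq svec :=
  [:: sscale (-1) (term1 2 ++ term1 3); sscale 2 (term1 4) ++ sscale (-1) (term1 5);
      sscale (-1) (term1 12) ++ sscale 2 (term1 13);
      sscale (-1) (term1 17 ++ term1 6); term1 14 ++ term1 8 ++ sscale (-1) (term1 15);
      term1 0; term1 1].

(* A triple (c, w, h) stands for c x_w applied to the h-th vector of hwtab.  A row
   (w, q, d) consists of the functional taking v to the q-th coordinate of y_w v
   and of six times the dual basis vector. *)
Definition xcomb := seq (int * seq (seq nat) * nat).
Definition cert_row := (seq (seq nat) * nat * xcomb)%type.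

Definition xc (c : int) (w : seq (seq nat)) (h : nat) : xcomb := [:: (c, w, h)].

(** By degree, the rows number 2, 3, 2 in [cert0] (degrees 0 to -2), 3, 4, 3 in [cert1] (degrees -1
    to -3) and 2, 3, 2 in [cert2] (degrees -2 to -4). The total 2, 6, 8, 6, 2 is twice the Hilbert
    series of B(V). *)
Definition cert0 : seq cert_row :=
  [:: ([::], 0%N, xc 6 [::] 5); ([::], 1%N, xc 6 [::] 6);
      ([:: la], 0%N, xc (-6) [:: la] 6); ([:: lb], 1%N, xc 3 [:: lb] 6);
      ([:: lc], 0%N, xc 6 [:: lc] 6); ([:: la; lb], 0%N, xc (-6) [:: lb; la] 6);
      ([:: la; lc], 0%N,
       xc 3 [:: lb; lc] 5 ++ xc 3 [:: la; lb] 6 ++ xc (-6) [:: lb; lc] 6)].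
Definition cert1 : seq cert_row :=
  [:: ([::], 2%N, xc (-6) [::] 0); ([::], 4%N, xc 3 [::] 1);
      ([::], 12%N, xc (-6) [::] 2);
      ([:: la], 4%N, xc (-2) [:: lc] 0 ++ xc 1 [:: la] 1 ++ xc 1 [:: lb] 2);
      ([:: la], 12%N, xc (-6) [:: la] 2);
      ([:: lb], 2%N, xc (-4) [:: lb] 0 ++ xc 2 [:: lc] 1 ++ xc (-4) [:: la] 2);
      ([:: lb], 12%N, xc (-6) [:: lb] 2);
      ([:: la; lb], 4%N, xc 2 [:: la; lb] 0 ++ xc 1 [:: lb; la] 1);
      ([:: la; lb], 12%N, xc (-6) [:: lb; la] 2);
      ([:: la; lc], 12%N, xc 6 [:: la; lb] 2)].
Definition cert2 : seq cert_row :=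
  [:: ([::], 6%N, xc (-6) [::] 3); ([::], 8%N, xc 6 [::] 4);
      ([:: la], 6%N, xc (-6) [:: la] 3); ([:: la], 8%N, xc (-6) [:: lb] 3);
      ([:: lb], 8%N, xc (-6) [:: lc] 3);
      ([:: la; lb], 6%N, xc (-2) [:: lb; la] 3 ++ xc 2 [:: la; lc] 3);
      ([:: la; lc], 8%N, xc 2 [:: lb; la] 3 ++ xc 4 [:: la; lc] 3)].
Definition cert : seq cert_row := cert0 ++ cert1 ++ cert2.

Definition sxcomb (d : xcomb) : svec :=
  flatten [seq sscale z.1.1 (sxmon z.1.2 (nth [::] hwtab z.2)) | z <- d].
Definition opymon (w : seq (seq nat)) : nat -> svec := foldr (fun l f => opM (opy l) f) op1 w.
(** The rank-one operator v -> (q-th coordinate of y_w v) d for the row (w, q, d). *)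
Definition opcert_row (r : cert_row) (j : nat) : svec :=
  sscale (scoef (opymon r.1.1 j) r.1.2) (sxcomb r.2).
Definition opcert : nat -> svec := foldr (fun r f => opD (opcert_row r) f) op0 cert.

(** As 24 rank-one operators in dimension 24 add up to 6 times the identity, the functionals form a
    basis of the dual space and the vectors are 6 times the dual basis. *)
Lemma opcert_check : opeq (opZ 6 op1) opcert.
Proof. by vm_compute. Qed.

Section Layers.
Variable k : fieldType.
Variables (zeta : k) (zetaP : 3.-primitive_root zeta).
Local Notation D := (Dalg k).
Local Notation M := (M_e_rho zetaP).
Local Notation V := (verma M).

Definition ylet (l : seq nat) : D :=
  Dy k (if l == la then s12 else if l == lb then s23 else s13).
Definition ymon (w : seq (seq nat)) : D := foldr (fun l p => ylet l * p) 1 w.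

Lemma dlift_ylet l : podd l -> dlift (vrep_relations k) (ylet l) = mxop k (opy l).
Proof.
by rewrite /podd !inE => /or3P [] /eqP ->; rewrite /ylet /= dlift_gen /vrep /= pcode_tperm.
Qed.

Lemma dlift_ymon w : all podd w -> dlift (vrep_relations k) (ymon w) = mxop k (opymon w).
Proof.
elim: w => [|l w IH] /=; first by rewrite rmorph1 mxop1.
by case/andP=> hl /IH {IH} IH; rewrite rmorphM /= IH dlift_ylet // mxopM.
Qed.

Definition entry (u : vmod k) (q : nat) : k := (u : 'cV_24) (inord q) 0.

Lemma entryD u v q : entry (u + v) q = entry u q + entry v q.
Proof. exact: mxE. Qed.
Lemma entry_scalar (a : k) u q : entry (a%:A *: u) q = a * entry u q.
Proof. by rewrite scalar_vmod /entry mxE. Qed.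
Lemma entry_mvec s q : (q < 24)%N -> entry (mvec k s) q = (scoef s q)%:~R.
Proof. by move=> hq; rewrite /entry mxE inordK. Qed.
Lemma entry0 q : entry 0 q = 0.
Proof. by rewrite /entry mxE. Qed.

Lemma entryN u q : entry (- u) q = - entry u q.
Proof. exact: mxE. Qed.
Lemma entry_ext u v : (forall q, entry u q = entry v q) -> u = v.
Proof. by move=> h; apply/colP => q; have := h (val q); rewrite /entry inord_val. Qed.

Definition functional (r : cert_row) (v : V) : k :=
  entry (coords (ymon r.1.1 *: v)) r.1.2.

Lemma cert_rowE f q s (u : 'cV[k]_24) : (q < 24)%N ->
  mxop k (fun j => sscale (scoef (f j) q) s) *m u = (mxop k f *m u) (inord q) 0 *: cvec k s.
Proof.
move=> hq; apply/colP => i; rewrite !mxE mulr_suml; apply: eq_bigr => j _.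
by rewrite !mxE inordK // scoef_scale intrM mulrAC.
Qed.

Lemma coords_decomposition v :
  coords v *~ 6 = \sum_(r <- cert) (functional r v)%:A *: mvec k (sxcomb r.2).
Proof.
have ck : all (fun r => all podd r.1.1 && (r.1.2 < 24)%N) cert by [].
transitivity (mxop k opcert *m (coords v : 'cV_24)).
  by rewrite -(mxop_eq k opcert_check) -mxopZ -mxop1 -scalemxAl mul1mx scaler_int.
rewrite /opcert; elim: cert ck => [|r c IH] /=; first by rewrite big_nil -mxop0 mul0mx.
case/andP=> /andP [hr hq] /IH {IH} IH; rewrite big_cons -mxopD mulmxDl IH; congr (_ + _).
rewrite cert_rowE // scalar_vmod.
by rewrite /functional coordsZ -[ymon _ *: _]/(vact _ _) /vact dlift_ymon.
Qed.

Lemma e_vec_coords (i : 'I_3) : coords (e_vec zetaP i) = mvec k (nth [::] hwtab i).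
Proof.
have zV := zetaVE zetaP.
have zs : zeta ^+ 2 = - 1 - zeta
  by apply/eqP; rewrite -subr_eq0 -(zeta_sum zetaP); apply/eqP; ring.
(* For a transposition s, s x_s = - x_s s, so (1 - s) x_s m = x_s (1 + s) m, and 1 + s has rank one
   on M(e,rho). Thus 1 - 3 and 2 - 3 go to multiples of one vector; [n0] and [n1] list the factors
   for i = 0, 1, 2. *)
pose n0 : seq int := [:: -1; 1; 0]; pose n1 : seq int := [:: -1; 0; 1].
set s := sigma \circ (tau ^+ i)%g.
have ps : pcode s = nth [::] [:: la; lb; lc] i.
  rewrite /s; case: (I3_cases i) => -> /=; rewrite ?expg0 ?expg1 ?expgS ?expg0 ?mulg1;
    by rewrite ?pcodeM ?pcode1 ?pcode_tperm.
have ck : all (fun i => all (fun e =>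
    let u := sext (opx (nth [::] [:: la; lb; lc] i)) (term1 e) in
    seqv (u ++ sscale (-1) (sext (opg (nth [::] [:: la; lb; lc] i)) u))
      (sscale (nth 0 (if e == 0%N then n0 else n1) i) (nth [::] hwtab i)))
  (iota 0 2)) (iota 0 3) by vm_compute.
have act (e : nat) : e \in iota 0 2 -> ((1 - Dg k s) * Dx k s) *: mvec k (term1 e)
    = mvec k (nth [::] hwtab i) *~ nth 0 (if e == 0%N then n0 else n1) i.
  move=> he; rewrite -scalerA [Dx k s *: _]gen_mvec scalerBl scale1r [Dg k s *: _]gen_mvec /= ps.
  rewrite -[- mvec _ _]mulrN1z -!mvec_scale -mvec_cat; apply: mvec_eqv.
  exact: (allP (forall_I3 ck i) e he).
have kE : rho_vmod (rho_ket zeta zeta : M) =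
    (zeta^-1)%:A *: mvec k (term1 0) + zeta%:A *: mvec k (term1 1).
  have [h1 h2 _] := rho_vecE zeta.
  rewrite /rho_vmod big_I3 [rhov pt3]/= mvec_nil scaler0 addr0 /rho_coord.
  by rewrite vsprojK ?h1 ?h2 // memv_span // inE eqxx.
rewrite /e_vec -/s coordsZ coords_ket kE -mulrA -scalerA scalerDr !scalar_swap.
rewrite !act // !scalar_int !scalerA !scalarM -scalerDl -scalerDl scalerA scalarM.
rewrite -[RHS]scale1r -[X in _ = X *: _](scale1r (1 : D)); congr (_%:A *: _).
(* What remains is zeta^i (zeta^-1 n0_i + zeta n1_i) = 1. *)
case: (I3_cases i) => -> /=; rewrite ?expr0 ?expr1 zV; ring: zs.
Qed.

Lemma c_vec_coords (i : 'I_2) :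
  coords (c_vec zetaP i) = (zeta ^+ 2 - zeta)%:A *: mvec k (nth [::] hwtab (3 + i)).
Proof.
have zV := zetaVE zetaP.
have zs : zeta ^+ 2 = - 1 - zeta
  by apply/eqP; rewrite -subr_eq0 -(zeta_sum zetaP); apply/eqP; ring.
have ketE (w : k) : w = zeta \/ w = zeta^-1 -> rho_vmod (rho_ket zeta w : M) =
    (w^-1)%:A *: mvec k (term1 0) + w%:A *: mvec k (term1 1).
  move=> hw; have [h1 h2 _] := rho_vecE w.
  rewrite /rho_vmod big_I3 [rhov pt3]/= mvec_nil scaler0 addr0 /rho_coord.
  rewrite vsprojK ?h1 ?h2 // memv_span // !inE.
  by case: hw => ->; rewrite eqxx ?orbT.
have cE : coords (c_elt zetaP) = (zeta ^+ 2 - zeta)%:A *: mvec k (nth [::] hwtab 3).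
  rewrite /c_elt coordsD !coordsZ !coords_ket !ketE; [|by right|by left].
  have AE e : e \in iota 0 2 ->
    Dx k s13 *: (Dx k s12 *: mvec k (term1 e)) = mvec k (sxmon [:: lc; la] (term1 e)).
    by move=> _; rewrite -xmon_mvec // /xmon /= mulr1 scalerA.
  have BE e : e \in iota 0 2 ->
    Dx k s12 *: (Dx k s23 *: mvec k (term1 e)) = mvec k (sxmon [:: la; lb] (term1 e)).
    by move=> _; rewrite -xmon_mvec // /xmon /= mulr1 scalerA.
  (* In the expansion of c the coefficient of ca on 1 - 3 cancels; the three others are zeta^2 -
     zeta up to sign. *)
  have -> : mvec k (nth [::] hwtab 3) = mvec k (sxmon [:: lc; la] (term1 1))
      - mvec k (sxmon [:: la; lb] (term1 0)) + mvec k (sxmon [:: la; lb] (term1 1)).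
    rewrite -[- mvec _ _]mulrN1z -!mvec_scale -!mvec_cat; apply: mvec_eqv; by vm_compute.
  (* The scalar is given a name to keep [scalerBl] from distributing over it. *)
  have [d dE] : exists d, d = zeta ^+ 2 - zeta by eexists.
  rewrite -dE.
  rewrite -!mulrA !scalerDr !scalar_swap !scalerBl -!scalerA !AE // !BE // invrK.
  apply: entry_ext => q; rewrite !(entryD, entryN, entry_scalar) zV.
  by rewrite dE; ring: zs.
rewrite /c_vec; case: i => -[|[|//]] hi /=; first exact: cE.
rewrite coordsZ cE scalar_swap [Dg k _ *: _]gen_mvec /= pcode_tperm; congr (_ *: _).
by apply: mvec_eqv; vm_compute.
Qed.

End Layers.

(** * Weights of E and C *)

Section Weights.
Variable k : fieldType.
Variables (zeta : k) (zetaP : 3.-primitive_root zeta).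
Local Notation D := (Dalg k).
Local Notation M := (M_e_rho zetaP).
Local Notation V := (verma M).
Local Notation E := (kspan (e_vec zetaP)).
Local Notation C := (kspan (c_vec zetaP)).
Local Notation hw h := (nth [::] hwtab h).

Lemma zeta_diff_neq0 : zeta ^+ 2 - zeta != 0.
Proof.
have -> : zeta ^+ 2 - zeta = zeta * (zeta - 1) by ring.
by rewrite mulf_eq0 negb_or zeta_neq0 //= subr_eq0 -(prim_order_dvd zetaP 1).
Qed.

Lemma e_vec_free : kfree (e_vec zetaP).
Proof.
move=> a h i; have e q : entry (\sum_i (a i)%:A *: mvec k (hw i)) q = 0.
  rewrite -[RHS](entry0 k q) -[X in _ = entry X q](coords0 zetaP).
  rewrite -[X in coords X]h coords_sum; congr (entry _ q).
  by apply: eq_bigr => j _; rewrite coordsZ e_vec_coords.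
have {}e q : (q < 24)%N -> \sum_i a i * (scoef (hw i) q)%:~R = 0.
  move=> hq; rewrite -[RHS](e q) !big_I3 !entryD !entry_scalar !entry_mvec //.
(* Each of the coordinates 3, 5, 12 occurs in exactly one of the three vectors, with coefficient
   -1. *)
have h3 := e 3%N isT; have h5 := e 5%N isT; have h12 := e 12%N isT.
rewrite !big_I3 /= ?mulr0 ?add0r ?addr0 in h3 h5 h12.
rewrite !mulr1 !mulrN1 in h3 h5 h12.
by case: (I3_cases i) => ->; apply: oppr_inj; rewrite oppr0.
Qed.

Lemma c_vec_free : kfree (c_vec zetaP).
Proof.
move=> a h i; have e q : entry (\sum_i (a i)%:A *: mvec k (hw (3 + i))) q = 0.
  apply: (mulfI zeta_diff_neq0); rewrite mulr0 -entry_scalar.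
  rewrite -[RHS](entry0 k q) -[X in _ = entry X q](coords0 zetaP).
  rewrite -[X in coords X]h coords_sum scaler_sumr; congr (entry _ q).
  by apply: eq_bigr => j _; rewrite coordsZ c_vec_coords scalar_swap.
have {}e q : (q < 24)%N -> \sum_i a i * (scoef (hw (3 + i)) q)%:~R = 0.
  move=> hq; rewrite -[RHS](e q) !big_ord_recl !big_ord0 !entryD !entry_scalar !entry_mvec //.
  by rewrite entry0.
have h6 := e 6%N isT; have h8 := e 8%N isT.
rewrite !big_ord_recl !big_ord0 /= ?mulr0 ?add0r ?addr0 in h6 h8.
case: i => -[|[|//]] hi.
  have -> : Ordinal hi = ord0 by apply: val_inj.
  by apply: oppr_inj; rewrite oppr0 -h6 mulrN1.
have -> : Ordinal hi = lift ord0 ord0 by apply: val_inj.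
by rewrite -h8 mulr1.
Qed.

(** The i with t = sigma tau^i, so that [e_map] sends the ket of t to e_i. *)
Definition e_index (t : transposition) : 'I_3 :=
  inord (index (pcode (val t)) [:: la; lb; lc]).

Lemma e_indexE t : nat_of_ord (e_index t) = index (pcode (val t)) [:: la; lb; lc].
Proof.
have : pcode (val t) \in [:: la; lb; lc] by rewrite -[_ \in _]/(podd _) -pcode_odd (valP t).
by rewrite -index_mem; exact: inordK.
Qed.

Lemma e_index_inj : injective e_index.
Proof.
move=> s t e; apply/val_inj/pcode_inj; have := congr1 (@nat_of_ord 3) e; rewrite !e_indexE.
have podd_mem (u : transposition) : pcode (val u) \in [:: la; lb; lc].
  by rewrite -[_ \in _]/(podd _) -pcode_odd (valP u).
by move/(congr1 (nth [::] [:: la; lb; lc])); rewrite !nth_index.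
Qed.

Definition e_map (f : M_sigma_sgn k) : V :=
  \sum_t (((f : sgn_type k) t : k)%:A : D) *: e_vec zetaP (e_index t).

Lemma e_vec_transposition t : coords (e_vec zetaP (e_index t)) =
  mvec k (hw (index (pcode (val t)) [:: la; lb; lc])).
Proof. by rewrite e_vec_coords e_indexE. Qed.

Lemma e_vec_g g t : Dg k g *: e_vec zetaP (e_index t) =
  ((-1) ^+ odd_perm g)%:A *: e_vec zetaP (e_index (conj_transposition g t)).
Proof.
apply: coords_inj; rewrite coordsZ [RHS]coordsZ !e_vec_transposition [Dg k g *: _]gen_mvec /=.
have -> : (-1) ^+ odd_perm g = (psgn (pcode g))%:~R :> k by rewrite /psgn pcode_odd; case: podd.
rewrite -scalar_int -mvec_scale; apply: mvec_eqv; rewrite !pcodeM pcodeV.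
have ck : all (fun g => all (fun t => podd t ==>
  seqv (sext (opg g) (hw (index t [:: la; lb; lc])))
  (sscale (psgn g) (hw (index (pconj g t) [:: la; lb; lc])))) perms3) perms3 by vm_compute.
have /implyP := allP (allP ck _ (pcode_mem g)) _ (pcode_mem (val t)); apply.
by rewrite -pcode_odd (valP t).
Qed.

Lemma e_vec_d h t : Dd k h *: e_vec zetaP (e_index t) =
  if val t == h then e_vec zetaP (e_index t) else 0.
Proof.
apply: coords_inj; rewrite coordsZ [in RHS]fun_if coords0 e_vec_transposition.
rewrite [Dd k h *: _]gen_mvec /= -mvec_nil -fun_if -(inj_eq pcode_inj); apply: mvec_eqv.
have ck : all (fun h => all (fun t => podd t ==>
  seqv (sext (opd h) (hw (index t [:: la; lb; lc])))
  (if t == h then hw (index t [:: la; lb; lc]) else [::])) perms3) perms3 by vm_compute.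
have /implyP := allP (allP ck _ (pcode_mem h)) _ (pcode_mem (val t)); apply.
by rewrite -pcode_odd (valP t).
Qed.

Lemma hw_y t h : (h < 5)%N -> Dy k t *: mvec k (hw h) = 0.
Proof.
move=> hh; rewrite gen_mvec -mvec_nil; apply: mvec_eqv.
have ck : all (fun t => all (fun h => seqv (sext (opy t) (hw h)) [::]) (iota 0 5)) perms3
  by vm_compute.
by apply: (allP (allP ck _ (pcode_mem t))); rewrite mem_iota.
Qed.

Lemma E_y t v : E v -> Dy k t *: v = 0.
Proof.
move=> [a ->]; apply: coords_inj; rewrite coordsZ coords_sum coords0 scaler_sumr big1 // => i _.
rewrite coordsZ scalar_swap e_vec_coords hw_y ?scaler0 //.
exact: ltn_trans (ltn_ord i) _.
Qed.

Lemma C_y t v : C v -> Dy k t *: v = 0.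
Proof.
move=> [a ->]; apply: coords_inj; rewrite coordsZ coords_sum coords0 scaler_sumr big1 // => i _.
rewrite coordsZ scalar_swap c_vec_coords scalar_swap hw_y ?scaler0 //.
by rewrite -[5%N]/(3 + 2)%N ltn_add2l.
Qed.

Lemma e_index_bij : bijective e_index.
Proof.
pose e_inv (i : 'I_3) : transposition :=
  insubd (Sub s12 (odd_tperm pt1 pt2) : transposition) (nth 1%g [:: s12; s23; s13] i).
apply: (Bijective (g := e_inv)) => [t|i]; last first.
  apply: ord_inj; rewrite e_indexE /= val_insubd.
  by case: (I3_cases i) => -> /=; rewrite odd_tperm /= pcode_tperm.
apply: e_index_inj; apply: ord_inj; rewrite e_indexE /= val_insubd e_indexE.
have [i [j [ij et]]] := odd_tperm3 (valP t).
case: t et => t ot /= ->; rewrite pcode_tperm.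
by case: (I3_cases i) (I3_cases j) => -> [] -> in ij *; rewrite // odd_tperm /= pcode_tperm.
Qed.

Lemma E_weight : has_weight E (M_sigma_sgn k).
Proof.
have [einv eK Ke] := e_index_bij.
have e_mapE f : e_map f = \sum_i ((f : sgn_type k) (einv i) : k)%:A *: e_vec zetaP i.
  rewrite /e_map (reindex einv); last by exists e_index => i _.
  by apply: eq_bigr => i _; rewrite Ke.
have e_mapL (a : k) u v : e_map (a *: u + v) = a%:A *: e_map u + e_map v.
  rewrite /e_map scaler_sumr -big_split; apply: eq_bigr => t _ /=.
  by rewrite !ffunE scalerDl scalerDl [in RHS]scalerA scalarM.
exists e_map; split=> //.
- move=> f g fg; apply/ffunP => t.
  have : e_map ((-1 : k) *: f + g) = 0 by rewrite e_mapL fg !scaleN1r addNr.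
  rewrite e_mapE => /e_vec_free/(_ (e_index t)); rewrite eK !ffunE.
  by rewrite [_ *: _]mulN1r addrC => /eqP; rewrite subr_eq0 => /eqP.
- apply/seteqP; split=> [_ [f _ <-]|v [a ->]].
    by exists (fun i => (f : sgn_type k) (einv i)).
  exists ([ffun t => a (e_index t)] : sgn_type k) => //.
  by rewrite e_mapE; apply: eq_bigr => i _; rewrite ffunE Ke.
- move=> g f; rewrite /e_map scaler_sumr.
  rewrite (reindex_inj (h := conj_transposition g)) /=.
    apply: eq_bigr => t _; rewrite ffunE -conj_transpositionM mulgV conj_transposition1.
    by rewrite scalar_swap e_vec_g [RHS]scalerA scalarM mulrC.
  move=> s t /(congr1 (conj_transposition g^-1%g)).
  by rewrite -!conj_transpositionM mulgV !conj_transposition1.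
- move=> h f; rewrite /e_map scaler_sumr; apply: eq_bigr => t _.
  rewrite ffunE scalar_swap e_vec_d; case: ifP => //.
  by rewrite scaler0 !scale0r.
Qed.

Lemma c_vec_g (g : 'S_3) (b : bool) :
  Dg k g *: c_vec zetaP (if b then ord0 else lift ord0 ord0) =
  c_vec zetaP (if b (+) odd_perm g then ord0 else lift ord0 ord0).
Proof.
apply: coords_inj; rewrite coordsZ !c_vec_coords scalar_swap; congr (_ *: _).
rewrite gen_mvec pcode_odd; apply: mvec_eqv.
have ck : all (fun g => all (fun b : bool => seqv (sext (opg g) (hw (if b then 3 else 4)%N))
  (hw (if b (+) podd g then 3 else 4)%N)) [:: true; false]) perms3 by vm_compute.
have := allP (allP ck _ (pcode_mem g)) b; rewrite !inE /=.
by case: b => /(_ isT); case: podd.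
Qed.

Lemma c_vec_d (h : 'S_3) (b : bool) :
  Dd k h *: c_vec zetaP (if b then ord0 else lift ord0 ord0) =
  if tau_deg b == h then c_vec zetaP (if b then ord0 else lift ord0 ord0) else 0.
Proof.
apply: coords_inj; rewrite coordsZ [in RHS]fun_if coords0 !c_vec_coords scalar_swap.
rewrite -[0 in RHS](scaler0 _ ((zeta ^+ 2 - zeta)%:A)) -fun_if -mvec_nil -fun_if.
congr (_ *: _); rewrite gen_mvec -(inj_eq pcode_inj); apply: mvec_eqv.
have ck : all (fun h => all (fun b : bool => seqv (sext (opd h) (hw (if b then 3 else 4)%N))
  (if (if b then [:: 1; 2; 0] else [:: 2; 0; 1])%N == h
   then hw (if b then 3 else 4)%N else [::]))
  [:: true; false]) perms3 by vm_compute.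
have := allP (allP ck _ (pcode_mem h)) b; rewrite !inE /tau_deg.
by case: b => /(_ isT); rewrite ?pcode_tau ?pcode_tauV.
Qed.

(** c has degree tau and sigma c has degree tau^-1, so they are the images of the kets of tau and
    tau^-1. *)
Definition c_map (f : M_tau_0 k) : V :=
  \sum_(b : bool) (((f : tau_type k) b : k)%:A : D) *:
    c_vec zetaP (if b then ord0 else lift ord0 ord0).

Lemma C_weight : has_weight C (M_tau_0 k).
Proof.
have c_mapE f : c_map f =
    \sum_i ((f : tau_type k) (i == ord0) : k)%:A *: c_vec zetaP i.
  by rewrite /c_map big_bool !big_ord_recl big_ord0 addr0.
have c_mapL (a : k) u v : c_map (a *: u + v) = a%:A *: c_map u + c_map v.
  rewrite /c_map scaler_sumr -big_split; apply: eq_bigr => t _ /=.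
  by rewrite !ffunE scalerDl scalerDl [in RHS]scalerA scalarM.
exists c_map; split=> //.
- move=> f g fg; apply/ffunP => b.
  have : c_map ((-1 : k) *: f + g) = 0 by rewrite c_mapL fg !scaleN1r addNr.
  rewrite c_mapE => /c_vec_free/(_ (if b then ord0 else lift ord0 ord0)).
  have -> : ((if b then ord0 else lift ord0 ord0) == ord0 :> 'I_2) = b by case: b.
  by rewrite !ffunE [_ *: _]mulN1r addrC => /eqP; rewrite subr_eq0 => /eqP.
- apply/seteqP; split=> [_ [f _ <-]|v [a ->]].
    by exists (fun i => (f : tau_type k) (i == ord0)).
  exists ([ffun b => a (if b then ord0 else lift ord0 ord0)] : tau_type k) => //.
  by rewrite c_mapE !big_ord_recl !big_ord0 !ffunE.
- move=> g f; rewrite /c_map scaler_sumr.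
  rewrite (reindex_inj (h := fun b => b (+) odd_perm g)) /=; last exact: addIb.
  apply: eq_bigr => b _; rewrite ffunE -addbA addbb addbF.
  by rewrite scalar_swap c_vec_g.
- move=> h f; rewrite /c_map scaler_sumr; apply: eq_bigr => b _.
  rewrite ffunE scalar_swap c_vec_d; case: ifP => //.
  by rewrite scaler0 !scale0r.
Qed.

End Weights.

(** * The lattice of submodules *)

Section Lattice.
Variables (k : fieldType) (char0 : [pchar k] =i pred0).
Variables (zeta : k) (zetaP : 3.-primitive_root zeta).
Local Notation D := (Dalg k).
Local Notation M := (M_e_rho zetaP).
Local Notation V := (verma M).
Local Notation E := (kspan (e_vec zetaP)).
Local Notation C := (kspan (c_vec zetaP)).
Local Notation hw h := (nth [::] hwtab h).

Lemma vdeg_stable (N : ds3Module k) n : ds3_stable (vdeg N n).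
Proof. by elim: n => [|n IH]; [exact: range_ket_stable | exact: xmul_stable]. Qed.

Lemma stable_sum (W : lmodType D) (S : set W) (I : Type) (r : seq I) (P : pred I) (f : I -> W) :
  ds3_stable S -> (forall i, P i -> S (f i)) -> S (\sum_(i <- r | P i) f i).
Proof. by move=> sS hf; apply: big_ind => //; [exact: ds3_0 | exact: (ds3_D sS)]. Qed.

Lemma kspan_sub (W : lmodType D) (S : set W) n (e : 'I_n -> W) :
  ds3_stable S -> (forall i, S (e i)) -> kspan e `<=` S.
Proof. by move=> sS he v [a ->]; apply: stable_sum => // i _; apply: (ds3_Z sS). Qed.

Lemma kspan_mem (W : lmodType D) n (e : 'I_n -> W) i : kspan e (e i).
Proof.
exists (fun j => (j == i)%:R); rewrite (bigD1 i) //= eqxx !scale1r big1 ?addr0 //.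
by move=> j /negPf ->; rewrite !scale0r.
Qed.

Lemma vdeg_x (N : ds3Module k) n t v : vdeg N n v -> vdeg N n.+1 (Dx k t *: v).
Proof. exact: (xmul_x t (ds3_0 (vdeg_stable N n))). Qed.

Lemma E_deg : E `<=` vdeg M 1.
Proof.
apply: kspan_sub => [|i]; first exact: vdeg_stable.
have sM := vdeg_stable M 1; rewrite /e_vec -mulrA -scalerA; apply: (ds3_Z sM).
rewrite -scalerA scalerBl scale1r; set v := _ *: _.
have hv : vdeg M 1 v by apply: vdeg_x; exists (rho_ket zeta zeta).
by apply: (ds3_D sM) => //; apply: ds3_N => //; apply: (ds3_g sM).
Qed.

Lemma C_deg : C `<=` vdeg M 2.
Proof.
have sM := vdeg_stable M 2.
have xx t s m : vdeg M 2 ((Dx k t * Dx k s) *: ket m).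
  by rewrite -scalerA; do 2!apply: vdeg_x; exists m.
have axx (a : k) t s m : vdeg M 2 ((a%:A * Dx k t * Dx k s) *: ket m).
  by rewrite -mulrA -scalerA; apply: (ds3_Z sM).
have hc : vdeg M 2 (c_elt zetaP).
  rewrite /c_elt !scalerBl; apply: (ds3_D sM); apply: (ds3_D sM) => //.
    by apply: (ds3_N sM); apply: xx.
  by apply: (ds3_N sM); apply: axx.
apply: kspan_sub => // i; rewrite /c_vec; case: ifP => // _; exact: (ds3_g sM).
Qed.

(** The vectors of the Verma module whose coordinates are listed in [hwtab]; dividing by zeta^2 -
    zeta makes c and sigma c integral. *)
Definition hwvec (h : nat) : V :=
  if (h < 3)%N then e_vec zetaP (inord h)
  else if (h < 5)%N then ((zeta ^+ 2 - zeta)^-1)%:A *: c_vec zetaP (inord (h - 3))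
  else ket (rho_diff zetaP (if h == 5%N then pt1 else pt2) pt3).

Lemma hwvec_coords h : (h < 7)%N -> coords (hwvec h) = mvec k (hw h).
Proof.
move=> h7; rewrite /hwvec; case: ltnP => [h3|h3]; first by rewrite e_vec_coords inordK.
case: ltnP => [h5|h5].
  rewrite coordsZ c_vec_coords scalerA scalarM mulVf ?zeta_diff_neq0 // !scale1r.
  by rewrite inordK ?subnKC // ltn_subLR.
rewrite coords_ket; case: h h7 h3 h5 => [|[|[|[|[|[|[|//]]]]]]] // _ _ _ /=.
  exact: (@rho_vmod_diff _ _ _ 0).
exact: (@rho_vmod_diff _ _ _ 1).
Qed.

Definition xcombv (d : xcomb) : V := \sum_(z <- d) (xmon k z.1.2 *: hwvec z.2) *~ z.1.1.

Lemma xcombv_coords d : all (fun z => all podd z.1.2 && (z.2 < 7)%N) d ->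
  coords (xcombv d) = mvec k (sxcomb d).
Proof.
rewrite /xcombv /sxcomb; elim: d => [|z d IH] /=; first by rewrite big_nil coords0 mvec_nil.
case/andP=> /andP [hz h7] /IH {IH} IH; rewrite big_cons coordsD IH mvec_cat; congr (_ + _).
by rewrite coordsMz coordsZ hwvec_coords // xmon_mvec // mvec_scale.
Qed.

Lemma xcombv_mem (A : set V) d : submodule A -> (forall z, z \in d -> A (hwvec z.2)) ->
  A (xcombv d).
Proof.
move=> sA hd; rewrite /xcombv big_seq; apply: submodule_sum => // z hz.
by rewrite scalar_int; do 2!apply: (submodule_act _ sA); apply: hd.
Qed.

Lemma int_neq0 n : (n.+1%:R : k) != 0.
Proof. by move/pcharf0P: char0 => ->. Qed.

Lemma mulrn_mem (A : set V) v n : submodule A -> A (v *~ n.+1%:Z) -> A v.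
Proof.
move=> sA hv; have -> : v = (n.+1%:R^-1)%:A *: (v *~ n.+1%:Z).
  by rewrite scalar_int scalerA scalarM mulVf ?int_neq0 // !scale1r.
exact: (submodule_act _ sA).
Qed.

(** The decomposition of 6 v along the dual basis involves only the rows whose functional does not
    vanish at v, and 6 is invertible. *)
Lemma decomposition_mem (A : set V) v : submodule A ->
  (forall r, r \in cert -> functional r v <> 0 -> A (xcombv r.2)) -> A v.
Proof.
move=> sA hA; apply: (@mulrn_mem _ _ 5) => //.
have -> : v *~ 6 = \sum_(r <- cert) (functional r v)%:A *: xcombv r.2.
  apply: coords_inj; rewrite coordsMz coords_decomposition // coords_sum.
  have ck : all (fun r => all (fun z => all podd z.1.2 && (z.2 < 7)%N) r.2) cert by [].
  rewrite !big_seq; apply: eq_bigr => r hr; rewrite coordsZ xcombv_coords //.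
  exact: (allP ck).
rewrite big_seq; apply: submodule_sum => // r hr.
case: (pselect (functional r v = 0)) => [->|nz]; first by rewrite scale0r scale0r; case: sA.
by apply: (submodule_act _ sA); apply: hA.
Qed.

(** The sum of the components of degree at most -n, described by coordinates; [wsize q] is the
    B(V)-degree of the q-th coordinate. *)
Definition low (n : nat) : set V :=
  [set v | forall q, (q < 24)%N -> (wsize q < n)%N -> entry (coords v) q = 0].

Lemma low_x n t v : low n v -> low n.+1 (Dx k t *: v).
Proof.
move=> hv q hq; rewrite ltnS => hqn.
have ck : all (fun t => all (fun q => all (fun j =>
    (wsize q <= wsize j)%N ==> (scoef (opx t j) q == 0)) (iota 0 24)) (iota 0 24)) perms3
  by vm_compute.
rewrite coordsZ -[Dx k t *: _]/(vact _ _) /vact dlift_gen /entry mxE big1 // => j _.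
rewrite !mxE inordK //; case: (leqP n (wsize j)) => hj.
  have q_in : q \in iota 0 24 by rewrite mem_iota.
  have j_in : val j \in iota 0 24 by rewrite mem_iota ltn_ord.
  have /implyP := allP (allP (allP ck _ (pcode_mem t)) _ q_in) _ j_in.
  by move=> /(_ (leq_trans hqn hj)) /eqP ->; rewrite mul0r.
by have := hv j (ltn_ord j) hj; rewrite /entry inord_val => ->; rewrite mulr0.
Qed.

Lemma lowD n u v : low n u -> low n v -> low n (u + v).
Proof. by move=> hu hv q hq hqn; rewrite coordsD entryD hu // hv // addr0. Qed.

Lemma low0 n : low n 0.
Proof. by move=> q _ _; rewrite coords0 entry0. Qed.

Lemma low_weak m n : (m <= n)%N -> low n `<=` low m.
Proof. by move=> mn v hv q hq hqm; apply: hv => //; apply: leq_trans mn. Qed.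

Lemma xspan_low (U : set V) n : U `<=` low n -> xspan U `<=` low n.
Proof.
move=> hU v; elim=> [u /hU //|u w _ hu _ hw|t w _ hw]; first exact: lowD.
by apply: (low_weak (leqnSn n)); apply: low_x.
Qed.

Lemma xmul_low (A : set V) n : A `<=` low n -> xmul A `<=` low n.+1.
Proof.
by move=> hA; apply: xmul_ind => [|u v|t v /hA]; [exact: low0 | exact: lowD | exact: low_x].
Qed.

(** The vector y_w v lies in N and in A = B(V) U, with a nonzero coordinate in the degree -n of U.
    As VA lives in degrees at most -(n+1), that vector is outside VA, and Nakayama applies. *)
Lemma layer (U N : set V) n r v : ds3_simple U ->
  (forall t u, U u -> Dy k t *: u = 0) -> U `<=` low n -> submodule N ->
  N v -> xspan U v -> r \in cert -> wsize r.1.2 = n -> functional r v <> 0 -> xspan U `<=` N.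
Proof.
move=> simU yU lU sN Nv Uv hr hn nz.
have sU : ds3_stable U by case: simU.
apply: (@xspan_nakayama _ _ _ sU (xkills5 k) _ (ymon k r.1.1 *: v)) => //.
- exact: submodule_act.
- exact: (submodule_act _ (xspan_submodule sU yU)).
move=> /(xmul_low (xspan_low lU)) hl; apply: nz; apply: hl; last by rewrite hn.
have ck : all (fun r => (r.1.2 < 24)%N) cert by [].
exact: (allP ck).
Qed.

Local Notation X := (xspan E).
Local Notation S := (xspan C).

Lemma E_simple : ds3_simple E.
Proof.
by have [f [fL _ <- fg fd]] := E_weight zetaP; exact: (range_simple fL fg fd (@M_sigma_simple k)).
Qed.
Lemma C_simple : ds3_simple C.
Proof.
by have [f [fL _ <- fg fd]] := C_weight zetaP; exact: (range_simple fL fg fd (@M_tau_simple k)).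
Qed.
Lemma ket_simple : ds3_simple (range (@ket k M)).
Proof.
have kL (a : k) (u w : M) : ket (a *: u + w) = a%:A *: ket u + ket w :> V.
  by rewrite ketD ketZ.
exact: (range_simple kL (@ketg k M) (@ketd k M) (@M_rho_simple k char0 zeta zetaP)).
Qed.

Lemma X_submodule : submodule X.
Proof. by have [sE _] := E_simple; apply: xspan_submodule => // t u; exact: E_y. Qed.
Lemma S_submodule : submodule S.
Proof. by have [sC _] := C_simple; apply: xspan_submodule => // t u; exact: C_y. Qed.

Lemma E_low : E `<=` low 1.
Proof.
move=> _ [a ->]; apply: (big_ind (low 1)) => [|u v|i _]; [exact: low0 | exact: lowD |].
move=> q hq; rewrite coordsZ e_vec_coords entry_scalar entry_mvec // => hqn.
have ck : all (fun i => all (fun q => (wsize q < 1)%N ==> (scoef (hw i) q == 0)) (iota 0 24))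
  (iota 0 3) by vm_compute.
have q_in : q \in iota 0 24 by rewrite mem_iota.
by have /implyP/(_ hqn)/eqP -> := allP (forall_I3 ck i) _ q_in; rewrite mulr0.
Qed.

Lemma C_low : C `<=` low 2.
Proof.
move=> _ [a ->]; apply: (big_ind (low 2)) => [|u v|i _]; [exact: low0 | exact: lowD |].
move=> q hq; rewrite coordsZ c_vec_coords !entry_scalar entry_mvec // => hqn.
have ck : all (fun i => all (fun q =>
    (wsize q < 2)%N ==> (scoef (hw (3 + i)) q == 0)) (iota 0 24)) (iota 0 2) by vm_compute.
have q_in : q \in iota 0 24 by rewrite mem_iota.
have i_in : val i \in iota 0 2 by rewrite mem_iota ltn_ord.
by have /implyP/(_ hqn)/eqP -> := allP (allP ck _ i_in) _ q_in; rewrite !mulr0.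
Qed.

Lemma hwvec_X h : (h < 3)%N -> X (hwvec h).
Proof. by move=> h3; rewrite /hwvec h3; apply: xspan_base; apply: kspan_mem. Qed.
Lemma hwvec_S h : (3 <= h < 5)%N -> S (hwvec h).
Proof.
case/andP=> h3 h5; rewrite /hwvec ltnNge h3 h5 /=; apply: (submodule_act _ S_submodule).
by apply: xspan_base; apply: kspan_mem.
Qed.

Lemma S_sub_X : S `<=` X.
Proof.
(* The three products x_t e_i of degree tau are x_(12) e_1, x_(23) e_2 and x_(13) e_0; their sum is
   -3 times the integral multiple of c. Then sigma c follows by applying sigma. *)
pose c_comb : xcomb := xc (-1) [:: la] 1 ++ xc (-1) [:: lb] 2 ++ xc (-1) [:: lc] 0.
have hc : X (hwvec 3).
  apply: (@mulrn_mem _ _ 2); first exact: X_submodule.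
  have -> : hwvec 3 *~ 3 = xcombv c_comb.
    apply: coords_inj; rewrite coordsMz hwvec_coords // xcombv_coords // -mvec_scale.
    by apply: mvec_eqv; vm_compute.
  apply: xcombv_mem; first exact: X_submodule.
  by move=> z; rewrite !inE => /or3P [] /eqP ->; apply: hwvec_X.
have hc0 : X (c_elt zetaP).
  have -> : c_elt zetaP = (zeta ^+ 2 - zeta)%:A *: hwvec 3.
    have -> : hwvec 3 = ((zeta ^+ 2 - zeta)^-1)%:A *: c_elt zetaP.
      by rewrite /hwvec /= /c_vec inordK.
    by rewrite scalerA scalarM mulfV ?zeta_diff_neq0 // !scale1r.
  exact: (submodule_act _ X_submodule).
have sX := submodule_stable X_submodule.
have CX : C `<=` X.
  by apply: kspan_sub => // i; rewrite /c_vec; case: ifP => // _; apply: (ds3_g sX).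
move=> v; elim=> [u /CX //|u w _ hu _ hw|t w _ hw]; first exact: (ds3_D sX).
exact: (submodule_act _ X_submodule).
Qed.

Lemma cert1_X r : r \in cert1 ++ cert2 -> X (xcombv r.2).
Proof.
move=> hr; apply: xcombv_mem; first exact: X_submodule.
have ck : all (fun r => all (fun z => (z.2 < 5)%N) r.2) (cert1 ++ cert2) by [].
move=> z hz; have h5 := allP (allP ck _ hr) _ hz.
case: (ltnP z.2 3) => h3; first exact: hwvec_X.
by apply/S_sub_X/hwvec_S; rewrite h3.
Qed.

Lemma cert2_S r : r \in cert2 -> S (xcombv r.2).
Proof.
move=> hr; apply: xcombv_mem; first exact: S_submodule.
have ck : all (fun r => all (fun z => (3 <= z.2 < 5)%N) r.2) cert2 by [].
by move=> z hz; apply: hwvec_S; apply: (allP (allP ck _ hr)).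
Qed.

Lemma functional_low (A : set V) n r v : submodule A -> A `<=` low n -> A v ->
  (r.1.2 < 24)%N -> (wsize r.1.2 < n)%N -> functional r v = 0.
Proof. by move=> sA lA Av h24 hn; apply: lA => //; apply: (submodule_act _ sA). Qed.

Lemma cert_cases r : r \in cert -> (r.1.2 < 24)%N /\
  [\/ r \in cert0 /\ wsize r.1.2 = 0%N, r \in cert1 /\ wsize r.1.2 = 1%N |
      r \in cert2 /\ wsize r.1.2 = 2%N].
Proof.
have c0 : all (fun r => (r.1.2 < 24)%N && (wsize r.1.2 == 0%N)) cert0 by [].
have c1 : all (fun r => (r.1.2 < 24)%N && (wsize r.1.2 == 1%N)) cert1 by [].
have c2 : all (fun r => (r.1.2 < 24)%N && (wsize r.1.2 == 2%N)) cert2 by [].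
rewrite /cert !mem_cat => /or3P [] hr.
- by have /andP [? /eqP] := allP c0 _ hr; split=> //; constructor 1.
- by have /andP [? /eqP] := allP c1 _ hr; split=> //; constructor 2.
- by have /andP [? /eqP] := allP c2 _ hr; split=> //; constructor 3.
Qed.

(** By contraposition: if N is proper, [layer] forces every functional of [cert0] to vanish at v,
    and the dual vectors of the other rows lie in X. *)
Lemma top_layer (N : set V) v : submodule N -> N v -> ~ X v -> N = [set: V].
Proof.
move=> sN Nv nX; apply: contrapT => nN; apply: nX.
apply: decomposition_mem; first exact: X_submodule.
move=> r hr nz; have [h24 []] := cert_cases hr => -[h hs].
- case: nN; apply/seteqP; split=> // u _.
  apply: (layer ket_simple (@range_ket_y _ _) _ sN Nv (verma_xspan v) hr hs nz) => //.
  exact: verma_xspan.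
- by apply: cert1_X; rewrite mem_cat h.
- by apply: cert1_X; rewrite mem_cat h orbT.
Qed.

(** Here the functionals of [cert0] vanish for degree reasons: y_w v stays in X, which has no
    component in degree 0. *)
Lemma middle_layer (N : set V) v : submodule N -> N v -> X v -> ~ S v -> X `<=` N.
Proof.
move=> sN Nv Xv nS; apply: contrapT => nN; apply: nS.
have lX := xspan_low E_low.
apply: decomposition_mem; first exact: S_submodule.
move=> r hr nz; have [h24 []] := cert_cases hr => -[h hs].
- by case: nz; apply: (functional_low X_submodule lX Xv) => //; rewrite hs.
- by case: nN; exact: (layer E_simple (@E_y _ _ _) E_low sN Nv Xv hr hs nz).
- exact: cert2_S.
Qed.

Lemma bottom_layer (N : set V) v : submodule N -> N v -> S v -> v <> 0 -> S `<=` N.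
Proof.
move=> sN Nv Sv v0; apply: contrapT => nN; apply: v0.
have lS := xspan_low C_low.
(* With A = 0 this says that v is 0 once all functionals vanish at v. *)
apply: (@decomposition_mem [set 0]).
  by split=> // a _ _ -> ->; rewrite scaler0 addr0.
move=> r hr nz; have [h24 []] := cert_cases hr => -[h hs].
- by case: nz; apply: (functional_low S_submodule lS Sv) => //; rewrite hs.
- by case: nz; apply: (functional_low S_submodule lS Sv) => //; rewrite hs.
- by case: nN; exact: (layer C_simple (@C_y _ _ _) C_low sN Nv Sv hr hs nz).
Qed.

End Lattice.

(** * Submodules, radical and socle *)

Section Structure.
Variables (k : fieldType) (char0 : [pchar k] =i pred0).
Variables (zeta : k) (zetaP : 3.-primitive_root zeta).
Local Notation M := (M_e_rho zetaP).
Local Notation V := (verma M).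
Local Notation E := (kspan (e_vec zetaP)).
Local Notation C := (kspan (c_vec zetaP)).
Local Notation X := (xspan E).
Local Notation S := (xspan C).

(** Strictness of the inclusions, here and in the next two lemmas, is seen on one coordinate: of 1 -
    3 in degree 0, of e_1 in degree -1, and of sigma c in degree -2. *)
Lemma top_factor : simple_factor [set: V] X.
Proof.
apply: simple_factorP => //; first exact: X_submodule.
  split=> // /(_ (hwvec zetaP 5) I) /(xspan_low (@E_low _ _ zetaP)) /(_ 0%N isT isT).
  by rewrite hwvec_coords // entry_mvec // => /eqP; rewrite oner_eq0.
by move=> N v sN Nv _ nX; rewrite (top_layer char0 sN Nv nX).
Qed.

Lemma middle_factor : simple_factor X S.
Proof.
apply: simple_factorP; [exact: X_submodule | exact: S_submodule | |].
  split; first exact: S_sub_X.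
  move=> /(_ _ (@hwvec_X _ _ zetaP 1 isT)) /(xspan_low (@C_low _ _ zetaP)) /(_ 5%N isT isT).
  by rewrite hwvec_coords // entry_mvec // => /eqP; rewrite oppr_eq0 oner_eq0.
by move=> N v sN Nv Xv nS; apply: (middle_layer char0 sN Nv Xv nS).
Qed.

Lemma bottom_factor : simple_factor S [set 0].
Proof.
apply: simple_factorP; [exact: S_submodule | | |].
- by split=> // a _ _ -> ->; rewrite scaler0 addr0.
- split=> [_ ->|]; first by case: (S_submodule zetaP).
  move=> /(_ _ (@hwvec_S _ _ zetaP 4 isT)) h; have := hwvec_coords zetaP (h := 4) isT.
  rewrite h coords0 => /(congr1 (fun u => entry u 8)).
  by rewrite entry0 entry_mvec // => /esym/eqP; rewrite oner_eq0.
by move=> N v sN Nv Sv v0; apply: (bottom_layer char0 sN Nv Sv v0).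
Qed.

Lemma submodule_cases (N : set V) : submodule N ->
  [\/ N = [set 0], N = S, N = X | N = [set: V]].
Proof.
move=> sN; case: (pselect (N `<=` X)) => [NX|]; last first.
  move=> /existsNP [v /not_implyP [Nv nX]]; constructor 4; exact: (top_layer char0 sN Nv nX).
case: (pselect (N `<=` S)) => [NS|]; last first.
  move=> /existsNP [v /not_implyP [Nv nS]]; constructor 3; apply/seteqP; split=> //.
  exact: (middle_layer char0 sN Nv (NX v Nv) nS).
case: (pselect (N `<=` [set 0])) => [N0|]; last first.
  move=> /existsNP [v /not_implyP [Nv n0]]; constructor 2; apply/seteqP; split=> //.
  exact: (bottom_layer char0 sN Nv (NS v Nv) n0).
constructor 1; apply/seteqP; split=> // _ ->; by case: sN.
Qed.

Lemma ket_inj : injective (@ket k M).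
Proof.
have hE (m : M) :
    entry (rho_vmod m) 0 = rho_coord m pt1 /\ entry (rho_vmod m) 1 = rho_coord m pt2.
  rewrite /rho_vmod big_I3 [rhov pt3]/= mvec_nil scaler0 addr0.
  rewrite !entryD !entry_scalar !entry_mvec //=.
  by rewrite !addr0 !mulr0 !mulr1 addr0 add0r.
move=> u v /(congr1 (@coords k zeta zetaP)); rewrite !coords_ket => h.
have [u1 u2] := hE u; have [v1 v2] := hE v.
by rewrite (rho_decomp u) (rho_decomp v) -u1 -u2 -v1 -v2 h.
Qed.

Lemma radical_X : radical V = X.
Proof. exact: (radicalE (@M_rho_simple k char0 zeta zetaP) top_factor). Qed.

(** S is the only simple submodule: by the classification the other candidates are X and the whole
    module, and both contain S properly. *)
Lemma socle_S : socle V = S.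
Proof.
have [_ _ [SX nXS] _] := middle_factor; have [_ _ [_ nS0] _] := bottom_factor.
have [_ _ [_ nTX] _] := top_factor.
have s0S : [set 0] `<=` S by move=> _ ->; case: (S_submodule zetaP).
have S_least W : simple_submodule W -> W = S.
  move=> [sW s0 [_ nW0] hW]; case: (submodule_cases sW) => // eW; rewrite {}eW in sW nW0 hW *.
  - by case: nW0.
  - by case: (hW S (S_submodule zetaP) s0S SX) => [eS|->//]; case: nS0; rewrite eS.
  - case: (hW S (S_submodule zetaP) s0S (@subsetT _ _)) => eS; first by case: nS0; rewrite eS.
    by case: nTX => v _; apply: SX; rewrite eS.
apply/seteqP; split=> v.
  apply; split; first exact: S_submodule.
  by move=> u [W sW]; rewrite (S_least W sW).
by move=> Sv N [_ hN]; apply: hN; exists S => //; exact: bottom_factor.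
Qed.

End Structure.
Theorem theorem10 (k : closedFieldType) (char0 : [pchar k] =i pred0)
    (zeta : k) (zetaP : 3.-primitive_root zeta) :
  let M := M_e_rho zetaP in
  let X := radical (verma M) in
  let S := socle (verma M) in
  let E := kspan (e_vec zetaP) in
  let C := kspan (c_vec zetaP) in
  [/\ (maximal_submodule X /\
       forall W : set (verma M), maximal_submodule W -> W = X),
      (S `<` X /\
       forall W : set (verma M),
         [/\ submodule W, W <> [set 0] & W <> [set: verma M]]
         <-> W = S \/ W = X),
      [/\ kfree (e_vec zetaP), E `<=` vdeg M 1, has_weight E (M_sigma_sgn k),
          X = submod_generated E & highest_weight X (M_sigma_sgn k)],
      [/\ kfree (c_vec zetaP), C `<=` vdeg M 2, has_weight C (M_tau_0 k),
          S = submod_generated C & highest_weight S (M_tau_0 k)] &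
      composition_factors (verma M)
        (fun i : 'I_3 => match val i with
           | 0%N => L_head M
           | 1%N => L_head (M_sigma_sgn k)
           | _ => L_head (M_tau_0 k)
           end)].

Proof.
move=> M X S E C.
have simM : module_simple M by exact: M_rho_simple.
have ss := @M_sigma_simple k; have st := @M_tau_simple k.
have Wk : has_weight (range (@ket k M)) M.
  exists (@ket k M); split=> //.
  - by move=> a u v; rewrite ketD ketZ.
  - by move=> u v; apply: ket_inj.
  - exact: ketg.
  - exact: ketd.
have top := top_factor char0 zetaP; have mid := middle_factor char0 zetaP.
have bot := bottom_factor char0 zetaP.
have [sE _] := E_simple zetaP; have [sC _] := C_simple zetaP.
have XE : X = xspan E := radical_X char0 zetaP.
have SC : S = xspan C := socle_S char0 zetaP.
have gE : submod_generated E = xspan E.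
  by apply: submod_generatedE => // t u; exact: E_y.
have gC : submod_generated C = xspan C.
  by apply: submod_generatedE => // t u; exact: C_y.
have [_ _ SX _] := mid; have [_ _ S0 _] := bot; have [_ _ XT _] := top.
split.
- rewrite XE; split=> // W mW; exact: verma_maximal_unique mW top.
- rewrite SC XE; split=> // W; split=> [[sW W0 WT]|].
    by case: (submodule_cases char0 sW) => //; [left | right].
  case=> ->; split; try exact: S_submodule; try exact: X_submodule.
  + by move=> e; case: S0 => _; rewrite e; apply.
  + by move=> e; case: SX => _; rewrite e; apply.
  + by move=> e; case: S0 => _; apply; rewrite -e; case: SX.
  + by move=> e; case: XT => _; rewrite e; apply.
- split; [exact: e_vec_free | exact: E_deg | exact: E_weight | by rewrite gE |].
  by exists E; split; [exact: E_weight | move=> t v; exact: E_y | rewrite gE].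
- split; [exact: c_vec_free | exact: C_deg | exact: C_weight | by rewrite gC |].
  by exists C; split; [exact: C_weight | move=> t v; exact: C_y | rewrite gC].
pose F (n : nat) : set (verma M) :=
  match n with 0%N => [set 0] | 1%N => xspan C | 2%N => xspan E | _ => [set: verma M] end.
(* From the bottom up the factors have weights (tau,0), (sigma,-), (e,rho), the reverse of the
   listed order; hence the exchange of the first and last index. *)
exists F, (tperm pt1 pt3); split=> // i; case: (I3_cases i) => ->.
- rewrite tpermL /=; split=> //.
  by apply: (factor_head st (C_weight zetaP)) bot => // t v; exact: C_y.
- rewrite tpermD //=; split=> //.
  by apply: (factor_head ss (E_weight zetaP)) mid => // t v; exact: E_y.
- rewrite tpermR /=; split=> //.
  apply: (factor_head simM Wk) top => [t v|]; first exact: range_ket_y.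
  by apply/seteqP; split=> // v _; exact: verma_xspan.
Qed.
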